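(* The $(\mathrm{median},-)$ convolution of two vectors of length $n$ can be computed in $O(n^2(\lg\lg n)^2/\lg n)$ time on a real RAM.
   Context: For vectors $\vec x=\langle x_0,\dots,x_{n-1}\rangle$, $\vec y=\langle y_0,\dots,y_{n-1}\rangle$ of reals, the $(\mathrm{median},-)$ convolution has $k$th entry $\mathrm{median}_{i=0}^{k}(x_i-y_{k-i})$, $k=0,\dots,n-1$. The real RAM is the model with unit-cost arithmetic operations and comparisons on real numbers. *)

(* Defs.v *)
From Stdlib Require Import Reals Lra ZArith Arith List.
Open Scope R_scope.

Definition count_lt (l : list R) (v : R) : nat :=
  length (filter (fun a => if Rlt_dec a v then true else false) l).
Definition count_le (l : list R) (v : R) : nat :=
  length (filter (fun a => if Rle_dec a v then true else false) l).

(* v is the element of rank k (0-based) of l in sorted order *)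
Definition is_rank (l : list R) (k : nat) (v : R) : Prop :=
  In v l /\ (count_lt l v <= k)%nat /\ (k < count_le l v)%nat.

(* median of a nonempty list of m values: the element of rank floor((m-1)/2)
   in sorted order (lower median; for odd m this is the usual median) *)
Definition is_median (l : list R) (v : R) : Prop :=
  is_rank l (Nat.div2 (length l - 1)) v.

Definition conv_terms (x y : list R) (k : nat) : list R :=
  map (fun i => nth i x 0 - nth (k - i) y 0) (seq 0 (S k)).

(* ---------- real RAM model ----------
   Real registers hold reals; integer registers hold w-bit words (w = Theta(lg n)).
   Unit cost per instruction. Real ops: + - * / and comparisons (no floor,
   no real-to-integer conversion).  Word ops: the standard word-RAM operations
   (arithmetic mod 2^w, bitwise ops, shifts, comparisons), indirect addressing. *)

Inductive rop := RAdd | RSub | RMul | RDiv.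
Inductive iop := IAdd | ISub | IMul | IDiv | IMod | IAnd | IOr | IXor | IShl | IShr.

Inductive instr :=
| RConst (d : nat) (c : R)
| RArith (o : rop) (d a b : nat)
| RLoad (d a : nat)
| RStore (a s : nat)
| IConst (d : nat) (c : Z)
| IArith (o : iop) (d a b : nat)
| ILoad (d a : nat)
| IStore (a s : nat)
| IToR (d a : nat)
| JmpRLt (a b t : nat)
| JmpREq (a b t : nat)
| JmpILt (a b t : nat)
| JmpIEq (a b t : nat)
| Jmp (t : nat)
| Halt.

Definition program := list instr.

Record state := mkState { pc : nat; rreg : nat -> R; ireg : nat -> Z }.

Inductive outcome := Next (s : state) | Halted (s : state) | Fault.

Definition upd {A} (f : nat -> A) (i : nat) (v : A) : nat -> A :=
  fun j => if Nat.eqb j i then v else f j.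

Definition wrap (w : nat) (z : Z) : Z := Z.modulo z (2 ^ Z.of_nat w).

Definition eval_iop (o : iop) (a b : Z) : Z :=
  match o with
  | IAdd => a + b | ISub => a - b | IMul => a * b
  | IDiv => Z.div a b | IMod => Z.modulo a b
  | IAnd => Z.land a b | IOr => Z.lor a b | IXor => Z.lxor a b
  | IShl => Z.shiftl a b | IShr => Z.shiftr a b
  end%Z.

Definition step (P : program) (w : nat) (s : state) : outcome :=
  let R := rreg s in let I := ireg s in let p := pc s in
  let nxt r i := Next (mkState (S p) r i) in
  match nth_error P p with
  | None => Halted s
  | Some ins =>
    match ins with
    | RConst d c => nxt (upd R d c) I
    | RArith o d a b =>
        match o with
        | RAdd => nxt (upd R d (R a + R b)) I
        | RSub => nxt (upd R d (R a - R b)) I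
        | RMul => nxt (upd R d (R a * R b)) I
        | RDiv => if Req_dec_T (R b) 0 then Fault else nxt (upd R d (R a / R b)) I
        end
    | RLoad d a => nxt (upd R d (R (Z.to_nat (I a)))) I
    | RStore a t => nxt (upd R (Z.to_nat (I a)) (R t)) I
    | IConst d c => nxt R (upd I d (wrap w c))
    | IArith o d a b => nxt R (upd I d (wrap w (eval_iop o (I a) (I b))))
    | ILoad d a => nxt R (upd I d (I (Z.to_nat (I a))))
    | IStore a t => nxt R (upd I (Z.to_nat (I a)) (I t))
    | IToR d a => nxt (upd R d (IZR (I a))) I
    | JmpRLt a b t =>
        if Rlt_dec (R a) (R b) then Next (mkState t R I) else nxt R I
    | JmpREq a b t =>
        if Req_dec_T (R a) (R b) then Next (mkState t R I) else nxt R I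
    | JmpILt a b t =>
        if Z.ltb (I a) (I b) then Next (mkState t R I) else nxt R I
    | JmpIEq a b t =>
        if Z.eqb (I a) (I b) then Next (mkState t R I) else nxt R I
    | Jmp t => Next (mkState t R I)
    | Halt => Halted s
    end
  end.

Fixpoint run (P : program) (w : nat) (fuel : nat) (s : state) : option state :=
  match fuel with
  | O => match step P w s with Halted s' => Some s' | _ => None end
  | S f => match step P w s with
           | Halted s' => Some s'
           | Next s' => run P w f s'
           | Fault => None
           end
  end.

Definition init_state (n : nat) (x y : list R) : state :=
  mkState 0
    (fun j => if Nat.ltb j n then nth j x 0
              else if Nat.ltb j (2 * n) then nth (j - n) y 0 else 0)
    (fun j => if Nat.eqb j 0 then Z.of_nat n else 0%Z).

Definition word_size (K n : nat) : nat := (K * (Nat.log2 n + 1))%nat.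

Definition lg (x : R) : R := ln x / ln 2.

(* Main.v *)
(** The k-th entry is a selection problem in an antidiagonal of differences.  Cut x into blocks
    of length d, a power of two of order lg n / lg lg n.  The antidiagonal k is a union of n/d
    groups, one per block of x facing a window of d consecutive entries of y; if every group is
    available in sorted order, the algorithm of Frederickson and Johnson selects in it in time
    O((n/d) lg d), which gives the theorem.

    Sorting all pairs (block, window) would be too slow, but by Fredman's identity
    x_r - y_r <= x_t - y_t <-> x_r - x_t <= y_r - y_t the sorted order of a pair depends only on
    how the differences within the window compare with those within the block.  For a batch of
    s = d^2 blocks a window is thus described by its ranks in d^2 sorted lists of length s, found
    by binary search.  The windows with the same ranks form a cell of an arrangement of s d^2
    hyperplanes y_p - y_q = c in dimension d, so at most (s d^2 + 1)^d of them need sorting; this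
    number is at most n^(1/4), and the other windows look up the sorted orders in a dictionary.

    The algorithm is a program in a small imperative language, whose compilation to the RAM
    multiplies the running time by at most the length of the compiled code. *)

Require Import Defs.
From Stdlib Require Import Reals Lra Lia ZArith Arith List Bool Permutation.
Import ListNotations.
Local Open Scope nat_scope.

(** The parameters come from balancing. Selection costs O((n/d) lg d) per entry, hence O(n^2 lg d /
    d) in all. The signatures cost n/(d s) batches times n windows times d^2 searches of O(lg s)
    steps, that is O(n^2 d lg s / s), and s = d^2 is the size of a batch at which this drops to the
    cost of the selections. The number of cells is at most 2^(5 d lg d). Keeping the fourth power of
    this bound below n is what limits d to lg n / lg lg n; in return the dictionary can be
    maintained crudely, in time cubic in the number of cells per batch, which is still linear in n.

    The last block on an antidiagonal meets a window that reaches beyond the start of y. Padding y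
    with numbers far below all data turns the surplus terms into values above every genuine term.
    The lower median has rank at most k, so it is not disturbed by them, and all groups have the
    same length d. *)

(** * A small imperative language with running times *)

Inductive bop := Plus | Minus | Times | Quot | Rem.

Inductive iexp :=
| Vr (v : nat) | Cn (c : nat) | Bi (o : bop) (a b : iexp) | Ar (a : nat) (e : iexp).

Inductive rexp :=
| RVr (v : nat) | RCn (c : R) | RBi (o : rop) (a b : rexp)
| RAr (a : nat) (e : iexp) | RI (e : iexp).

Inductive cnd := CLt (a b : iexp) | CRlt (a b : rexp).

Inductive cmd :=
| Skip
| IAsg (v : nat) (e : iexp)
| RAsg (v : nat) (r : rexp)
| ISto (a : nat) (e1 e2 : iexp)
| RSto (a : nat) (e : iexp) (r : rexp)
| Seq (c1 c2 : cmd)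
| If (b : cnd) (c1 c2 : cmd)
| While (b : cnd) (c : cmd).

Record st := mkSt {
  iv : nat -> nat; rv : nat -> R; ia : nat -> nat -> nat; ra : nat -> nat -> R }.

Definition put {A} (f : nat -> A) (i : nat) (v : A) : nat -> A :=
  fun j => if Nat.eqb j i then v else f j.

Definition set_iv s v x := mkSt (put (iv s) v x) (rv s) (ia s) (ra s).
Definition set_rv s v x := mkSt (iv s) (put (rv s) v x) (ia s) (ra s).
Definition set_ia s a i x := mkSt (iv s) (rv s) (put (ia s) a (upd (ia s a) i x)) (ra s).
Definition set_ra s a i x := mkSt (iv s) (rv s) (ia s) (put (ra s) a (upd (ra s a) i x)).

Definition beval (o : bop) (a b : nat) : nat :=
  match o with
  | Plus => a + b | Minus => a - b | Times => a * b | Quot => a / b | Rem => a mod b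
  end.

Fixpoint ieval (s : st) (e : iexp) : nat :=
  match e with
  | Vr v => iv s v
  | Cn c => c
  | Bi o a b => beval o (ieval s a) (ieval s b)
  | Ar a e => ia s a (ieval s e)
  end.

Definition reval_op (o : rop) (a b : R) : R :=
  match o with
  | RAdd => (a + b)%R | RSub => (a - b)%R | RMul => (a * b)%R | RDiv => (a / b)%R
  end.

Fixpoint reval (s : st) (r : rexp) : R :=
  match r with
  | RVr v => rv s v
  | RCn c => c
  | RBi o a b => reval_op o (reval s a) (reval s b)
  | RAr a e => ra s a (ieval s e)
  | RI e => INR (ieval s e)
  end.

Definition ceval (s : st) (b : cnd) : bool :=
  match b with
  | CLt a b => ieval s a <? ieval s b
  | CRlt a b => if Rlt_dec (reval s a) (reval s b) then true else false
  end.

(* A program gets stuck instead of producing an integer of lM m or more or a negative one: below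
   lM m neither wrapping modulo 2^w nor truncated subtraction can show. *)
Record lim := mkLim { lM : nat; lN : nat }.

Definition bok (m : lim) (o : bop) (a b : nat) : Prop :=
  match o with
  | Plus => a + b < lM m | Minus => b <= a | Times => a * b < lM m | _ => True
  end.

Fixpoint iok (m : lim) (s : st) (e : iexp) : Prop :=
  match e with
  | Vr _ => True
  | Cn c => c < lM m
  | Bi o a b => iok m s a /\ iok m s b /\ bok m o (ieval s a) (ieval s b)
  | Ar a e => iok m s e /\ ieval s e < lM m
  end.

(** Array 0 is the raw register file: below 16 lie the scalars and temporaries of the compiled code,
    from 3n on the other arrays. *)
Definition idx_ok (m : lim) (a i : nat) : Prop :=
  match a with O => 16 <= i < 3 * lN m | _ => i < lM m end.

(** Division is ruled out, so compiled code cannot reach [Fault]. *)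
Fixpoint rok (m : lim) (s : st) (r : rexp) : Prop :=
  match r with
  | RVr _ => True
  | RCn _ => True
  | RBi o a b => rok m s a /\ rok m s b /\ match o with RDiv => False | _ => True end
  | RAr a e => iok m s e /\ idx_ok m a (ieval s e)
  | RI e => iok m s e
  end.

Definition cok (m : lim) (s : st) (b : cnd) : Prop :=
  match b with
  | CLt a b => iok m s a /\ iok m s b
  | CRlt a b => rok m s a /\ rok m s b
  end.

(** Each assignment and each test costs one unit, however large its expressions are: their size is
    fixed by the program text and is accounted for by the length of the compiled code. *)
Inductive exec (m : lim) : cmd -> st -> st -> nat -> Prop :=
| E_skip s : exec m Skip s s 0
| E_iasg v e s : iok m s e -> exec m (IAsg v e) s (set_iv s v (ieval s e)) 1
| E_rasg v r s : rok m s r -> exec m (RAsg v r) s (set_rv s v (reval s r)) 1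
| E_isto a e1 e2 s : iok m s e1 -> iok m s e2 -> ieval s e1 < lM m ->
    exec m (ISto a e1 e2) s (set_ia s a (ieval s e1) (ieval s e2)) 1
| E_rsto a e r s : iok m s e -> rok m s r -> idx_ok m a (ieval s e) ->
    exec m (RSto a e r) s (set_ra s a (ieval s e) (reval s r)) 1
| E_seq c1 c2 s s1 s2 t1 t2 : exec m c1 s s1 t1 -> exec m c2 s1 s2 t2 ->
    exec m (Seq c1 c2) s s2 (t1 + t2)
| E_ift b c1 c2 s s1 t : cok m s b -> ceval s b = true -> exec m c1 s s1 t ->
    exec m (If b c1 c2) s s1 (1 + t)
| E_iff b c1 c2 s s1 t : cok m s b -> ceval s b = false -> exec m c2 s s1 t ->
    exec m (If b c1 c2) s s1 (1 + t)
| E_whf b c s : cok m s b -> ceval s b = false -> exec m (While b c) s s 1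
| E_wht b c s s1 s2 t1 t2 : cok m s b -> ceval s b = true -> exec m c s s1 t1 ->
    exec m (While b c) s1 s2 t2 -> exec m (While b c) s s2 (1 + t1 + t2).

(** * Compilation to the RAM *)

(* Integer registers: scalars 0..63, temporaries 64..95, register 100 holds 3n, cell i of
   array a is 128 + 8i + a.  Real registers: scalars 0..7, temporaries 8..15, cell i of array
   a > 0 is 3n + 8i + a, and array 0 is the raw input/output area itself. *)

Definition bi (o : bop) : iop :=
  match o with Plus => IAdd | Minus => ISub | Times => IMul | Quot => IDiv | Rem => IMod end.

Definition iaddr (k a : nat) : list instr :=
  [IConst (65 + k) 8; IArith IMul (64 + k) (64 + k) (65 + k);
   IConst (65 + k) (Z.of_nat (128 + a)); IArith IAdd (64 + k) (64 + k) (65 + k)].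

(** The temporaries from 64 on form an evaluation stack; at depth k the result goes to 64 + k.
    Copying a register is done by adding zero. *)
Fixpoint ci (e : iexp) (k : nat) : list instr :=
  match e with
  | Vr v => [IConst (65 + k) 0; IArith IAdd (64 + k) v (65 + k)]
  | Cn c => [IConst (64 + k) (Z.of_nat c)]
  | Bi o a b => ci a k ++ ci b (S k) ++ [IArith (bi o) (64 + k) (64 + k) (65 + k)]
  | Ar a e => ci e k ++ iaddr k a ++ [ILoad (64 + k) (64 + k)]
  end.

Definition raddr (a : nat) : list instr :=
  match a with
  | O => []
  | _ => [IConst 65 8; IArith IMul 64 64 65; IConst 65 (Z.of_nat a);
          IArith IAdd 64 64 65; IArith IAdd 64 64 100]
  end.

(** Integer subexpressions start again at depth 0, since the partial results of a real expression
    occupy real registers only. *)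
Fixpoint cr (r : rexp) (k : nat) : list instr :=
  match r with
  | RVr v => [RConst (9 + k) 0; RArith RAdd (8 + k) v (9 + k)]
  | RCn c => [RConst (8 + k) c]
  | RBi o a b => cr a k ++ cr b (S k) ++ [RArith o (8 + k) (8 + k) (9 + k)]
  | RAr a e => ci e 0 ++ raddr a ++ [RLoad (8 + k) 64]
  | RI e => ci e 0 ++ [IToR (8 + k) 64]
  end.

Definition cc (b : cnd) : list instr :=
  match b with
  | CLt a b => ci a 0 ++ ci b 1
  | CRlt a b => cr a 0 ++ cr b 1
  end.

Definition jc (b : cnd) (t : nat) : instr :=
  match b with CLt _ _ => JmpILt 64 65 t | CRlt _ _ => JmpRLt 8 9 t end.

(** Jump targets are absolute, hence the load address [p]. *)
Fixpoint comp (p : nat) (c : cmd) : list instr :=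
  match c with
  | Skip => []
  | IAsg v e => ci e 0 ++ [IConst 65 0; IArith IAdd v 64 65]
  | RAsg v r => cr r 0 ++ [RConst 9 0; RArith RAdd v 8 9]
  | ISto a e1 e2 => ci e2 0 ++ ci e1 1 ++ iaddr 1 a ++ [IStore 65 64]
  | RSto a e r => cr r 0 ++ ci e 0 ++ raddr a ++ [RStore 64 8]
  | Seq c1 c2 => comp p c1 ++ comp (p + length (comp p c1)) c2
  | If b c1 c2 =>
      let p1 := p + length (cc b) + 2 in
      let l1 := comp p1 c1 in
      let p2 := p1 + length l1 + 1 in
      let l2 := comp p2 c2 in
      cc b ++ [jc b p1; Jmp p2] ++ l1 ++ [Jmp (p2 + length l2)] ++ l2
  | While b c =>
      let p1 := p + length (cc b) + 2 in
      let l1 := comp p1 c in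
      cc b ++ [jc b p1; Jmp (p1 + length l1 + 1)] ++ l1 ++ [Jmp p]
  end.

(** The register budget: the bound 31 leaves room for the second temporary 65 + k, which must not
    pass 95. *)
Fixpoint iwf (e : iexp) (k : nat) : bool :=
  match e with
  | Vr v => (v <? 64) && (k <? 31)
  | Cn _ => k <? 32
  | Bi _ a b => iwf a k && iwf b (S k) && (k <? 31)
  | Ar a e => (a <? 8) && iwf e k && (k <? 31)
  end.

Fixpoint rwf (r : rexp) (k : nat) : bool :=
  match r with
  | RVr v => (v <? 8) && (k <? 7)
  | RCn _ => k <? 8
  | RBi _ a b => rwf a k && rwf b (S k) && (k <? 7)
  | RAr a e => (a <? 8) && iwf e 0 && (k <? 8)
  | RI e => iwf e 0 && (k <? 8)
  end.

Definition cwf (b : cnd) : bool :=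
  match b with
  | CLt a b => iwf a 0 && iwf b 1
  | CRlt a b => rwf a 0 && rwf b 1
  end.

Fixpoint wf (c : cmd) : bool :=
  match c with
  | Skip => true
  | IAsg v e => (v <? 64) && iwf e 0
  | RAsg v r => (v <? 8) && rwf r 0
  | ISto a e1 e2 => (a <? 8) && iwf e2 0 && iwf e1 1
  | RSto a e r => (a <? 8) && rwf r 0 && iwf e 0
  | Seq c1 c2 => wf c1 && wf c2
  | If b c1 c2 => cwf b && wf c1 && wf c2
  | While b c => cwf b && wf c
  end.

(** * Placement of code and sequences of machine steps *)

Definition code_at (P : program) (p : nat) (l : list instr) : Prop :=
  forall i x, nth_error l i = Some x -> nth_error P (p + i) = Some x.

Lemma code_at_app P p l1 l2 :
  code_at P p (l1 ++ l2) <-> code_at P p l1 /\ code_at P (p + length l1) l2.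
Proof.
  unfold code_at; split.
  - intros H; split; intros i x Hi.
    + apply H. rewrite nth_error_app1; auto. apply nth_error_Some; congruence.
    + rewrite <- Nat.add_assoc. apply H. rewrite nth_error_app2 by lia.
      replace (length l1 + i - length l1) with i by lia; auto.
  - intros [H1 H2] i x Hi. destruct (Nat.lt_ge_cases i (length l1)).
    + rewrite nth_error_app1 in Hi; auto.
    + rewrite nth_error_app2 in Hi by lia. apply H2 in Hi.
      replace (p + i) with (p + length l1 + (i - length l1)) by lia; auto.
Qed.

Lemma code_at_cons P p x l :
  code_at P p (x :: l) <-> nth_error P p = Some x /\ code_at P (S p) l.
Proof.
  change (x :: l) with ([x] ++ l). rewrite code_at_app; simpl.
  replace (p + 1) with (S p) by lia. split; intros [H1 H2]; split; auto.
  - rewrite <- (Nat.add_0_r p). apply H1; auto.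
  - intros [|[|i]] y Hy; simpl in Hy; inversion Hy; subst. rewrite Nat.add_0_r; auto.
Qed.

Fixpoint steps (P : program) (w k : nat) (x y : state) : Prop :=
  match k with
  | O => x = y
  | S k => exists z, step P w x = Next z /\ steps P w k z y
  end.

Lemma steps_trans P w k1 k2 x y z :
  steps P w k1 x y -> steps P w k2 y z -> steps P w (k1 + k2) x z.
Proof.
  revert x; induction k1 as [|k1 IH]; simpl; intros x H1 H2; [subst; auto|].
  destruct H1 as (u & Hu & H1). exists u; eauto.
Qed.

Lemma steps_S P w k x y z : steps P w 1 x y -> steps P w k y z -> steps P w (S k) x z.
Proof. apply (steps_trans P w 1 k). Qed.

Lemma steps_run P w k x y fuel : steps P w k x y -> step P w y = Halted y -> k <= fuel ->
  run P w fuel x = Some y.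
Proof.
  revert x fuel; induction k as [|k IH]; simpl; intros x fuel H Hy Hf.
  - subst. destruct fuel; simpl; rewrite Hy; auto.
  - destruct H as (z & Hz & H). destruct fuel as [|fuel]; [lia|]. simpl. rewrite Hz.
    apply IH; auto; lia.
Qed.

Lemma wrap_small w z : (0 <= z < 2 ^ Z.of_nat w)%Z -> wrap w z = z.
Proof. intros; unfold wrap; apply Z.mod_small; auto. Qed.

Lemma upd_same {A} (f : nat -> A) i v : upd f i v i = v.
Proof. unfold upd; rewrite Nat.eqb_refl; auto. Qed.

Lemma upd_other {A} (f : nat -> A) i v j : j <> i -> upd f i v j = f j.
Proof. intros; unfold upd. destruct (Nat.eqb_spec j i); congruence. Qed.

Section Correct.
#[local] Arguments Nat.add : simpl never.
#[local] Arguments steps : simpl never.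
#[local] Arguments Nat.mul : simpl never.
#[local] Arguments Z.mul : simpl never.
#[local] Arguments Z.add : simpl never.
#[local] Arguments Z.of_nat : simpl never.
Variables (P : program) (w : nat) (m : lim).
(** The largest addresses formed are 128 + 8i + a and 3n + 8i + a with i < [lM m] and a < 8; below
    2^w address arithmetic does not wrap. *)
Hypothesis Hm : (8 * Z.of_nat (lM m) + 256 + 3 * Z.of_nat (lN m) <= 2 ^ Z.of_nat w)%Z.
Hypothesis HM16 : 16 <= 3 * lN m.

Notation W := (2 ^ Z.of_nat w)%Z.

(** Agreement alone would not do: [iok] puts no bound on the value of a variable or a cell, and a
    copy of it is only faithful if it fits into a word. *)
Record rel (s : st) (rr : nat -> R) (ii : nat -> Z) : Prop := {
  rel_iv : forall v, v < 64 -> ii v = Z.of_nat (iv s v) /\ (Z.of_nat (iv s v) < W)%Z;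
  rel_ia : forall a i, a < 8 -> i < lM m ->
    ii (128 + i * 8 + a) = Z.of_nat (ia s a i) /\ (Z.of_nat (ia s a i) < W)%Z;
  rel_off : ii 100 = Z.of_nat (3 * lN m);
  rel_rv : forall v, v < 8 -> rr v = rv s v;
  rel_raw : forall i, 16 <= i < 3 * lN m -> rr i = ra s 0 i;
  rel_ra : forall a i, 0 < a < 8 -> i < lM m -> rr (3 * lN m + i * 8 + a) = ra s a i }.

(** Evaluation at depth k may touch only the temporaries from k upwards, so partial results of
    smaller depth survive. *)
Definition ipres (k : nat) (ii ii' : nat -> Z) : Prop :=
  forall j, j < 64 + k \/ 96 <= j -> ii' j = ii j.
Definition rpres (k : nat) (rr rr' : nat -> R) : Prop :=
  forall j, j < 8 + k \/ 16 <= j -> rr' j = rr j.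

Lemma rel_pres s rr ii rr' ii' k l :
  rel s rr ii -> ipres k ii ii' -> rpres l rr rr' -> rel s rr' ii'.
Proof.
  intros H Hi Hr. unfold ipres, rpres in *. destruct H. constructor; intros.
  - rewrite Hi by lia; auto.
  - rewrite Hi by lia; auto.
  - rewrite Hi by lia; auto.
  - rewrite Hr by lia; auto.
  - rewrite Hr by lia; auto.
  - rewrite Hr by lia; auto.
Qed.

Lemma ipres_refl k ii : ipres k ii ii. Proof. intros ? ?; auto. Qed.
Lemma rpres_refl k rr : rpres k rr rr. Proof. intros ? ?; auto. Qed.

Lemma rel_ipres s rr ii ii' k : rel s rr ii -> ipres k ii ii' -> rel s rr ii'.
Proof. intros H Hi. exact (rel_pres _ _ _ _ _ k 0 H Hi (rpres_refl _ _)). Qed.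

Lemma ieval_lt s rr ii e k : rel s rr ii -> iwf e k = true -> iok m s e ->
  (Z.of_nat (ieval s e) < W)%Z.
Proof.
  intros H. revert k; induction e as [v|c|o a IHa b IHb|a e IH]; simpl; intros k Hw Hk.
  - apply andb_prop in Hw as [Hv _]. apply Nat.ltb_lt in Hv. apply (rel_iv _ _ _ H); auto.
  - lia.
  - apply andb_prop in Hw as [Hw _]. apply andb_prop in Hw as [Ha Hb].
    destruct Hk as (Ka & Kb & Ko). specialize (IHa _ Ha Ka). specialize (IHb _ Hb Kb).
    destruct o; cbn [beval bok] in *; try lia.
    + eapply Z.le_lt_trans; [|exact IHa]. apply inj_le.
      destruct (ieval s b) eqn:E; [simpl; lia|]; apply Nat.Div0.div_le_upper_bound; nia.
    + eapply Z.le_lt_trans; [|exact IHa]. apply inj_le, Nat.Div0.mod_le.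
  - apply andb_prop in Hw as [Hw _]. apply andb_prop in Hw as [Ha Hb].
    apply Nat.ltb_lt in Ha. apply (rel_ia _ _ _ H); tauto.
Qed.

Lemma st_iconst p rr ii d c : nth_error P p = Some (IConst d c) -> (0 <= c < W)%Z ->
  steps P w 1 (mkState p rr ii) (mkState (S p) rr (upd ii d c)).
Proof.
  intros H Hc. hnf. eexists; split; [|reflexivity]. unfold step; simpl; rewrite H.
  rewrite wrap_small; auto.
Qed.

Lemma st_iarith p rr ii o d a b x : nth_error P p = Some (IArith o d a b) ->
  eval_iop o (ii a) (ii b) = x -> (0 <= x < W)%Z ->
  steps P w 1 (mkState p rr ii) (mkState (S p) rr (upd ii d x)).
Proof.
  intros H <- Hc. hnf. eexists; split; [|reflexivity]. unfold step; simpl; rewrite H.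
  rewrite wrap_small; auto.
Qed.

Lemma st_iload p rr ii d a : nth_error P p = Some (ILoad d a) ->
  steps P w 1 (mkState p rr ii) (mkState (S p) rr (upd ii d (ii (Z.to_nat (ii a))))).
Proof. intros H. hnf. eexists; split; [|reflexivity]. unfold step; simpl; rewrite H; auto. Qed.

Lemma st_istore p rr ii a b : nth_error P p = Some (IStore a b) ->
  steps P w 1 (mkState p rr ii) (mkState (S p) rr (upd ii (Z.to_nat (ii a)) (ii b))).
Proof. intros H. hnf. eexists; split; [|reflexivity]. unfold step; simpl; rewrite H; auto. Qed.

Lemma st_rconst p rr ii d c : nth_error P p = Some (RConst d c) ->
  steps P w 1 (mkState p rr ii) (mkState (S p) (upd rr d c) ii).
Proof. intros H. hnf. eexists; split; [|reflexivity]. unfold step; simpl; rewrite H; auto. Qed.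

Lemma st_rarith p rr ii o d a b : nth_error P p = Some (RArith o d a b) -> o <> RDiv ->
  steps P w 1 (mkState p rr ii) (mkState (S p) (upd rr d (reval_op o (rr a) (rr b))) ii).
Proof.
  intros H Ho. hnf. eexists; split; [|reflexivity]. unfold step; simpl; rewrite H.
  destruct o; auto; congruence.
Qed.

Lemma st_rload p rr ii d a : nth_error P p = Some (RLoad d a) ->
  steps P w 1 (mkState p rr ii) (mkState (S p) (upd rr d (rr (Z.to_nat (ii a)))) ii).
Proof. intros H. hnf. eexists; split; [|reflexivity]. unfold step; simpl; rewrite H; auto. Qed.

Lemma st_rstore p rr ii a b : nth_error P p = Some (RStore a b) ->
  steps P w 1 (mkState p rr ii) (mkState (S p) (upd rr (Z.to_nat (ii a)) (rr b)) ii).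
Proof. intros H. hnf. eexists; split; [|reflexivity]. unfold step; simpl; rewrite H; auto. Qed.

Lemma st_itor p rr ii d a : nth_error P p = Some (IToR d a) ->
  steps P w 1 (mkState p rr ii) (mkState (S p) (upd rr d (IZR (ii a))) ii).
Proof. intros H. hnf. eexists; split; [|reflexivity]. unfold step; simpl; rewrite H; auto. Qed.

Ltac ups := repeat (rewrite upd_same || (rewrite upd_other by lia)).

Lemma iaddr_ok a k p rr ii i : a < 8 -> i < lM m -> k < 31 ->
  code_at P p (iaddr k a) -> ii (64 + k) = Z.of_nat i ->
  exists ii', steps P w 4 (mkState p rr ii) (mkState (4 + p) rr ii') /\
    ipres k ii ii' /\ ii' (64 + k) = Z.of_nat (128 + i * 8 + a).
Proof.
  intros Ha Hi Hk HC E. unfold iaddr in HC.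
  rewrite !code_at_cons in HC. destruct HC as (C1 & C2 & C3 & C4 & _).
  eexists; split; [|split].
  - eapply steps_S; [eapply (st_iconst _ _ _ _ _ C1); lia|].
    eapply steps_S; [eapply (st_iarith _ _ _ _ _ _ _ _ C2)|].
    { simpl. ups. rewrite E. reflexivity. } { lia. }
    eapply steps_S; [eapply (st_iconst _ _ _ _ _ C3); lia|].
    eapply (st_iarith _ _ _ _ _ _ _ (Z.of_nat (128 + i * 8 + a)) C4); [|lia].
    simpl. ups. lia.
  - intros j Hj. ups; auto.
  - ups; auto.
Qed.

Lemma ci_ok s rr e : forall k p ii, rel s rr ii -> iwf e k = true -> iok m s e ->
  code_at P p (ci e k) ->
  exists ii', steps P w (length (ci e k)) (mkState p rr ii) (mkState (p + length (ci e k)) rr ii')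
    /\ ipres k ii ii' /\ ii' (64 + k) = Z.of_nat (ieval s e).
Proof.
  induction e as [v|c|o a IHa b IHb|a e IH]; intros k p ii HR Hw Hk HC;
    pose proof (ieval_lt _ _ _ _ _ HR Hw Hk) as Hlt; cbn [iwf iok ci ieval length] in Hw, Hk, HC |- *.
  - apply andb_prop in Hw as [Hv Hk']. apply Nat.ltb_lt in Hv, Hk'.
    rewrite !code_at_cons in HC. destruct HC as (C1 & C2 & _).
    destruct (rel_iv _ _ _ HR v Hv) as [E1 E2].
    eexists; split; [|split].
    + eapply steps_S; [eapply (st_iconst _ _ _ _ _ C1); lia|].
      replace (p + 2) with (S (S p)) by lia.
      eapply (st_iarith _ _ _ _ _ _ _ (Z.of_nat (iv s v)) C2); [|lia].
      simpl. ups. lia.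
    + intros j Hj. ups; auto.
    + ups; auto.
  - apply Nat.ltb_lt in Hw. rewrite !code_at_cons in HC. destruct HC as (C1 & _).
    eexists; split; [|split].
    + replace (p + 1) with (S p) by lia. eapply (st_iconst _ _ _ _ _ C1). lia.
    + intros j Hj. ups; auto.
    + ups; auto.
  - apply andb_prop in Hw as [Hw Hk']. apply andb_prop in Hw as [Wa Wb]. apply Nat.ltb_lt in Hk'.
    destruct Hk as (Ka & Kb & Ko). rewrite !code_at_app in HC. destruct HC as (C1 & C2 & C3).
    rewrite code_at_cons in C3. destruct C3 as [C3 _].
    destruct (IHa _ _ _ HR Wa Ka C1) as (i1 & S1 & P1 & E1).
    assert (HR1 : rel s rr i1) by (eapply rel_ipres; eauto).
    destruct (IHb _ _ _ HR1 Wb Kb C2) as (i2 & S2 & P2 & E2).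
    pose proof (ieval_lt _ _ _ _ _ HR Wa Ka) as La. pose proof (ieval_lt _ _ _ _ _ HR Wb Kb) as Lb.
    eexists; split; [|split].
    + rewrite !length_app; simpl length. eapply steps_trans; [exact S1|].
      eapply steps_trans; [exact S2|].
      rewrite !Nat.add_assoc.
      replace (p + length (ci a k) + length (ci b (S k)) + 1) with
        (S (p + length (ci a k) + length (ci b (S k)))) by lia.
      eapply (st_iarith _ _ _ _ _ _ _ (Z.of_nat (beval o (ieval s a) (ieval s b))) C3).
      * rewrite (P2 (64 + k)) by lia. rewrite E1.
        replace (i2 (65 + k)) with (Z.of_nat (ieval s b)) by (rewrite <- E2; f_equal; lia).
        destruct o; cbn [bi eval_iop beval bok] in *; [lia|lia|lia| |].
        -- rewrite Nat2Z.inj_div; auto.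
        -- rewrite Nat2Z.inj_mod; auto.
      * simpl in Hlt. lia.
    + intros j Hj. ups. rewrite P2 by lia. apply P1; lia.
    + ups; auto.
  - apply andb_prop in Hw as [Hw Hk']. apply andb_prop in Hw as [Wa Wb]. apply Nat.ltb_lt in Hk', Wa.
    destruct Hk as (Ka & Kb). rewrite !code_at_app in HC. destruct HC as (C1 & C2 & C3).
    rewrite code_at_cons in C3. destruct C3 as [C3 _].
    destruct (IH _ _ _ HR Wb Ka C1) as (i1 & S1 & P1 & E1).
    destruct (iaddr_ok a k _ rr i1 _ Wa Kb Hk' C2 E1) as (i2 & S2 & P2 & E2).
    assert (HR2 : rel s rr i2).
    { eapply (rel_pres _ _ _ _ _ k 0); [exact HR| |apply rpres_refl]. intros j Hj. rewrite P2 by lia. apply (P1 j Hj). }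
    eexists; split; [|split].
    + rewrite !length_app. eapply steps_trans; [exact S1|].
      eapply steps_trans; [exact S2|].
      replace (p + (length (ci e k) + (length (iaddr k a) + length [ILoad (64 + k) (64 + k)])))
        with (S (4 + (p + length (ci e k)))) by (simpl; lia).
      eapply (st_iload _ _ _ _ (64 + k)).
      replace (4 + (p + length (ci e k))) with (p + length (ci e k) + length (iaddr k a)) by (simpl; lia).
      exact C3.
    + intros j Hj. ups. rewrite P2 by lia. apply P1; lia.
    + ups. rewrite E2, Nat2Z.id. apply (rel_ia _ _ _ HR2); auto.
Qed.

Lemma raddr_ok a p s rr ii i : rel s rr ii -> a < 8 -> idx_ok m a i ->
  code_at P p (raddr a) -> ii 64 = Z.of_nat i ->
  exists ii' j, steps P w (length (raddr a)) (mkState p rr ii) (mkState (p + length (raddr a)) rr ii') /\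
    ipres 0 ii ii' /\ ii' 64 = Z.of_nat j /\ j = match a with O => i | _ => 3 * lN m + i * 8 + a end.
Proof.
  intros HR Ha Hi HC E. destruct a as [|a].
  - exists ii, i. simpl. rewrite Nat.add_0_r. split; [reflexivity|split; [apply ipres_refl|split; auto]].
  - unfold raddr in *. simpl in Hi.
    rewrite !code_at_cons in HC. destruct HC as (C1 & C2 & C3 & C4 & C5 & _).
    eexists; exists (3 * lN m + i * 8 + S a); split; [|split; [|split; [|reflexivity]]].
    + replace (p + length _) with (S (S (S (S (S p))))) by (simpl; lia).
      eapply steps_S; [eapply (st_iconst _ _ _ _ _ C1); lia|].
      eapply steps_S; [eapply (st_iarith _ _ _ _ _ _ _ (Z.of_nat (i * 8)) C2)|].
      { simpl. ups. rewrite E. lia. } { lia. }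
      eapply steps_S; [eapply (st_iconst _ _ _ _ _ C3); lia|].
      eapply steps_S; [eapply (st_iarith _ _ _ _ _ _ _ (Z.of_nat (i * 8 + S a)) C4)|].
      { unfold eval_iop. ups. lia. } { lia. }
      eapply (st_iarith _ _ _ _ _ _ _ (Z.of_nat (3 * lN m + i * 8 + S a)) C5); [|lia].
      unfold eval_iop. ups. rewrite (rel_off _ _ _ HR). lia.
    + intros j Hj. ups; auto.
    + ups; auto.
Qed.

Lemma cr_ok s r : forall k p rr ii, rel s rr ii -> rwf r k = true -> rok m s r ->
  code_at P p (cr r k) ->
  exists rr' ii', steps P w (length (cr r k)) (mkState p rr ii) (mkState (p + length (cr r k)) rr' ii')
    /\ ipres 0 ii ii' /\ rpres k rr rr' /\ rr' (8 + k) = reval s r.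
Proof.
  induction r as [v|c|o a IHa b IHb|a e|e]; intros k p rr ii HR Hw Hk HC; cbn [rwf rok cr reval length] in Hw, Hk, HC |- *.
  - apply andb_prop in Hw as [Hv Hk']. apply Nat.ltb_lt in Hv, Hk'.
    rewrite !code_at_cons in HC. destruct HC as (C1 & C2 & _).
    eexists; exists ii; split; [|split; [|split]].
    + eapply steps_S; [eapply (st_rconst _ _ _ _ _ C1)|].
      replace (p + 2) with (S (S p)) by lia.
      eapply (st_rarith _ _ _ _ _ _ _ C2). congruence.
    + apply ipres_refl.
    + intros j Hj. ups; auto.
    + ups; simpl. ups. rewrite (rel_rv _ _ _ HR) by auto. ring.
  - apply Nat.ltb_lt in Hw. rewrite !code_at_cons in HC. destruct HC as (C1 & _).
    eexists; exists ii; split; [|split; [|split]].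
    + replace (p + 1) with (S p) by lia. eapply (st_rconst _ _ _ _ _ C1).
    + apply ipres_refl.
    + intros j Hj. ups; auto.
    + ups; auto.
  - apply andb_prop in Hw as [Hw Hk']. apply andb_prop in Hw as [Wa Wb]. apply Nat.ltb_lt in Hk'.
    destruct Hk as (Ka & Kb & Ko). rewrite !code_at_app in HC. destruct HC as (C1 & C2 & C3).
    rewrite code_at_cons in C3. destruct C3 as [C3 _].
    destruct (IHa _ _ _ _ HR Wa Ka C1) as (r1 & i1 & S1 & P1 & Q1 & E1).
    assert (HR1 : rel s r1 i1) by (eapply rel_pres; eauto).
    destruct (IHb _ _ _ _ HR1 Wb Kb C2) as (r2 & i2 & S2 & P2 & Q2 & E2).
    eexists; exists i2; split; [|split; [|split]].
    + rewrite !length_app; simpl length. eapply steps_trans; [exact S1|].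
      eapply steps_trans; [exact S2|].
      rewrite !Nat.add_assoc.
      replace (p + length (cr a k) + length (cr b (S k)) + 1) with
        (S (p + length (cr a k) + length (cr b (S k)))) by lia.
      eapply (st_rarith _ _ _ _ _ _ _ C3). destruct o; try congruence; tauto.
    + intros j Hj. rewrite P2 by lia. apply P1; lia.
    + intros j Hj. ups. rewrite Q2 by lia. apply Q1; lia.
    + ups. f_equal; auto.  rewrite Q2 by lia; auto.
  - apply andb_prop in Hw as [Hw Hk']. apply andb_prop in Hw as [Wa Wb]. apply Nat.ltb_lt in Hk', Wa.
    destruct Hk as (Ka & Kb). rewrite !code_at_app in HC. destruct HC as (C1 & C2 & C3).
    rewrite code_at_cons in C3. destruct C3 as [C3 _].
    destruct (ci_ok s rr e 0 _ _ HR Wb Ka C1) as (i1 & S1 & P1 & E1).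
    assert (HR1 : rel s rr i1) by (eapply rel_ipres; eauto).
    destruct (raddr_ok a _ s rr i1 _ HR1 Wa Kb C2 E1) as (i2 & j & S2 & P2 & E2 & Ej).
    eexists; exists i2; split; [|split; [|split]].
    + rewrite !length_app; simpl length. eapply steps_trans; [exact S1|].
      eapply steps_trans; [exact S2|].
      rewrite !Nat.add_assoc.
      replace (p + length (ci e 0) + length (raddr a) + 1) with
        (S (p + length (ci e 0) + length (raddr a))) by lia.
      eapply (st_rload _ _ _ _ _ C3).
    + intros l Hl. rewrite P2 by lia. apply P1; lia.
    + intros l Hl. ups; auto.
    + ups. rewrite E2, Nat2Z.id. subst j. destruct a as [|a].
      * apply (rel_raw _ _ _ HR); auto.
      * apply (rel_ra _ _ _ HR); [lia|auto].
  - apply andb_prop in Hw as [Wb Hk']. apply Nat.ltb_lt in Hk'.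
    rewrite !code_at_app in HC. destruct HC as (C1 & C3).
    rewrite code_at_cons in C3. destruct C3 as [C3 _].
    destruct (ci_ok s rr e 0 _ _ HR Wb Hk C1) as (i1 & S1 & P1 & E1).
    eexists; exists i1; split; [|split; [|split]].
    + rewrite !length_app; simpl length. eapply steps_trans; [exact S1|].
      rewrite !Nat.add_assoc.
      replace (p + length (ci e 0) + 1) with (S (p + length (ci e 0))) by lia.
      eapply (st_itor _ _ _ _ _ C3).
    + auto.
    + intros l Hl. ups; auto.
    + ups. change 64 with (64 + 0). rewrite E1. symmetry; apply INR_IZR_INZ.
Qed.

Lemma cc_ok s b p rr ii t : rel s rr ii -> cwf b = true -> cok m s b ->
  code_at P p (cc b ++ [jc b t]) ->
  exists rr' ii', steps P w (length (cc b) + 1) (mkState p rr ii)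
     (mkState (if ceval s b then t else p + length (cc b) + 1) rr' ii') /\ rel s rr' ii'.
Proof.
  intros HR Hw Hk HC. rewrite code_at_app in HC. destruct HC as [HC HJ].
  rewrite code_at_cons in HJ. destruct HJ as [HJ _].
  destruct b as [a b|a b]; simpl in Hw, Hk, HC, HJ |- *;
    apply andb_prop in Hw as [Wa Wb]; destruct Hk as [Ka Kb];
    rewrite code_at_app in HC; destruct HC as [C1 C2].
  - destruct (ci_ok s rr a 0 _ _ HR Wa Ka C1) as (i1 & S1 & P1 & E1).
    assert (HR1 : rel s rr i1) by (eapply rel_ipres; eauto).
    destruct (ci_ok s rr b 1 _ _ HR1 Wb Kb C2) as (i2 & S2 & P2 & E2).
    exists rr, i2; split; [|eapply rel_ipres; eauto].
    eapply steps_trans; [rewrite length_app; eapply steps_trans; [exact S1|exact S2]|].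
    hnf. eexists; split; [|reflexivity]. rewrite length_app, Nat.add_assoc in HJ |- *.
    unfold step; simpl. rewrite HJ.
    change 65 with (64 + 1). rewrite E2. rewrite (P2 64) by lia. change 64 with (64 + 0). rewrite E1.
    destruct (Nat.ltb_spec (ieval s a) (ieval s b)), (Z.ltb_spec (Z.of_nat (ieval s a)) (Z.of_nat (ieval s b)));
      try lia; auto. rewrite Nat.add_1_r; auto.
  - destruct (cr_ok s a 0 _ _ _ HR Wa Ka C1) as (r1 & i1 & S1 & P1 & Q1 & E1).
    assert (HR1 : rel s r1 i1) by (eapply rel_pres; eauto).
    destruct (cr_ok s b 1 _ _ _ HR1 Wb Kb C2) as (r2 & i2 & S2 & P2 & Q2 & E2).
    exists r2, i2; split; [|eapply rel_pres; eauto].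
    eapply steps_trans; [rewrite length_app; eapply steps_trans; [exact S1|exact S2]|].
    hnf. eexists; split; [|reflexivity]. rewrite length_app, Nat.add_assoc in HJ |- *.
    unfold step; simpl. rewrite HJ.
    change 9 with (8 + 1). rewrite E2. rewrite (Q2 8) by lia. change 8 with (8 + 0). rewrite E1.
    destruct (Rlt_dec (reval s a) (reval s b)); auto. rewrite Nat.add_1_r; auto.
Qed.

Lemma put_same {A} (f : nat -> A) i v : put f i v i = v.
Proof. apply upd_same. Qed.
Lemma put_other {A} (f : nat -> A) i v j : j <> i -> put f i v j = f j.
Proof. apply upd_other. Qed.

(** The bound is stated for every L above the code length, so that the bounds of subcommands, whose
    code is shorter, hold for the same L and simply add up. *)
Lemma comp_ok c s s' t : exec m c s s' t -> forall p rr ii, wf c = true -> rel s rr ii ->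
  code_at P p (comp p c) ->
  exists rr' ii' k, steps P w k (mkState p rr ii) (mkState (p + length (comp p c)) rr' ii') /\
    rel s' rr' ii' /\ (forall L, length (comp p c) <= L -> k <= L * t).
Proof.
  induction 1 as [s|v e s Hk|v r s Hk|a e1 e2 s K1 K2 K3|a e r s K1 K2 K3
    |c1 c2 s s1 s2 t1 t2 _ IH1 _ IH2|b c1 c2 s s1 t Hk Hb _ IH|b c1 c2 s s1 t Hk Hb _ IH
    |b c s Hk Hb|b c s s1 s2 t1 t2 Hk Hb _ IH1 _ IH2]; intros p rr ii Hw HR HC.
  - exists rr, ii, 0. simpl. rewrite Nat.add_0_r. repeat split; auto; try apply HR; intros; lia.
  - cbn [wf comp] in Hw, HC |- *. apply andb_prop in Hw as [Hv We]. apply Nat.ltb_lt in Hv.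
    rewrite code_at_app, !code_at_cons in HC. destruct HC as (C1 & C2 & C3 & _).
    destruct (ci_ok s rr e 0 _ _ HR We Hk C1) as (i1 & S1 & P1 & E1).
    pose proof (ieval_lt _ _ _ _ _ HR We Hk) as Hlt.
    exists rr; eexists; exists (length (ci e 0) + (1 + 1)); split; [|split].
    + eapply steps_trans; [exact S1|]. eapply steps_S; [eapply (st_iconst _ _ _ _ _ C2); lia|].
      rewrite length_app. simpl length.
      replace (p + (length (ci e 0) + 2)) with (S (S (p + length (ci e 0)))) by lia.
      eapply (st_iarith _ _ _ _ _ _ _ (Z.of_nat (ieval s e)) C3); [|lia].
      simpl. ups. change 64 with (64 + 0). rewrite E1. lia.
    + destruct HR. constructor; simpl; intros.
      * destruct (Nat.eq_dec v0 v) as [->|Hn].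
        -- rewrite upd_same, put_same. split; auto.
        -- rewrite put_other by auto. ups. rewrite P1 by lia. auto.
      * ups. rewrite P1 by lia. auto.
      * ups. rewrite P1 by lia. auto.
      * auto.
      * auto.
      * auto.
    + intros L HL. rewrite length_app in HL. simpl in HL. nia.
  - cbn [wf comp] in Hw, HC |- *. apply andb_prop in Hw as [Hv We]. apply Nat.ltb_lt in Hv.
    rewrite code_at_app, !code_at_cons in HC. destruct HC as (C1 & C2 & C3 & _).
    destruct (cr_ok s r 0 _ _ _ HR We Hk C1) as (r1 & i1 & S1 & P1 & Q1 & E1).
    eexists; exists i1; exists (length (cr r 0) + (1 + 1)); split; [|split].
    + eapply steps_trans; [exact S1|]. eapply steps_S; [eapply (st_rconst _ _ _ _ _ C2)|].
      rewrite length_app. simpl length.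
      replace (p + (length (cr r 0) + 2)) with (S (S (p + length (cr r 0)))) by lia.
      eapply (st_rarith _ _ _ _ _ _ _ C3); congruence.
    + simpl reval_op. destruct HR. constructor; simpl; intros.
      * rewrite P1 by lia. auto.
      * rewrite P1 by lia. auto.
      * rewrite P1 by lia. auto.
      * destruct (Nat.eq_dec v0 v) as [->|Hn].
        -- rewrite upd_same, put_same. ups. change 8 with (8 + 0). rewrite E1. ring.
        -- rewrite put_other by auto. ups. rewrite Q1 by lia. auto.
      * ups. rewrite Q1 by lia. auto.
      * ups. rewrite Q1 by lia. auto.
    + intros L HL. rewrite length_app in HL. simpl in HL. nia.
  - cbn [wf comp] in Hw, HC |- *. apply andb_prop in Hw as [Hw We1]. apply andb_prop in Hw as [Ha We2].
    apply Nat.ltb_lt in Ha.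
    rewrite !code_at_app, !code_at_cons in HC. destruct HC as (C1 & C2 & C3 & C4 & _).
    destruct (ci_ok s rr e2 0 _ _ HR We2 K2 C1) as (i1 & S1 & P1 & E1).
    assert (HR1 : rel s rr i1) by (eapply rel_ipres; eauto).
    destruct (ci_ok s rr e1 1 _ _ HR1 We1 K1 C2) as (i2 & S2 & P2 & E2).
    assert (HR2 : rel s rr i2) by (eapply rel_ipres; eauto).
    destruct (iaddr_ok a 1 _ rr i2 _ Ha K3 ltac:(lia) C3 E2) as (i3 & S3 & P3 & E3).
    assert (HR3 : rel s rr i3) by (eapply rel_ipres; eauto).
    pose proof (ieval_lt _ _ _ _ _ HR We2 K2) as Hlt.
    exists rr; eexists; exists (length (ci e2 0) + (length (ci e1 1) + (4 + 1))); split; [|split].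
    + eapply steps_trans; [exact S1|]. eapply steps_trans; [exact S2|].
      eapply steps_trans; [exact S3|]. rewrite !length_app.
      replace (p + (length (ci e2 0) + (length (ci e1 1) + (length (iaddr 1 a) + length [IStore 65 64]))))
        with (S (4 + (p + length (ci e2 0) + length (ci e1 1)))) by (simpl; lia).
      eapply (st_istore _ _ _ 65 64).
      replace (4 + (p + length (ci e2 0) + length (ci e1 1))) with
        (p + length (ci e2 0) + length (ci e1 1) + length (iaddr 1 a)) by (simpl; lia). exact C4.
    + change 65 with (64 + 1) at 1. rewrite E3, Nat2Z.id.
      assert (E64 : i3 64 = Z.of_nat (ieval s e2)).
      { rewrite P3 by lia. rewrite P2 by lia. exact E1. }
      rewrite E64. destruct HR3. constructor; simpl; intros; ups; auto.
      * destruct (Nat.eq_dec a0 a) as [->|Hn].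
        -- rewrite put_same. destruct (Nat.eq_dec i (ieval s e1)) as [->|Hi].
           ++ rewrite upd_same. simpl; rewrite upd_same. auto.
           ++ rewrite (upd_other (ia s a)) by auto. rewrite upd_other by lia. apply rel_ia0; auto.
        -- rewrite (put_other (ia s) a _ a0) by exact Hn. rewrite upd_other by lia. apply rel_ia0; auto.
    + intros L HL. rewrite !length_app in HL. simpl length in HL. nia.
  - cbn [wf comp] in Hw, HC |- *. apply andb_prop in Hw as [Hw We]. apply andb_prop in Hw as [Ha Wr].
    apply Nat.ltb_lt in Ha.
    rewrite !code_at_app, !code_at_cons in HC. destruct HC as (C1 & C2 & C3 & C4 & _).
    destruct (cr_ok s r 0 _ _ _ HR Wr K2 C1) as (r1 & i1 & S1 & P1 & Q1 & E1).
    assert (HR1 : rel s r1 i1) by (eapply rel_pres; eauto).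
    destruct (ci_ok s r1 e 0 _ _ HR1 We K1 C2) as (i2 & S2 & P2 & E2).
    assert (HR2 : rel s r1 i2) by (eapply rel_ipres; eauto).
    destruct (raddr_ok a _ s r1 i2 _ HR2 Ha K3 C3 E2) as (i3 & j & S3 & P3 & E3 & Ej).
    assert (HR3 : rel s r1 i3) by (eapply rel_ipres; eauto).
    eexists; exists i3; exists (length (cr r 0) + (length (ci e 0) + (length (raddr a) + 1))); split; [|split].
    + eapply steps_trans; [exact S1|]. eapply steps_trans; [exact S2|].
      eapply steps_trans; [exact S3|]. rewrite !length_app.
      replace (p + (length (cr r 0) + (length (ci e 0) + (length (raddr a) + length [RStore 64 8]))))
        with (S (p + length (cr r 0) + length (ci e 0) + length (raddr a))) by (simpl; lia).
      eapply (st_rstore _ _ _ 64 8). exact C4.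
    + rewrite E3, Nat2Z.id. change 8 with (8 + 0) at 1. rewrite E1.
      destruct a as [|a]; simpl in K3, Ej; subst j.
      * destruct HR3. constructor; simpl; intros; auto.
        -- rewrite upd_other by lia; auto.
        -- rewrite put_same. destruct (Nat.eq_dec i (ieval s e)) as [->|Hi].
           ++ rewrite !upd_same; auto.
           ++ rewrite !upd_other by auto; auto.
        -- rewrite put_other by lia. rewrite upd_other by lia. apply rel_ra0; auto.
      * destruct HR3. constructor; simpl; intros; auto.
        -- rewrite upd_other by lia; auto.
        -- rewrite put_other by lia. rewrite upd_other by lia; auto.
        -- destruct (Nat.eq_dec a0 (S a)) as [->|Hn].
           ++ rewrite put_same. destruct (Nat.eq_dec i (ieval s e)) as [->|Hi].
              ** rewrite !upd_same; auto.
              ** rewrite (upd_other (ra s (S a))) by auto. rewrite upd_other by lia. apply rel_ra0; auto.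
           ++ rewrite (put_other (ra s) (S a) _ a0) by exact Hn. rewrite upd_other by lia. apply rel_ra0; auto.
    + intros L HL. rewrite !length_app in HL. simpl length in HL. nia.
  - cbn [wf comp] in Hw, HC |- *. apply andb_prop in Hw as [W1 W2]. rewrite code_at_app in HC.
    destruct HC as [C1 C2]. destruct (IH1 _ _ _ W1 HR C1) as (r1 & i1 & k1 & S1 & R1 & B1).
    destruct (IH2 _ _ _ W2 R1 C2) as (r2 & i2 & k2 & S2 & R2 & B2).
    exists r2, i2, (k1 + k2). rewrite length_app, Nat.add_assoc. split; [|split]; auto.
    + eapply steps_trans; eauto.
    + intros L HL. specialize (B1 L ltac:(lia)). specialize (B2 L ltac:(lia)). nia.
  - cbn [wf comp] in Hw, HC |- *. apply andb_prop in Hw as [Hw W2]. apply andb_prop in Hw as [Wb W1].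
    set (p1 := p + length (cc b) + 2) in *. set (l1 := comp p1 c1) in *.
    set (p2 := p1 + length l1 + 1) in *. set (l2 := comp p2 c2) in *.
    change ([jc b p1; Jmp p2] ++ l1 ++ [Jmp (p2 + length l2)] ++ l2) with
      ([jc b p1] ++ ([Jmp p2] ++ l1 ++ [Jmp (p2 + length l2)] ++ l2)) in *.
    rewrite app_assoc, code_at_app in HC. destruct HC as [C1 C2].
    rewrite !code_at_app in C2. destruct C2 as (C2 & C3 & C4 & C5).
    rewrite length_app in *. simpl length in *.
    destruct (cc_ok _ _ _ _ _ _ HR Wb Hk C1) as (r1 & i1 & S1 & R1). rewrite Hb in S1.
    replace (p + (length (cc b) + 1) + 1) with p1 in * by (unfold p1; lia).
    destruct (IH _ _ _ W1 R1 C3) as (r2 & i2 & k2 & S2 & R2 & B2).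
    rewrite code_at_cons in C4. destruct C4 as [C4 _].
    exists r2, i2, (length (cc b) + 1 + (k2 + 1)); split; [|split]; auto.
    + eapply steps_trans; [exact S1|]. eapply steps_trans; [exact S2|].
      hnf. eexists; split; [|reflexivity]. unfold step; simpl. fold l1. rewrite C4. do 2 f_equal.
      rewrite ?length_app; simpl length; rewrite ?length_app; simpl length. unfold p2, p1. lia.
    + intros L HL. rewrite ?length_app in HL. simpl length in HL. rewrite ?length_app in HL; simpl length in HL.
      specialize (B2 L). fold l1 in B2. specialize (B2 ltac:(lia)). nia.
  - cbn [wf comp] in Hw, HC |- *. apply andb_prop in Hw as [Hw W2]. apply andb_prop in Hw as [Wb W1].
    set (p1 := p + length (cc b) + 2) in *. set (l1 := comp p1 c1) in *.
    set (p2 := p1 + length l1 + 1) in *. set (l2 := comp p2 c2) in *.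
    change ([jc b p1; Jmp p2] ++ l1 ++ [Jmp (p2 + length l2)] ++ l2) with
      ([jc b p1] ++ ([Jmp p2] ++ l1 ++ [Jmp (p2 + length l2)] ++ l2)) in *.
    rewrite app_assoc, code_at_app in HC. destruct HC as [C1 C2].
    rewrite !code_at_app in C2. destruct C2 as (C2 & C3 & C4 & C5).
    rewrite length_app in *. simpl length in *.
    destruct (cc_ok _ _ _ _ _ _ HR Wb Hk C1) as (r1 & i1 & S1 & R1). rewrite Hb in S1.
    replace (p + (length (cc b) + 1) + 1) with p1 in * by (unfold p1; lia).
    fold p2 in C5.
    destruct (IH _ _ _ W2 R1 C5) as (r2 & i2 & k2 & S2 & R2 & B2).
    rewrite code_at_cons in C2. destruct C2 as [C2 _].
    exists r2, i2, (length (cc b) + 1 + (1 + k2)); split; [|split]; auto.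
    + eapply steps_trans; [exact S1|]. eapply steps_S.
      { hnf. eexists; split; [|reflexivity]. unfold step; simpl.
        replace (p + length (cc b) + 1) with (p + (length (cc b) + 1)) by lia. rewrite C2. reflexivity. }
      replace (p + _) with (p2 + length (comp p2 c2)); [exact S2|].
      rewrite ?length_app; simpl length; rewrite ?length_app; simpl length. fold l2. unfold p2, p1. lia.
    + intros L HL. rewrite ?length_app in HL. simpl length in HL. rewrite ?length_app in HL; simpl length in HL.
      specialize (B2 L). fold l2 in B2. specialize (B2 ltac:(lia)). nia.
  - cbn [wf comp] in Hw, HC |- *. apply andb_prop in Hw as [Wb W1].
    set (p1 := p + length (cc b) + 2) in *. set (l1 := comp p1 c) in *.
    change ([jc b p1; Jmp (p1 + length l1 + 1)] ++ l1 ++ [Jmp p]) with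
      ([jc b p1] ++ ([Jmp (p1 + length l1 + 1)] ++ l1 ++ [Jmp p])) in *.
    rewrite app_assoc, code_at_app in HC. destruct HC as [C1 C2].
    rewrite !code_at_app in C2. destruct C2 as (C2 & C3 & C4).
    rewrite length_app in *. simpl length in *.
    destruct (cc_ok _ _ _ _ _ _ HR Wb Hk C1) as (r1 & i1 & S1 & R1). rewrite Hb in S1.
    rewrite code_at_cons in C2. destruct C2 as [C2 _].
    exists r1, i1, (length (cc b) + 1 + 1); split; [|split]; auto.
    + eapply steps_trans; [exact S1|].
      hnf. eexists; split; [|reflexivity]. unfold step; simpl.
      replace (p + length (cc b) + 1) with (p + (length (cc b) + 1)) by lia. rewrite C2.
      do 2 f_equal. rewrite ?length_app; simpl length. unfold p1; lia.
    + intros L HL. rewrite ?length_app in HL. simpl length in HL. nia.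
  (* The second induction hypothesis is about the same loop at the same address, so the hypotheses
     on the whole loop are kept besides their decomposition. *)
  - pose proof Hw as Hw0. pose proof HC as HC0.
    cbn [wf comp] in Hw, HC. apply andb_prop in Hw as [Wb W1].
    set (p1 := p + length (cc b) + 2) in *. set (l1 := comp p1 c) in *.
    change ([jc b p1; Jmp (p1 + length l1 + 1)] ++ l1 ++ [Jmp p]) with
      ([jc b p1] ++ ([Jmp (p1 + length l1 + 1)] ++ l1 ++ [Jmp p])) in *.
    rewrite app_assoc, code_at_app in HC. destruct HC as [C1 C2].
    rewrite !code_at_app in C2. destruct C2 as (C2 & C3 & C4).
    rewrite length_app in *. simpl length in *.
    destruct (cc_ok _ _ _ _ _ _ HR Wb Hk C1) as (r1 & i1 & S1 & R1). rewrite Hb in S1.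
    replace (p + (length (cc b) + 1) + 1) with p1 in * by (unfold p1; lia).
    destruct (IH1 _ _ _ W1 R1 C3) as (r2 & i2 & k2 & S2 & R2 & B2). fold l1 in S2.
    rewrite code_at_cons in C4. destruct C4 as [C4 _].
    destruct (IH2 _ _ _ Hw0 R2 HC0) as (r3 & i3 & k3 & S3 & R3 & B3).
    exists r3, i3, (length (cc b) + 1 + (k2 + (1 + k3))); split; [|split]; auto.
    + eapply steps_trans; [exact S1|]. eapply steps_trans; [exact S2|].
      eapply steps_S; [|exact S3].
      hnf. eexists; split; [|reflexivity]. unfold step; simpl. rewrite C4. reflexivity.
    + intros L HL. specialize (B3 L HL). cbn [comp] in HL. fold p1 l1 in HL.
      rewrite ?length_app in HL. simpl length in HL. rewrite ?length_app in HL; simpl in HL.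
      specialize (B2 L). fold l1 in B2. specialize (B2 ltac:(lia)). nia.
Qed.

End Correct.

(** * Weakest preconditions with running time *)

Definition inb (v : nat) (l : list nat) : bool := existsb (Nat.eqb v) l.

Fixpoint mods (f : cmd -> list nat) (c : cmd) : list nat :=
  match c with
  | Seq c1 c2 => mods f c1 ++ mods f c2
  | If _ c1 c2 => mods f c1 ++ mods f c2
  | While _ c => mods f c
  | _ => f c
  end.

Definition miv := mods (fun c => match c with IAsg v _ => [v] | _ => [] end).
Definition mrv := mods (fun c => match c with RAsg v _ => [v] | _ => [] end).
Definition mia := mods (fun c => match c with ISto a _ _ => [a] | _ => [] end).
Definition mra := mods (fun c => match c with RSto a _ _ => [a] | _ => [] end).

(* The sets of assigned variables and arrays are computed, so that what a command leaves
   unchanged is known without stating it in any specification. *)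
Record frame (c : cmd) (s s' : st) : Prop := {
  fr_iv : forall v, inb v (miv c) = false -> iv s' v = iv s v;
  fr_rv : forall v, inb v (mrv c) = false -> rv s' v = rv s v;
  fr_ia : forall a, inb a (mia c) = false -> ia s' a = ia s a;
  fr_ra : forall a, inb a (mra c) = false -> ra s' a = ra s a }.

Lemma inb_app v l1 l2 : inb v (l1 ++ l2) = false -> inb v l1 = false /\ inb v l2 = false.
Proof. unfold inb. rewrite existsb_app. apply orb_false_elim. Qed.

Lemma inb_one v u : inb v [u] = false -> v <> u.
Proof. unfold inb; simpl. rewrite orb_false_r. apply Nat.eqb_neq. Qed.

Lemma frame_refl c s : frame c s s.
Proof. constructor; auto. Qed.

Lemma frame_trans c s1 s2 s3 : frame c s1 s2 -> frame c s2 s3 -> frame c s1 s3.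
Proof.
  intros [] []; constructor; intros;
  [rewrite fr_iv1, fr_iv0|rewrite fr_rv1, fr_rv0|rewrite fr_ia1, fr_ia0|rewrite fr_ra1, fr_ra0]; auto.
Qed.

Definition subm (c c' : cmd) : Prop := forall v,
  (inb v (miv c') = false -> inb v (miv c) = false) /\
  (inb v (mrv c') = false -> inb v (mrv c) = false) /\
  (inb v (mia c') = false -> inb v (mia c) = false) /\
  (inb v (mra c') = false -> inb v (mra c) = false).

Lemma frame_sub c c' s s' : subm c c' -> frame c s s' -> frame c' s s'.
Proof.
  intros H [A1 A2 A3 A4]. constructor; intros v Hv; destruct (H v) as (B1 & B2 & B3 & B4); auto.
Qed.

Lemma subm_seq1 c1 c2 : subm c1 (Seq c1 c2).
Proof. intros v; repeat split; intros H; apply inb_app in H; tauto. Qed.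
Lemma subm_seq2 c1 c2 : subm c2 (Seq c1 c2).
Proof. intros v; repeat split; intros H; apply inb_app in H; tauto. Qed.
Lemma subm_if1 b c1 c2 : subm c1 (If b c1 c2).
Proof. intros v; repeat split; intros H; apply inb_app in H; tauto. Qed.
Lemma subm_if2 b c1 c2 : subm c2 (If b c1 c2).
Proof. intros v; repeat split; intros H; apply inb_app in H; tauto. Qed.
Lemma subm_while b c : subm c (While b c).
Proof. intros v; repeat split; auto. Qed.

Lemma exec_frame m c s s' t : exec m c s s' t -> frame c s s'.
Proof.
  induction 1; try apply frame_refl.
  1-4: constructor; simpl; auto; intros u Hu; apply put_other; apply inb_one in Hu; auto.
  - eapply frame_trans; [eapply frame_sub; [apply subm_seq1|]|eapply frame_sub; [apply subm_seq2|]]; eauto.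
  - eapply frame_sub; [apply subm_if1|]; auto.
  - eapply frame_sub; [apply subm_if2|]; auto.
  - eapply frame_trans; [eapply frame_sub; [apply subm_while|]|]; eauto.
Qed.

(** Total correctness: the existence of an execution means that the command neither gets stuck nor
    diverges. *)
Definition wp (m : lim) (c : cmd) (s : st) (Q : st -> nat -> Prop) : Prop :=
  exists s' t, exec m c s s' t /\ Q s' t.

Definition Loop (v : nat) (e : iexp) (c : cmd) : cmd :=
  While (CLt (Vr v) e) (Seq c (IAsg v (Bi Plus (Vr v) (Cn 1)))).

Definition For (v : nat) (e : iexp) (c : cmd) : cmd := Seq (IAsg v (Cn 0)) (Loop v e c).

Section Rules.
Variable m : lim.

(** The frame property of the command enters as an additional hypothesis, so specifications need to
    mention only what changes. *)
Lemma wp_mono c s (Q Q' : st -> nat -> Prop) :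
  wp m c s Q -> (forall s' t, Q s' t -> frame c s s' -> Q' s' t) -> wp m c s Q'.
Proof. intros (s' & t & H & HQ) HH. exists s', t. eauto using exec_frame. Qed.

Lemma wp_skip s Q : Q s 0 -> wp m Skip s Q.
Proof. intros; exists s, 0; split; [constructor|auto]. Qed.

Lemma wp_seq c1 c2 s Q :
  wp m c1 s (fun s1 t1 => wp m c2 s1 (fun s2 t2 => Q s2 (t1 + t2))) -> wp m (Seq c1 c2) s Q.
Proof.
  intros (s1 & t1 & H1 & s2 & t2 & H2 & H). exists s2, (t1 + t2). split; [econstructor|]; eauto.
Qed.

Lemma wp_iasg v e s (Q : st -> nat -> Prop) :
  iok m s e -> Q (set_iv s v (ieval s e)) 1 -> wp m (IAsg v e) s Q.
Proof. intros; eexists; eexists; split; [constructor|]; eauto. Qed.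

Lemma wp_rasg v e s (Q : st -> nat -> Prop) :
  rok m s e -> Q (set_rv s v (reval s e)) 1 -> wp m (RAsg v e) s Q.
Proof. intros; eexists; eexists; split; [constructor|]; eauto. Qed.

Lemma wp_isto a e1 e2 s (Q : st -> nat -> Prop) :
  iok m s e1 /\ iok m s e2 /\ ieval s e1 < lM m ->
  Q (set_ia s a (ieval s e1) (ieval s e2)) 1 -> wp m (ISto a e1 e2) s Q.
Proof. intros (? & ? & ?) ?; eexists; eexists; split; [constructor|]; eauto. Qed.

Lemma wp_rsto a e r s (Q : st -> nat -> Prop) :
  iok m s e /\ rok m s r /\ idx_ok m a (ieval s e) ->
  Q (set_ra s a (ieval s e) (reval s r)) 1 -> wp m (RSto a e r) s Q.
Proof. intros (? & ? & ?) ?; eexists; eexists; split; [constructor|]; eauto. Qed.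

Lemma wp_ifi a b c1 c2 s (Q : st -> nat -> Prop) :
  iok m s a /\ iok m s b ->
  (ieval s a < ieval s b -> wp m c1 s (fun s' t => Q s' (1 + t))) ->
  (ieval s b <= ieval s a -> wp m c2 s (fun s' t => Q s' (1 + t))) ->
  wp m (If (CLt a b) c1 c2) s Q.
Proof.
  intros Hk H1 H2. destruct (Nat.ltb_spec (ieval s a) (ieval s b)) as [Hl|Hl].
  - destruct (H1 Hl) as (s' & t & E & HQ). exists s', (1 + t); split; auto.
    apply E_ift; auto. simpl. apply Nat.ltb_lt; auto.
  - destruct (H2 Hl) as (s' & t & E & HQ). exists s', (1 + t); split; auto.
    apply E_iff; auto. simpl. apply Nat.ltb_ge; auto.
Qed.

Lemma wp_ifr a b c1 c2 s (Q : st -> nat -> Prop) :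
  rok m s a /\ rok m s b ->
  ((reval s a < reval s b)%R -> wp m c1 s (fun s' t => Q s' (1 + t))) ->
  ((reval s b <= reval s a)%R -> wp m c2 s (fun s' t => Q s' (1 + t))) ->
  wp m (If (CRlt a b) c1 c2) s Q.
Proof.
  intros Hk H1 H2. destruct (Rlt_dec (reval s a) (reval s b)) as [Hl|Hl].
  - destruct (H1 Hl) as (s' & t & E & HQ). exists s', (1 + t); split; auto.
    apply E_ift; auto. simpl. destruct (Rlt_dec _ _); auto; contradiction.
  - destruct (H2 ltac:(lra)) as (s' & t & E & HQ). exists s', (1 + t); split; auto.
    apply E_iff; auto. simpl. destruct (Rlt_dec _ _); auto; contradiction.
Qed.

(** The time spent so far is an argument of the invariant, while termination rests on the separate
    measure [f]. This allows amortised bounds, where single iterations have no common cost. *)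
Lemma wp_while a b c s0 (I : st -> nat -> Prop) (f : st -> nat) (Q : st -> nat -> Prop) :
  I s0 0 ->
  (forall s t, frame c s0 s -> I s t -> iok m s a /\ iok m s b) ->
  (forall s t, frame c s0 s -> I s t -> ieval s a < ieval s b ->
     wp m c s (fun s' t' => I s' (1 + t + t') /\ f s' < f s)) ->
  (forall s t, frame c s0 s -> I s t -> ieval s b <= ieval s a -> Q s (t + 1)) ->
  wp m (While (CLt a b) c) s0 Q.
Proof.
  intros H0 Hok Hbody Hend.
  assert (HH : forall k s t, f s < k -> frame c s0 s -> I s t ->
    exists s' t', exec m (While (CLt a b) c) s s' t' /\ Q s' (t + t')).
  { induction k as [|k IH]; intros s t Hf Hfr Hi; [lia|].
    destruct (Nat.ltb_spec (ieval s a) (ieval s b)) as [Hl|Hl].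
    - destruct (Hbody _ _ Hfr Hi Hl) as (s1 & t1 & E1 & I1 & F1).
      destruct (IH s1 (1 + t + t1)) as (s2 & t2 & E2 & Q2); auto; [lia|eauto using frame_trans, exec_frame|].
      exists s2, (1 + t1 + t2). split.
      + eapply E_wht; eauto; [simpl; eauto|simpl; apply Nat.ltb_lt; auto].
      + replace (t + (1 + t1 + t2)) with (1 + t + t1 + t2) by lia; auto.
    - exists s, 1. split; [|auto]. apply E_whf; [simpl; eauto|simpl; apply Nat.ltb_ge; auto]. }
  destruct (HH (S (f s0)) s0 0) as (s' & t' & E & HQ); auto using frame_refl.
  exists s', t'; auto.
Qed.

(** The 2 added per iteration pays for the test and the increment, the final 1 for the failing
    test. *)
Lemma wp_loop v e c s0 lo hi (I : nat -> st -> nat -> Prop) (Q : st -> nat -> Prop) :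
  inb v (miv c) = false -> hi < lM m -> lo <= hi -> iv s0 v = lo -> I lo s0 0 ->
  (forall s, frame (Loop v e c) s0 s -> iok m s e /\ ieval s e = hi) ->
  (forall i s t, lo <= i < hi -> frame (Loop v e c) s0 s -> I i s t -> iv s v = i ->
     wp m c s (fun s' t' => I (S i) (set_iv s' v (S i)) (t + t' + 2))) ->
  (forall s t, frame (Loop v e c) s0 s -> I hi s t -> iv s v = hi -> Q s (t + 1)) ->
  wp m (Loop v e c) s0 Q.
Proof.
  intros Hv HM Hlh H0 HI Hok Hbody Hend. unfold Loop.
  assert (Fr : forall s, frame (Seq c (IAsg v (Bi Plus (Vr v) (Cn 1)))) s0 s -> frame (Loop v e c) s0 s).
  { intros s. apply frame_sub, subm_while. }
  apply wp_while with (I := fun s t => lo <= iv s v <= hi /\ I (iv s v) s t)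
    (f := fun s => hi - iv s v).
  - rewrite H0; split; auto.
  - intros s t HF [Hi _]. destruct (Hok s (Fr _ HF)); simpl; auto.
  - intros s t HF [Hi HIs] Hl. destruct (Hok s (Fr _ HF)) as [K1 K2]. rewrite K2 in Hl. simpl in Hl.
    apply wp_seq. eapply wp_mono; [eapply (Hbody (iv s v)); eauto; lia|].
    intros s1 t1 I1 F1. assert (E : iv s1 v = iv s v) by (apply (fr_iv _ _ _ F1); auto).
    apply wp_iasg; simpl; rewrite E.
    + repeat split; lia.
    + unfold put. rewrite Nat.eqb_refl.
      replace (iv s v + 1) with (S (iv s v)) by lia. split; [split|]; try lia.
      replace (S (t + (t1 + 1))) with (t + t1 + 2) by lia. exact I1.
  - intros s t HF [Hi HIs] Hl. destruct (Hok s (Fr _ HF)) as [K1 K2]. rewrite K2 in Hl. simpl in Hl.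
    assert (iv s v = hi) by lia. apply Hend; auto. congruence.
Qed.

Lemma wp_for v e c s0 hi (I : nat -> st -> nat -> Prop) (Q : st -> nat -> Prop) :
  inb v (miv c) = false -> hi < lM m -> I 0 (set_iv s0 v 0) 0 ->
  (forall s, frame (For v e c) s0 s -> iok m s e /\ ieval s e = hi) ->
  (forall i s t, i < hi -> frame (For v e c) s0 s -> I i s t -> iv s v = i ->
     wp m c s (fun s' t' => I (S i) (set_iv s' v (S i)) (t + t' + 2))) ->
  (forall s t, frame (For v e c) s0 s -> I hi s t -> iv s v = hi -> Q s (t + 2)) ->
  wp m (For v e c) s0 Q.
Proof.
  intros Hv HM HI Hok Hbody Hend. unfold For. apply wp_seq.
  assert (F0 : frame (For v e c) s0 (set_iv s0 v 0)).
  { unfold For. eapply frame_sub; [apply subm_seq1|]. eapply exec_frame.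
    (* A frame does not depend on the limits, so any limit that admits the constant 0 will do. *)
    apply (E_iasg (mkLim 1 0) v (Cn 0)). simpl. lia. }
  assert (Fr : forall s, frame (Loop v e c) (set_iv s0 v 0) s -> frame (For v e c) s0 s).
  { intros s Hs. eapply frame_trans; [exact F0|]. unfold For. eapply frame_sub; [apply subm_seq2|]; auto. }
  apply wp_iasg; [simpl; lia|]. simpl.
  apply wp_loop with (lo := 0) (hi := hi) (I := I); auto.
  - lia.
  - unfold set_iv, put; simpl. rewrite Nat.eqb_refl; auto.
  - intros i s t Hi Hs. apply Hbody; auto; lia.
  - intros s t HF Hs Hi. replace (S (t + 1)) with (t + 2) by lia. apply Hend; auto.
Qed.

Lemma wp_forc v e c s0 hi T (I : nat -> st -> Prop) (Q : st -> nat -> Prop) :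
  inb v (miv c) = false -> hi < lM m -> I 0 (set_iv s0 v 0) ->
  (forall s, frame (For v e c) s0 s -> iok m s e /\ ieval s e = hi) ->
  (forall i s, i < hi -> frame (For v e c) s0 s -> I i s -> iv s v = i ->
     wp m c s (fun s' t' => t' <= T /\ I (S i) (set_iv s' v (S i)))) ->
  (forall s t, frame (For v e c) s0 s -> I hi s -> iv s v = hi -> t <= hi * (T + 2) + 2 -> Q s t) ->
  wp m (For v e c) s0 Q.
Proof.
  intros Hv HM HI Hok Hbody Hend.
  apply wp_for with (hi := hi) (I := fun i s t => I i s /\ t <= i * (T + 2)); auto.
  - intros i s t Hi HF [Is Ht] Hiv. eapply wp_mono; [eapply Hbody; eauto|].
    intros s' t' [H1 H2] _. split; auto. lia.
  - intros s t HF [Is Ht] Hiv. apply Hend; auto. lia.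
Qed.

End Rules.

(* Notation and tactics for program proofs *)
Declare Scope cmd_scope.
Delimit Scope cmd_scope with cmd.
Declare Scope ie_scope.
Delimit Scope ie_scope with ie.
Declare Scope re_scope.
Delimit Scope re_scope with re.
Arguments Bi _ (_ _)%_ie.
Arguments Ar _ _%_ie.
Arguments RAr _ _%_ie.
Arguments RI _%_ie.
Arguments RBi _ (_ _)%_re.
Arguments IAsg _ _%_ie.
Arguments RAsg _ _%_re.
Arguments ISto _ (_ _)%_ie.
Arguments RSto _ _%_ie _%_re.
Arguments CLt (_ _)%_ie.
Arguments CRlt (_ _)%_re.
Arguments If _ (_ _)%_cmd.
Arguments While _ _%_cmd.
Arguments For _ _%_ie _%_cmd.
Arguments Loop _ _%_ie _%_cmd.

Notation "c1 ;; c2" := (Seq c1 c2) (at level 80, right associativity) : cmd_scope.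
Notation "v <-i e" := (IAsg v e) (at level 70) : cmd_scope.
Notation "v <-r e" := (RAsg v e) (at level 70) : cmd_scope.
Notation "a + b" := (Bi Plus a b) : ie_scope.
Notation "a - b" := (Bi Minus a b) : ie_scope.
Notation "a * b" := (Bi Times a b) : ie_scope.
Notation "a / b" := (Bi Quot a b) : ie_scope.
Notation "a 'mod' b" := (Bi Rem a b) : ie_scope.
Notation "a + b" := (RBi RAdd a b) : re_scope.
Notation "a - b" := (RBi RSub a b) : re_scope.
Notation "a * b" := (RBi RMul a b) : re_scope.

Ltac sc := cbn [iv rv ia ra set_iv set_rv set_ia set_ra put Nat.eqb ieval reval beval reval_op
  iok rok bok idx_ok].
Ltac sch H := cbn [iv rv ia ra set_iv set_rv set_ia set_ra put Nat.eqb ieval reval beval reval_op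
  iok rok bok idx_ok] in H.

(** That a variable is not among the assigned ones is decided by conversion, whence [eq_refl]. *)
Ltac fr1 := match goal with
  | H : frame ?c ?s ?s' |- context [iv ?s' ?v] => rewrite (fr_iv c s s' H v eq_refl)
  | H : frame ?c ?s ?s' |- context [rv ?s' ?v] => rewrite (fr_rv c s s' H v eq_refl)
  | H : frame ?c ?s ?s' |- context [ia ?s' ?v] => rewrite (fr_ia c s s' H v eq_refl)
  | H : frame ?c ?s ?s' |- context [ra ?s' ?v] => rewrite (fr_ra c s s' H v eq_refl)
  end.
Ltac fr := repeat (fr1; sc).

Ltac oks := sc; fr; repeat match goal with |- _ /\ _ => split end; try exact Logic.I; try lia; auto.

Ltac ws1 := lazymatch goal with
  | |- wp _ (Seq _ _) _ _ => apply wp_seq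
  | |- wp _ (IAsg _ _) _ _ => apply wp_iasg; [oks|sc]
  | |- wp _ (RAsg _ _) _ _ => apply wp_rasg; [oks|sc]
  | |- wp _ (ISto _ _ _) _ _ => apply wp_isto; [oks|sc]
  | |- wp _ (RSto _ _ _) _ _ => apply wp_rsto; [oks|sc]
  | |- wp _ Skip _ _ => apply wp_skip; sc
  end.
Ltac ws := repeat ws1.
Ltac wif H := repeat ws1; lazymatch goal with
  | |- wp _ (If (CLt _ _) _ _) _ _ => apply wp_ifi; [oks|sc; intros H|sc; intros H]
  | |- wp _ (If (CRlt _ _) _ _) _ _ => apply wp_ifr; [oks|sc; intros H|sc; intros H]
  end; ws.
Ltac wsi := repeat lazymatch goal with
  | |- wp _ (Seq _ _) _ _ => apply wp_seq
  | |- wp _ (IAsg _ _) _ _ => apply wp_iasg; [oks|sc]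
  end.

(** * Counting and ranks in lists *)

Notation "x <=r y" := (Rle x y) (at level 70, only parsing).
Notation "x <r y" := (Rlt x y) (at level 70, only parsing).

Definition seg {A} (f : nat -> A) (a n : nat) : list A := map f (seq a n).
Definition cnt {A} (p : A -> bool) (l : list A) : nat := length (filter p l).
Definition ltb (v : R) : R -> bool := fun a => if Rlt_dec a v then true else false.
Definition leb (v : R) : R -> bool := fun a => if Rle_dec a v then true else false.
(** Membership of v is not stated: the gap between the two counts forces it. Counts pass through
    permutations, concatenations and filters more easily. *)
Definition rk (l : list R) (k : nat) (v : R) : Prop := cnt (ltb v) l <= k < cnt (leb v) l.

Lemma ltb_spec v a : reflect (a < v)%R (ltb v a).
Proof. unfold ltb; destruct (Rlt_dec a v); constructor; auto. Qed.
Lemma leb_spec v a : reflect (a <= v)%R (leb v a).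
Proof. unfold leb; destruct (Rle_dec a v); constructor; auto. Qed.

Lemma seg_S {A} (f : nat -> A) a n : seg f a (S n) = seg f a n ++ [f (a + n)].
Proof. unfold seg. rewrite seq_S, map_app. reflexivity. Qed.

Lemma seg_length {A} (f : nat -> A) a n : length (seg f a n) = n.
Proof. unfold seg. rewrite length_map, length_seq; auto. Qed.

Lemma seg_app {A} (f : nat -> A) a n k : seg f a (n + k) = seg f a n ++ seg f (a + n) k.
Proof. unfold seg. rewrite seq_app, map_app. reflexivity. Qed.

Lemma seg_ext {A} (f g : nat -> A) a n :
  (forall i, a <= i < a + n -> f i = g i) -> seg f a n = seg g a n.
Proof. intros H. apply map_ext_in. intros i Hi. apply in_seq in Hi. apply H; lia. Qed.

Lemma seg_shift {A} (f : nat -> A) a n : seg f a n = seg (fun i => f (a + i)) 0 n.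
Proof.
  induction n as [|n IH]; [reflexivity|]. rewrite !seg_S, IH. reflexivity.
Qed.

Lemma in_seg {A} (f : nat -> A) a n x : In x (seg f a n) <-> exists i, a <= i < a + n /\ f i = x.
Proof.
  unfold seg. rewrite in_map_iff. split; intros (i & H1 & H2).
  - apply in_seq in H2. eauto.
  - exists i. split; auto. apply in_seq; lia.
Qed.

Lemma seg_map {A B} (h : A -> B) (f : nat -> A) a n : map h (seg f a n) = seg (fun i => h (f i)) a n.
Proof. unfold seg. apply map_map. Qed.

Lemma cnt_app {A} (p : A -> bool) l1 l2 : cnt p (l1 ++ l2) = cnt p l1 + cnt p l2.
Proof. unfold cnt. rewrite filter_app, length_app; auto. Qed.

Lemma cnt_cons {A} (p : A -> bool) x l : cnt p (x :: l) = (if p x then 1 else 0) + cnt p l.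
Proof. unfold cnt; simpl. destruct (p x); auto. Qed.

Lemma cnt_seg_S {A} (p : A -> bool) f a n :
  cnt p (seg f a (S n)) = cnt p (seg f a n) + if p (f (a + n)) then 1 else 0.
Proof. rewrite seg_S, cnt_app, cnt_cons. change (cnt p []) with 0. lia. Qed.

Lemma cnt_le_length {A} (p : A -> bool) l : cnt p l <= length l.
Proof. induction l; [reflexivity|]. rewrite cnt_cons; simpl. destruct (p a); lia. Qed.

Lemma cnt_seg_le {A} (p : A -> bool) f a n : cnt p (seg f a n) <= n.
Proof. rewrite <- (seg_length f a n) at 2. apply cnt_le_length. Qed.

Lemma cnt_perm {A} (p : A -> bool) l1 l2 : Permutation l1 l2 -> cnt p l1 = cnt p l2.
Proof. intros H; unfold cnt. induction H; simpl; auto; repeat destruct (p _); simpl; congruence. Qed.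

Lemma cnt_mono {A} (p q : A -> bool) l :
  (forall x, In x l -> p x = true -> q x = true) -> cnt p l <= cnt q l.
Proof.
  induction l as [|a l IH]; intros H; [reflexivity|]. rewrite !cnt_cons.
  specialize (IH (fun x Hx => H x (or_intror Hx))).
  destruct (p a) eqn:E; [rewrite (H a (or_introl eq_refl) E)|]; lia.
Qed.

Lemma cnt_ext {A} (p q : A -> bool) l : (forall x, In x l -> p x = q x) -> cnt p l = cnt q l.
Proof.
  intros H. apply Nat.le_antisymm; apply cnt_mono; intros x Hx E; [rewrite <- H|rewrite H]; auto.
Qed.

Lemma cnt_all {A} (p : A -> bool) l : (forall x, In x l -> p x = true) -> cnt p l = length l.
Proof.
  induction l as [|a l IH]; intros H; [reflexivity|]. rewrite cnt_cons, (H a), IH; simpl; auto.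
  intros x Hx; apply H; simpl; auto.
Qed.

Lemma cnt_none {A} (p : A -> bool) l : (forall x, In x l -> p x = false) -> cnt p l = 0.
Proof.
  induction l as [|a l IH]; intros H; [reflexivity|]. rewrite cnt_cons, (H a), IH; simpl; auto.
  intros x Hx; apply H; simpl; auto.
Qed.

Lemma cnt_neg {A} (p : A -> bool) l : cnt p l + cnt (fun x => negb (p x)) l = length l.
Proof. induction l as [|a l IH]; [reflexivity|]. rewrite !cnt_cons; simpl. destruct (p a); simpl; lia. Qed.

Lemma cnt_ex {A} (p : A -> bool) l : cnt p l < length l -> exists x, In x l /\ p x = false.
Proof.
  intros H. induction l as [|a l IH]; [simpl in H; unfold cnt in H; simpl in H; lia|].
  rewrite cnt_cons in H. simpl in H. destruct (p a) eqn:E.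
  - destruct IH as (x & Hx & E'); [lia|]. exists x; simpl; auto.
  - exists a; simpl; auto.
Qed.

Lemma cnt_pos {A} (p : A -> bool) l : 0 < cnt p l -> exists x, In x l /\ p x = true.
Proof.
  intros H. destruct (cnt_ex (fun x => negb (p x)) l) as (x & Hx & E).
  - pose proof (cnt_neg p l); lia.
  - exists x; split; auto. destruct (p x); auto; discriminate.
Qed.

Lemma cnt_filter {A} (p q : A -> bool) l : cnt p (filter q l) = cnt (fun x => q x && p x) l.
Proof.
  induction l as [|a l IH]; [reflexivity|]. simpl. rewrite cnt_cons, <- IH.
  destruct (q a); simpl; [rewrite cnt_cons|]; auto.
Qed.

Ltac eqbs := repeat match goal with
  | |- context [?a =? ?b] => destruct (Nat.eqb_spec a b) end; try lia.

Definition swap (i j x : nat) : nat := if x =? i then j else if x =? j then i else x.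

(** [swap] is an involution of the index range, hence permutes it. *)
Lemma seg_swap {A} (f g : nat -> A) b n i j : b <= i < b + n -> b <= j < b + n ->
  (forall x, b <= x < b + n -> g x = f (swap i j x)) -> Permutation (seg f b n) (seg g b n).
Proof.
  intros Hi Hj H. rewrite (seg_ext g (fun x => f (swap i j x))) by auto.
  unfold seg. rewrite <- (map_map (swap i j) f). apply Permutation_map.
  assert (Inv : forall x, swap i j (swap i j x) = x).
  { intros x. unfold swap. destruct (Nat.eqb_spec x i); [|destruct (Nat.eqb_spec x j)]; eqbs. }
  assert (Rg : forall x, b <= x < b + n -> b <= swap i j x < b + n).
  { intros x Hx. unfold swap. eqbs. }
  apply NoDup_Permutation.
  - apply seq_NoDup.
  - apply FinFun.Injective_map_NoDup; [|apply seq_NoDup].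
    intros x y E. rewrite <- (Inv x), <- (Inv y), E; auto.
  - intros x. rewrite in_map_iff. split.
    + intros Hx. exists (swap i j x). split; auto. apply in_seq in Hx. apply in_seq. apply Rg; lia.
    + intros (y & <- & Hy). apply in_seq in Hy. apply in_seq. apply Rg; lia.
Qed.

(** More than k entries lie below p, so some entry below p is not below v. Hence v < p, and the
    entries from p on do not count as smaller than v. *)
Lemma rk_low l k v p : rk (filter (ltb p) l) k v -> k < cnt (ltb p) l -> rk l k v.
Proof.
  intros [H1 H2] Hk. unfold rk. rewrite cnt_filter in *.
  assert (Hv : (v < p)%R).
  { destruct (cnt_ex (ltb v) (filter (ltb p) l)) as (x & Hx & E).
    - rewrite cnt_filter. unfold cnt in *; lia.
    - apply filter_In in Hx as [_ Hx]. destruct (ltb_spec v x), (ltb_spec p x); try discriminate. lra. }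
  rewrite (cnt_ext (ltb v) (fun x => ltb p x && ltb v x)).
  - split; auto. eapply Nat.lt_le_trans; [exact H2|]. apply cnt_mono. intros x _ E.
    apply andb_prop in E; tauto.
  - intros x _. destruct (ltb_spec v x), (ltb_spec p x); simpl; auto; lra.
Qed.

Definition gtb (p : R) : R -> bool := fun x => negb (leb p x).

Lemma cnt_split_high p l (q : R -> bool) : (forall x, (x <= p)%R -> q x = true) ->
  cnt q l = cnt (leb p) l + cnt q (filter (gtb p) l).
Proof.
  intros H. rewrite cnt_filter. unfold gtb. induction l as [|a l IH]; [reflexivity|].
  rewrite !cnt_cons. destruct (leb_spec p a); simpl; [rewrite H by auto|]; lia.
Qed.

(** Some entry above p is at most v, so v > p, and all the discarded entries count as smaller than
    v. *)
Lemma rk_high l k v p : rk (filter (gtb p) l) k v -> rk l (cnt (leb p) l + k) v.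
Proof.
  intros [H1 H2]. unfold rk.
  assert (Hv : (p < v)%R).
  { destruct (cnt_pos (leb v) (filter (gtb p) l)) as (x & Hx & E); [lia|].
    apply filter_In in Hx as [_ Hx]. unfold gtb in Hx.
    destruct (leb_spec v x), (leb_spec p x); try discriminate. lra. }
  rewrite (cnt_split_high p l (ltb v)), (cnt_split_high p l (leb v)); [lia| |].
  - intros x Hx. destruct (leb_spec v x); auto; lra.
  - intros x Hx. destruct (ltb_spec v x); auto; lra.
Qed.

Lemma rk_perm l1 l2 k v : Permutation l1 l2 -> rk l1 k v -> rk l2 k v.
Proof. intros H. unfold rk. rewrite !(cnt_perm _ _ _ H); auto. Qed.

(** * Sorting and searching *)

(* Names of the arrays of reals (RAW to VA), the arrays of integers (PAY to CUT), the integer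
   variables (lower case) and the real variables (initial r).  Arrays and variables are reused by
   the parts of the algorithm that do not overlap in time. *)
Notation RAW := 0 (only parsing).
Notation XA := 1 (only parsing).
Notation YA := 2 (only parsing).
Notation KEY := 3 (only parsing).
Notation WK := 4 (only parsing).
Notation VA := 5 (only parsing).
Notation PAY := 0 (only parsing).
Notation PERM := 1 (only parsing).
Notation CELL := 2 (only parsing).
Notation PT := 3 (only parsing).
Notation LO := 4 (only parsing).
Notation HI := 5 (only parsing).
Notation CUT := 6 (only parsing).

Notation vn := 0 (only parsing).
Notation sb := 1 (only parsing).
Notation sn := 2 (only parsing).
Notation si := 3 (only parsing).
Notation sj := 4 (only parsing).
Notation stmp := 5 (only parsing).
Notation bb := 6 (only parsing).
Notation bn := 7 (only parsing).
Notation bl := 8 (only parsing).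
Notation bh := 9 (only parsing).
Notation bm := 10 (only parsing).

Notation rtmp := 0 (only parsing).
Notation ru := 1 (only parsing).

(** Quadratic time is enough, since only segments that are short compared with the whole task are
    sorted. The payloads travel with the keys. *)
Definition isort : cmd := (
  For si (Vr sn) (
    For sj (Vr si) (
      If (CRlt (RAr KEY (Vr sb + Vr si)) (RAr KEY (Vr sb + Vr sj)))
        (rtmp <-r RAr KEY (Vr sb + Vr si) ;;
         RSto KEY (Vr sb + Vr si) (RAr KEY (Vr sb + Vr sj)) ;;
         RSto KEY (Vr sb + Vr sj) (RVr rtmp) ;;
         stmp <-i Ar PAY (Vr sb + Vr si) ;;
         ISto PAY (Vr sb + Vr si) (Ar PAY (Vr sb + Vr sj)) ;;
         ISto PAY (Vr sb + Vr sj) (Vr stmp))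
        Skip)))%cmd.

Definition kp (s : st) (i : nat) : R * nat := (ra s KEY i, ia s PAY i).

Definition sorted_at (K : nat -> R) (b n : nat) : Prop :=
  forall i j, i <= j < n -> K (b + i) <=r K (b + j).

Definition same_out (s0 s : st) (b n : nat) : Prop :=
  forall x, x < b \/ b + n <= x -> kp s x = kp s0 x.

Lemma isort_ok m s0 : iv s0 sb + iv s0 sn < lM m ->
  wp m isort s0 (fun s t => t <= 11 * (iv s0 sn * iv s0 sn) + 5 * iv s0 sn + 2 /\
    same_out s0 s (iv s0 sb) (iv s0 sn) /\
    Permutation (seg (kp s0) (iv s0 sb) (iv s0 sn)) (seg (kp s) (iv s0 sb) (iv s0 sn)) /\
    sorted_at (ra s KEY) (iv s0 sb) (iv s0 sn)).
Proof.
  set (b := iv s0 sb). set (n := iv s0 sn). intros HM.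
  apply wp_forc with (hi := n) (T := 9 * n + 2 + 2 * n)
    (I := fun i s => same_out s0 s b n /\ Permutation (seg (kp s0) b n) (seg (kp s) b n) /\
      sorted_at (ra s KEY) b i).
  - reflexivity.
  - lia.
  - split; [intros x _; reflexivity|split; [reflexivity|]]. intros i j; lia.
  - intros s HF. oks.
  - intros i s Hi HF (Ho & Hp & Hs) Ei.
    (* An exchange at j keeps the prefix sorted: the entries before j are at most the incoming
       entry, which in turn is smaller than the one it replaces. *)
    apply wp_forc with (hi := i) (T := 7)
      (I := fun j s => same_out s0 s b n /\ Permutation (seg (kp s0) b n) (seg (kp s) b n) /\
        sorted_at (ra s KEY) b i /\ forall x, x < j -> ra s KEY (b + x) <=r ra s KEY (b + i)).
    + reflexivity.
    + lia.
    + repeat split; auto. intros x Hx; lia.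
    + intros s' HF'. oks.
    + intros j s1 Hj HF1 (Ho1 & Hp1 & Hs1 & Hl1) Ej.
      assert (E1 : iv s1 sb = b) by (fr; auto).
      assert (E2 : iv s1 si = i) by (fr; auto).
      wif H.
      * rewrite E1, E2, Ej in *. split; [lia|split; [|split; [|split]]].
        -- intros x Hx. rewrite <- Ho1 by auto. unfold kp. sc. unfold upd. eqbs. reflexivity.
        -- rewrite Hp1. apply seg_swap with (i := b + i) (j := b + j); try lia.
           intros x Hx. unfold kp, swap. sc. unfold upd. eqbs; subst; f_equal; f_equal; lia.
        -- intros x y Hxy. unfold upd. pose proof (Hs1 x y Hxy) as Q1. pose proof (Hs1 j y) as Q2.
           pose proof (Hl1 x) as Q3.
           destruct (Nat.eq_dec x j), (Nat.eq_dec y j); eqbs; try subst x; try lra.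
           apply Q3. lia.
        -- intros x Hx. unfold upd. pose proof (Hl1 x) as Q3.
           destruct (Nat.eq_dec x j); eqbs; [lra|]. specialize (Q3 ltac:(lia)). lra.
      * rewrite E1, E2, Ej in *. split; [lia|split; [|split; [|split]]]; auto.
        intros x Hx. assert (x = j \/ x < j) as [->|] by lia; auto.
    + intros s2 t HF2 (Ho2 & Hp2 & Hs2 & Hl2) _ Ht. split; [nia|split; [|split]]; auto.
      intros x y Hxy. assert (y < i \/ y = i) as [Hy|Hy] by lia; [apply Hs2; lia|].
      subst y. assert (x = i \/ x < i) as [->|] by lia; [apply Rle_refl|]. apply Hl2; lia.
  - intros s t HF (Ho & Hp & Hs) _ Ht. split; [nia|split; [|split]]; auto.
Qed.

Definition bsearch : cmd := (
  bl <-i Cn 0 ;; bh <-i Vr bn ;;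
  While (CLt (Vr bl) (Vr bh)) (
    bm <-i (Vr bl + Vr bh) / Cn 2 ;;
    If (CRlt (RVr ru) (RAr KEY (Vr bb + Vr bm)))
      (bh <-i Vr bm)
      (bl <-i Vr bm + Cn 1)))%cmd.

Lemma bsearch_ok m s0 e : iv s0 bb + iv s0 bn < lM m -> 2 * iv s0 bn < lM m -> 3 < lM m ->
  iv s0 bn < 2 ^ e -> sorted_at (ra s0 KEY) (iv s0 bb) (iv s0 bn) ->
  wp m bsearch s0 (fun s t => t <= 4 * e + 3 /\ iv s bl <= iv s0 bn /\
    (forall x, x < iv s bl -> ra s0 KEY (iv s0 bb + x) <=r rv s0 ru) /\
    (forall x, iv s bl <= x < iv s0 bn -> rv s0 ru <r ra s0 KEY (iv s0 bb + x))).
Proof.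
  set (b := iv s0 bb). set (n := iv s0 bn). set (u := rv s0 ru).
  intros HM HM2 HM3 He Hs. unfold bsearch. ws.
  apply wp_while with (f := fun s => iv s bh - iv s bl)
   (I := fun s t => iv s bl <= iv s bh <= n /\ (exists e', iv s bh - iv s bl < 2 ^ e' /\ t + 4 * e' <= 4 * e) /\
    (forall x, x < iv s bl -> ra s0 KEY (b + x) <=r u) /\
    (forall x, iv s bh <= x < n -> u <r ra s0 KEY (b + x))).
  - sc. split; [lia|]. split; [|split; intros; lia]. exists e. fold n. lia.
  - intros s t HF _. oks.
  - intros s t HF (Hb & (e' & He1 & He2) & H1 & H2) Hl. sch Hl.
    assert (E1 : iv s bb = b) by (fr; auto). assert (E2 : rv s ru = u) by (fr; auto).
    assert (E3 : ra s KEY = ra s0 KEY) by (fr; auto).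
    destruct e' as [|e']; [simpl in He1; lia|]. simpl in He1.
    pose proof (Nat.div_mod_eq (iv s bl + iv s bh) 2) as D1.
    pose proof (Nat.mod_upper_bound (iv s bl + iv s bh) 2 ltac:(lia)) as D2.
    set (mid := (iv s bl + iv s bh) / 2) in *.
    wif H; fold mid in H |- *; rewrite ?E1, ?E2, ?E3 in *; fold mid.
    + split; [split; [lia|split; [|split]]|lia]; auto.
      * exists e'. lia.
      * intros x Hx. apply Rlt_le_trans with (1 := H). apply Hs; lia.
    + split; [split; [lia|split; [|split]]|lia]; auto.
      * exists e'. lia.
      * intros x Hx. apply Rle_trans with (2 := H). apply Hs; lia.
  - intros s t HF (Hb & (e' & He1 & He2) & H1 & H2) Hl. sch Hl. sc.
    split; [lia|]. split; [lia|]. replace (iv s bh) with (iv s bl) in * by lia. auto.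
Qed.

(** * Linear-time selection *)

Notation sdone := 11 (only parsing).
Notation p0 := 12 (only parsing).
Notation wn := 13 (only parsing).
Notation wq := 14 (only parsing).
Notation wi := 15 (only parsing).
Notation pm := 16 (only parsing).
Notation pl := 17 (only parsing).
Notation pg := 18 (only parsing).
Notation cl := 19 (only parsing).
Notation ce := 20 (only parsing).
Notation wj := 21 (only parsing).

Notation rp := 2 (only parsing).
Notation rres := 3 (only parsing).

(** The sampling bounds are proved for all downward closed predicates: they are needed for both
    [ltb v] and [leb v], and v is known only after sampling. *)
Definition down (p : R -> bool) : Prop := forall a b, a <=r b -> p b = true -> p a = true.

Lemma down_ltb v : down (ltb v).
Proof. intros a b H. destruct (ltb_spec v a), (ltb_spec v b); auto; lra. Qed.
Lemma down_leb v : down (leb v).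
Proof. intros a b H. destruct (leb_spec v a), (leb_spec v b); auto; lra. Qed.

Lemma down_prefix p (S : nat -> R) n : down p -> (forall i j, i <= j < n -> S i <=r S j) ->
  exists c, c <= n /\ forall i, i < n -> p (S i) = (i <? c).
Proof.
  intros Hp. induction n as [|n IH]; intros Hs.
  - exists 0. split; auto; intros; lia.
  - destruct IH as (c & Hc & H); [intros; apply Hs; lia|].
    destruct (p (S n)) eqn:E.
    + exists (Datatypes.S n). split; auto. intros i Hi. rewrite (proj2 (Nat.ltb_lt _ _) Hi).
      apply Hp with (S n); auto. apply Hs; lia.
    + exists c. split; [lia|]. intros i Hi. destruct (Nat.eq_dec i n) as [->|].
      * rewrite E. symmetry; apply Nat.ltb_ge; auto.
      * apply H; lia.
Qed.

Lemma cnt_prefix {A} (p : A -> bool) f n c : c <= n ->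
  (forall i, i < n -> p (f i) = (i <? c)) -> cnt p (seg f 0 n) = c.
Proof.
  revert c. induction n as [|n IH]; intros c Hc H.
  - unfold cnt, seg; simpl; lia.
  - rewrite cnt_seg_S. simpl. rewrite H by lia. destruct (Nat.eq_dec c (S n)) as [->|].
    + rewrite (IH n); [|lia|].
      * destruct (Nat.ltb_spec n (S n)); lia.
      * intros i Hi. rewrite H by lia. destruct (Nat.ltb_spec i (S n)), (Nat.ltb_spec i n); auto; lia.
    + rewrite (IH c); [|lia|].
      * destruct (Nat.ltb_spec n c); lia.
      * intros; apply H; lia.
Qed.

(** On a sorted array p holds on an initial segment. If its length is c, the sampled positions 4i +
    3 inside it number floor(c/4). *)
Lemma cnt_quarter p (S : nat -> R) q : down p -> (forall i j, i <= j < 4 * q -> S i <=r S j) ->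
  4 * cnt p (seg (fun i => S (4 * i + 3)) 0 q) <= cnt p (seg S 0 (4 * q))
  <= 4 * cnt p (seg (fun i => S (4 * i + 3)) 0 q) + 3.
Proof.
  intros Hp Hs. destruct (down_prefix p S (4 * q) Hp Hs) as (c & Hc & H).
  rewrite (cnt_prefix p S _ c) by auto.
  pose proof (Nat.div_mod_eq c 4). pose proof (Nat.mod_upper_bound c 4 ltac:(lia)).
  rewrite (cnt_prefix p _ q (c / 4)); [lia|lia|].
  intros i Hi. rewrite H by lia.
  destruct (Nat.ltb_spec (4 * i + 3) c), (Nat.ltb_spec i (c / 4)); auto; lia.
Qed.

Lemma cnt_groups p (K K1 : nat -> R) q G : down p ->
  (forall g, g < G -> sorted_at K1 (g * (4 * q)) (4 * q) /\
     Permutation (seg K (g * (4 * q)) (4 * q)) (seg K1 (g * (4 * q)) (4 * q))) ->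
  4 * cnt p (seg (fun i => K1 (4 * i + 3)) 0 (G * q)) <= cnt p (seg K 0 (G * (4 * q)))
  <= 4 * cnt p (seg (fun i => K1 (4 * i + 3)) 0 (G * q)) + 3 * G.
Proof.
  intros Hp. induction G as [|G IH]; intros H; [cbn; lia|].
  specialize (IH (fun g Hg => H g (Nat.lt_trans _ _ _ Hg (Nat.lt_succ_diag_r _)))).
  destruct (H G) as [Hs HP]; [lia|].
  replace (S G * q) with (G * q + q) by lia. replace (S G * (4 * q)) with (G * (4 * q) + 4 * q) by lia.
  rewrite !seg_app, !cnt_app. simpl (0 + _).
  rewrite (cnt_perm _ _ _ HP), (seg_shift K1), (seg_shift _ (G * q)).
  pose proof (cnt_quarter p (fun i => K1 (G * (4 * q) + i)) q Hp) as Q. simpl in Q.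
  specialize (Q Hs).
  rewrite (seg_ext (fun i => K1 (4 * (G * q + i) + 3)) (fun i => K1 (G * (4 * q) + (4 * i + 3)))).
  - simpl in *. lia.
  - intros; f_equal; lia.
Qed.

(* Keeping every fourth entry of sorted groups of length l costs a rank error of at most 3 per
   group.  The group length doubles from one level to the next while the sample shrinks by four,
   so both the running times and the relative rank errors are summable. *)
Definition pivot_level : cmd := (
  For pg (Vr pm / Vr pl) (sb <-i Vr pg * Vr pl ;; sn <-i Vr pl ;; isort) ;;
  For wi (Vr pm / Cn 4) (RSto KEY (Vr wi) (RAr KEY (Cn 4 * Vr wi + Cn 3))) ;;
  pm <-i Vr pm / Cn 4 ;; pl <-i Cn 2 * Vr pl)%cmd.

Lemma kp_fst s b n : map fst (seg (kp s) b n) = seg (ra s KEY) b n.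
Proof. apply (seg_map fst (kp s)). Qed.

Lemma pivot_level_ok m s0 q G : 1 <= q -> iv s0 pl = 4 * q -> iv s0 pm = G * (4 * q) ->
  iv s0 pm + iv s0 pm + iv s0 pl + iv s0 pl + 8 < lM m -> 1 <= G ->
  wp m pivot_level s0 (fun s t => t <= 20 * (iv s0 pm * iv s0 pl) + 20 /\
    iv s pm = G * q /\ iv s pl = 8 * q /\
    forall p, down p ->
     4 * cnt p (seg (ra s KEY) 0 (G * q)) <= cnt p (seg (ra s0 KEY) 0 (G * (4 * q)))
     <= 4 * cnt p (seg (ra s KEY) 0 (G * q)) + 3 * G).
Proof.
  intros Hq EL Em HM HG. unfold pivot_level. ws.
  assert (D1 : iv s0 pm / iv s0 pl = G) by (rewrite EL, Em; apply Nat.div_mul; lia).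
  assert (D2 : iv s0 pm / 4 = G * q).
  { rewrite Em. replace (G * (4 * q)) with (G * q * 4) by lia. apply Nat.div_mul; lia. }
  assert (HGp : G <= iv s0 pm) by nia.
  apply wp_forc with (hi := G) (T := 11 * (4 * q * (4 * q)) + 5 * (4 * q) + 4)
    (I := fun g s => (forall x, g * (4 * q) <= x -> ra s KEY x = ra s0 KEY x) /\
     forall g', g' < g -> sorted_at (ra s KEY) (g' * (4 * q)) (4 * q) /\
     Permutation (seg (ra s0 KEY) (g' * (4 * q)) (4 * q)) (seg (ra s KEY) (g' * (4 * q)) (4 * q))).
  - reflexivity.
  - lia.
  - split; [auto|intros; lia].
  - intros s HF. oks.
  - intros g s Hg HF (Ho & Hs) Eg.
    assert (E1 : iv s pl = 4 * q) by (fr; auto).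
    assert (B : g * (4 * q) + 4 * q <= iv s0 pm) by nia.
    ws; rewrite ?Eg, ?E1; try lia.
    eapply wp_mono; [apply isort_ok|]; sc; rewrite ?Eg, ?E1; try lia.
    intros s' t (Ht & Ho1 & Hp1 & Hs1) F. split; [lia|]. split.
    + intros x Hx. pose proof (Ho1 x) as Q. unfold kp in Q. sch Q.
      assert (Q' : (ra s' KEY x, ia s' PAY x) = (ra s KEY x, ia s PAY x)) by (apply Q; lia).
      inversion Q' as [Q2]. rewrite Q2. apply Ho; lia.
    + intros g' Hg'. apply (Permutation_map fst) in Hp1. rewrite !kp_fst in Hp1. sch Hp1.
      destruct (Nat.eq_dec g' g) as [->|].
      * split; auto. rewrite <- Hp1. rewrite (seg_ext (ra s KEY) (ra s0 KEY)); auto.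
        intros i Hi; apply Ho; lia.
      * assert (HH : forall i, i < 4 * q -> ra s' KEY (g' * (4 * q) + i) = ra s KEY (g' * (4 * q) + i)).
        { intros i Hi. pose proof (Ho1 (g' * (4 * q) + i)) as Q. unfold kp in Q. sch Q.
          assert (g' * (4 * q) + i < g * (4 * q)) by nia.
          specialize (Q ltac:(lia)). inversion Q; auto. }
        destruct (Hs g') as [S1 P1]; [lia|]. split.
        -- intros i j Hij. rewrite !HH by lia. apply S1; auto.
        -- rewrite P1. rewrite (seg_ext (ra s' KEY) (ra s KEY)); auto.
           intros i Hi. replace i with (g' * (4 * q) + (i - g' * (4 * q))) by lia. apply HH; lia.
  - intros s t HF (Ho & Hs) Eg Ht.
    assert (E1 : iv s pl = 4 * q) by (fr; auto). assert (E2 : iv s pm = iv s0 pm) by (fr; auto).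
    apply wp_seq.
    apply wp_forc with (hi := G * q) (T := 1) (I := fun i s' => (forall x, x < i -> ra s' KEY x = ra s KEY (4 * x + 3)) /\
      forall x, i <= x -> ra s' KEY x = ra s KEY x).
    + reflexivity.
    + lia.
    + split; intros; [lia|auto].
    + intros s' HF'. oks.
    + intros i s1 Hi HF1 (H1 & H2) Ei. ws. split; [lia|]. split.
      * intros x Hx. unfold upd. rewrite Ei. eqbs; [subst x; apply H2; lia|apply H1; lia].
      * intros x Hx. unfold upd. rewrite Ei. eqbs. apply H2; lia.
    + intros s1 t1 HF1 (H1 & H2) _ Ht1.
      assert (E3 : iv s1 pl = 4 * q) by (fr; auto). assert (E4 : iv s1 pm = iv s0 pm) by (fr; auto).
      ws. rewrite E3, E4, D2.
      split; [rewrite Em, EL in *; nia|]. split; auto. split; [lia|].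
      intros p Hp. rewrite (seg_ext (ra s1 KEY) (fun i => ra s KEY (4 * i + 3)) 0 (G * q)) by (intros; apply H1; lia).
      apply cnt_groups; auto.
Qed.

(** Only the first p0 entries are sampled, where p0 is the largest power of two up to the length.
    They are more than half of the list, and all groups divide them evenly. *)
Definition pivot : cmd := (
  p0 <-i Cn 1 ;;
  While (CLt (Cn 2 * Vr p0) (Vr wn + Cn 1)) (p0 <-i Cn 2 * Vr p0) ;;
  For wi (Vr p0) (RSto KEY (Vr wi) (RAr WK (Vr wi))) ;;
  pm <-i Vr p0 ;; pl <-i Cn 64 ;;
  While (CLt (Vr pl) (Vr pm + Cn 1)) pivot_level ;;
  sb <-i Cn 0 ;; sn <-i Vr pm ;; isort ;;
  rp <-r RAr KEY (Vr pm / Cn 2))%cmd.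

Lemma pow_split a b : a <= b -> 2 ^ b = 2 ^ (b - a) * 2 ^ a.
Proof. intros H. rewrite <- Nat.pow_add_r. f_equal; lia. Qed.

Lemma pow_le_inv a b : 2 ^ a <= 2 ^ b -> a <= b.
Proof. intros H. apply Nat.pow_le_mono_r_iff with 2; lia. Qed.

(** Let p be the number of sampled entries, so p > N/2. The pivot is the median of the last sample,
    so at least p/2 > N/4 entries are at most the pivot. The rank errors of the levels sum to at
    most 3p/32, so at most p/2 + 3p/32 = 19p/32 sampled entries are below it; with the N - p others
    this makes at most N - 13p/32 <= 51N/64. *)
Lemma pivot_ok m s0 : 1 <= iv s0 wn -> 4 * iv s0 wn + 400 < lM m ->
  wp m pivot s0 (fun s t => t <= 5000 * iv s0 wn /\
    iv s0 wn <= 4 * cnt (leb (rv s rp)) (seg (ra s0 WK) 0 (iv s0 wn)) /\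
    64 * cnt (ltb (rv s rp)) (seg (ra s0 WK) 0 (iv s0 wn)) <= 51 * iv s0 wn).
Proof.
  set (N := iv s0 wn). intros HN HM. unfold pivot. ws.
  apply wp_while with (f := fun s => N - iv s p0)
    (I := fun s t => t <= 2 * iv s p0 /\ exists a, iv s p0 = 2 ^ a /\ 2 ^ a <= N).
  { sc. split; [lia|]. exists 0. simpl; lia. }
  { intros s t HF (Ht & a & Ha & HaN). assert (iv s wn = N) by (fr; auto). oks. }
  { intros s t HF (Ht & a & Ha & HaN) Hl. assert (Ew : iv s wn = N) by (fr; auto). sch Hl.
    pose proof (Nat.pow_nonzero 2 a).
    ws. split; [|lia]. split; [lia|]. exists (S a). simpl. lia. }
  intros s1 t1 HF1 (Ht1 & a & Ha & HaN) Hl. assert (Ew1 : iv s1 wn = N) by (fr; auto). sch Hl.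
  assert (EW : ra s1 WK = ra s0 WK) by (fr; auto).
  set (p := iv s1 p0) in *.
  assert (Hp1 : 1 <= p) by (pose proof (Nat.pow_nonzero 2 a); lia).
  ws. apply wp_forc with (hi := p) (T := 1) (I := fun i s => forall x, x < i -> ra s KEY x = ra s0 WK x).
  { reflexivity. } { lia. } { intros; lia. } { intros s HF. oks. }
  { intros i s Hi HF HI Ei. ws. split; [lia|]. intros x Hx. unfold upd. fr.
    rewrite Ei. eqbs; [subst; auto|apply HI; lia]. }
  intros s2 t2 HF2 HK _ Ht2. assert (E2 : iv s2 p0 = p) by (fr; auto).
  ws. rewrite E2.
  (* [W] is the number of original entries that one sample entry stands for. The last clause is c0
     <= W c + (3/32 - 6/2^l) p for the counts c0 in the original and c in the sample: the error
     3p/2^l of each level since l = 6 is summed. The potential 50 [pm] [pl] halves at each level and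
     pays for it. *)
  apply wp_while with (f := fun s => iv s pm)
   (I := fun s t => t + 50 * (iv s pm * iv s pl) <= 50 * (p * 64) /\
     exists l b W, iv s pm = 2 ^ b /\ iv s pl = 2 ^ l /\ 6 <= l /\ p = W * 2 ^ b /\ iv s pl <= 2 * p + 64 /\
      forall pr, down pr -> W * cnt pr (seg (ra s KEY) 0 (2 ^ b)) <= cnt pr (seg (ra s0 WK) 0 p) /\
        32 * (2 ^ l * cnt pr (seg (ra s0 WK) 0 p)) + 192 * p <=
        32 * (2 ^ l * (W * cnt pr (seg (ra s KEY) 0 (2 ^ b)))) + 3 * (p * 2 ^ l)).
  { sc. split; [lia|]. exists 6, a, 1. split; [lia|]. split; [reflexivity|]. split; [lia|].
    split; [lia|]. split; [lia|].
    intros pr _. rewrite <- Ha. fold p. rewrite (seg_ext (ra s2 KEY) (ra s0 WK)) by (intros; apply HK; lia).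
    change (2 ^ 6) with 64. lia. }
  { intros s t HF (Ht & l & b & W & Em & El & Hl6 & Hp & Hplp & _).
    assert (iv s pm <= p) by (rewrite Em, Hp; destruct W; [lia|apply Nat.le_add_r]). oks. }
  { intros s t HF (Ht & l & b & W & Em & El & Hl6 & Hp & Hplp & HI) Hlt. sch Hlt.
    assert (Hlb : l <= b) by (apply pow_le_inv; lia).
    set (q := 2 ^ (l - 2)).
    assert (Eq : 2 ^ l = 4 * q) by (rewrite (pow_split 2 l) by lia; fold q; simpl; lia).
    assert (EG : 2 ^ b = 2 ^ (b - l) * (4 * q)) by (rewrite <- Eq; apply pow_split; lia).
    set (G := 2 ^ (b - l)) in *.
    assert (HG : 1 <= G) by (pose proof (Nat.pow_nonzero 2 (b - l)); unfold G; lia).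
    assert (Hq : 16 <= q).
    { unfold q. change 16 with (2 ^ 4). apply Nat.pow_le_mono_r; lia. }
    assert (iv s pm <= p) by (rewrite Em, Hp; destruct W; [lia|apply Nat.le_add_r]).
    eapply wp_mono; [apply (pivot_level_ok m s q G); try lia|].
    intros s' t' (Ht' & Em' & El' & Hc) _. rewrite Em', El'.
    assert (Eb : G * q = 2 ^ (b - 2)).
    { unfold G, q. rewrite <- Nat.pow_add_r. f_equal; lia. }
    assert (Em0 : iv s pm = 4 * (G * q)) by lia.
    assert (El0 : iv s pl = 4 * q) by lia.
    split; [split|].
    - rewrite Em0, El0 in *. nia.
    - exists (S l), (b - 2), (4 * W). split; [auto|]. split; [simpl; lia|]. split; [lia|].
      rewrite <- Eb. split; [lia|]. split; [lia|].
      intros pr Hpr. destruct (HI pr Hpr) as [I1 I2]. destruct (Hc pr Hpr) as [C1 C2].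
      rewrite <- EG in C1, C2.
      replace (2 ^ S l) with (2 * 2 ^ l) by reflexivity.
      set (c' := cnt pr (seg (ra s' KEY) 0 (G * q))) in *.
      set (c := cnt pr (seg (ra s KEY) 0 (2 ^ b))) in *.
      set (c0 := cnt pr (seg (ra s0 WK) 0 p)) in *.
      split; [apply Nat.le_trans with (W * c); [rewrite (Nat.mul_comm 4 W), <- Nat.mul_assoc; apply Nat.mul_le_mono_l; auto|auto]|].
      assert (A1 : W * c <= W * (4 * c' + 3 * G)) by (apply Nat.mul_le_mono_l; auto).
      assert (A2 : 2 ^ l * (W * c) <= 2 ^ l * (W * (4 * c' + 3 * G))) by (apply Nat.mul_le_mono_l; auto).
      assert (Hp2 : p = 2 ^ l * (W * G)) by (rewrite Hp, EG, Eq; ring).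
      replace (2 ^ l * (W * (4 * c' + 3 * G))) with (4 * (2 ^ l * (W * c')) + 3 * p) in A2
        by (rewrite Hp2; ring).
      replace (32 * (2 * 2 ^ l * (4 * W * c'))) with (32 * (2 * (4 * (2 ^ l * (W * c'))))) by ring.
      replace (2 * 2 ^ l * c0) with (2 * (2 ^ l * c0)) by ring.
      replace (p * (2 * 2 ^ l)) with (2 * (p * 2 ^ l)) by ring.
      clear - A2 I2. lia.
    - lia. }
  intros s3 t3 HF3 (Ht3 & l & b & W & Em & El & Hl6 & Hp & Hplp & HI) Hlt. sch Hlt.
  assert (Hb1 : 1 <= 2 ^ b) by (pose proof (Nat.pow_nonzero 2 b); lia).
  assert (HW : 1 <= W) by (destruct W; lia).
  assert (iv s3 pm <= p) by (rewrite Em, Hp; destruct W; [lia|apply Nat.le_add_r]).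
  ws. eapply wp_mono; [apply isort_ok|]; sc; [lia|].
  intros s4 t4 (Ht4 & _ & Hperm & Hs) F4.
  apply (Permutation_map fst) in Hperm. rewrite !kp_fst in Hperm. sch Hperm.
  set (M := iv s3 pm) in *. assert (EM4 : iv s4 pm = M) by (fr; auto).
  pose proof (Nat.div_mod_eq M 2) as D1. pose proof (Nat.mod_upper_bound M 2 ltac:(lia)) as D2.
  assert (HH : M / 2 < M) by lia.
  ws; [fold M; lia|]. rewrite EM4.
  set (v := ra s4 KEY (M / 2)).
  rewrite Em in *. fold M in Em. rewrite <- Em in *.
  split; [assert (M * M <= M * iv s3 pl) by (apply Nat.mul_le_mono_l; lia); lia|].
  assert (C1 : M / 2 + 1 <= cnt (leb v) (seg (ra s3 KEY) 0 M)).
  { rewrite (cnt_perm _ _ _ Hperm). replace M with (M / 2 + 1 + (M - (M / 2 + 1))) at 2 by lia.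
    rewrite seg_app, cnt_app. rewrite cnt_all; [rewrite seg_length; lia|].
    intros x Hx. apply in_seg in Hx as (i & Hi & <-). destruct (leb_spec v (ra s4 KEY i)) as [|Hn]; auto.
    exfalso; apply Hn. apply (Hs i (M / 2)). lia. }
  assert (C2 : cnt (ltb v) (seg (ra s3 KEY) 0 M) <= M / 2).
  { rewrite (cnt_perm _ _ _ Hperm). replace M with (M / 2 + (M - M / 2)) at 1 by lia.
    rewrite seg_app, cnt_app. rewrite (cnt_none _ (seg _ (0 + _) _)).
    - pose proof (cnt_seg_le (ltb v) (ra s4 KEY) 0 (M / 2)). lia.
    - intros x Hx. apply in_seg in Hx as (i & Hi & <-). destruct (ltb_spec v (ra s4 KEY i)) as [Hn|]; auto.
      exfalso. apply (Rlt_not_le _ _ Hn). apply (Hs (M / 2) i). lia. }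
  destruct (HI (leb v) (down_leb v)) as [I1 _]. destruct (HI (ltb v) (down_ltb v)) as [_ I2].
  replace N with (p + (N - p)) by lia. rewrite seg_app, !cnt_app.
  split.
  - assert (A1 : W * M <= W * (2 * cnt (leb v) (seg (ra s3 KEY) 0 M))) by (apply Nat.mul_le_mono_l; lia).
    clear - A1 I1 Hp HaN Ha Hl Ew1. fold p in Hl, Ha. lia.
  - pose proof (cnt_seg_le (ltb v) (ra s0 WK) (0 + p) (N - p)) as C3.
    set (c0 := cnt (ltb v) (seg (ra s0 WK) 0 p)) in *.
    set (c := cnt (ltb v) (seg (ra s3 KEY) 0 M)) in *.
    assert (A1 : W * (2 * c) <= p) by (rewrite Hp; apply Nat.mul_le_mono_l; lia).
    assert (A2 : 2 ^ l * (32 * c0) <= 2 ^ l * (19 * p)).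
    { assert (2 ^ l * (W * (2 * c)) <= 2 ^ l * p) by (apply Nat.mul_le_mono_l; auto).
      clear - H0 I2. lia. }
    apply Nat.mul_le_mono_pos_l in A2; [clear - A2 C3 HaN Ha Hl Ew1; fold p in Ha, Hl; lia|]. pose proof (Nat.pow_nonzero 2 l); lia.
Qed.

Definition count3 : cmd := (
  cl <-i Cn 0 ;; ce <-i Cn 0 ;;
  For wi (Vr wn) (
    If (CRlt (RAr WK (Vr wi)) (RVr rp)) (cl <-i Vr cl + Cn 1) Skip ;;
    If (CRlt (RVr rp) (RAr WK (Vr wi))) Skip (ce <-i Vr ce + Cn 1)))%cmd.

Lemma count3_ok m s0 : iv s0 wn + 3 < lM m ->
  wp m count3 s0 (fun s t => t <= 6 * iv s0 wn + 4 /\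
    iv s cl = cnt (ltb (rv s0 rp)) (seg (ra s0 WK) 0 (iv s0 wn)) /\
    iv s ce = cnt (leb (rv s0 rp)) (seg (ra s0 WK) 0 (iv s0 wn))).
Proof.
  intros HM. set (v := rv s0 rp). set (N := iv s0 wn). unfold count3. ws.
  apply wp_forc with (hi := N) (T := 4) (I := fun i s => i <= N /\
    iv s cl = cnt (ltb v) (seg (ra s0 WK) 0 i) /\ iv s ce = cnt (leb v) (seg (ra s0 WK) 0 i)).
  - reflexivity.
  - lia.
  - split; [lia|split; reflexivity].
  - intros s HF. oks.
  - intros i s Hi HF (Hle & H1 & H2) Ei.
    assert (E1 : ra s WK = ra s0 WK) by (fr; auto). assert (E2 : rv s rp = v) by (fr; auto).
    pose proof (cnt_seg_le (ltb v) (ra s0 WK) 0 i). pose proof (cnt_seg_le (leb v) (ra s0 WK) 0 i).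
    apply wp_seq. eapply wp_mono with (Q := fun s' t => t <= 2 /\
      iv s' cl = cnt (ltb v) (seg (ra s0 WK) 0 (S i))).
    { rewrite cnt_seg_S. simpl (0 + _). destruct (ltb_spec v (ra s0 WK i)) as [Hl|Hl];
      wif H3; rewrite ?E1, ?E2, ?Ei in H3; split; try lia; exfalso; lra. }
    intros s' t' (Ht & H3) F.
    assert (E1' : ra s' WK = ra s WK) by (apply (fr_ra _ _ _ F); auto).
    assert (E2' : rv s' rp = rv s rp) by (apply (fr_rv _ _ _ F); auto).
    assert (Ei' : iv s' wi = iv s wi) by (apply (fr_iv _ _ _ F); auto).
    assert (Ec' : iv s' ce = iv s ce) by (apply (fr_iv _ _ _ F); auto).
    rewrite (cnt_seg_S (leb v)). simpl (0 + i). destruct (leb_spec v (ra s0 WK i)) as [Hl|Hl];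
      wif H4; rewrite ?E1', ?E1, ?E2', ?E2, ?Ei', ?Ei in H4; try (exfalso; lra); (split; [lia|split; [lia|split; [auto|lia]]]).
  - intros s t HF (_ & H1 & H2) _ Ht. split; [lia|auto].
Qed.

Definition compress (a b : rexp) : cmd := (
  wj <-i Cn 0 ;;
  For wi (Vr wn) (
    If (CRlt a b) (RSto WK (Vr wj) (RAr WK (Vr wi)) ;; wj <-i Vr wj + Cn 1) Skip) ;;
  wn <-i Vr wj)%cmd.

Lemma compress_ok m s0 a b (pr : R -> bool) : iv s0 wn + 3 < lM m ->
  (forall s, iv s wi < lM m -> rv s rp = rv s0 rp ->
    (rok m s a /\ rok m s b) /\ (reval s a <r reval s b <-> pr (ra s WK (iv s wi)) = true)) ->
  wp m (compress a b) s0 (fun s t => t <= 5 * iv s0 wn + 4 /\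
    seg (ra s WK) 0 (iv s wn) = filter pr (seg (ra s0 WK) 0 (iv s0 wn))).
Proof.
  intros HM Hab. set (N := iv s0 wn) in *. unfold compress. ws.
  apply wp_forc with (hi := N) (T := 3) (I := fun i s => iv s wj <= i /\
    seg (ra s WK) 0 (iv s wj) = filter pr (seg (ra s0 WK) 0 i) /\
    (forall x, i <= x -> ra s WK x = ra s0 WK x)).
  - reflexivity.
  - lia.
  - sc; split; [lia|split; [reflexivity|auto]].
  - intros s HF. oks.
  - intros i s Hi HF (Hj & H1 & H2) Ei.
    destruct (Hab s) as [Hok Hr]; [lia|fr; auto|]. rewrite Ei, H2 in Hr by lia.
    rewrite seg_S, filter_app. simpl (0 + i). simpl (filter _ [_]).
    apply wp_ifr; auto; intros Hlt.
    + apply Hr in Hlt. rewrite Hlt. ws. rewrite Ei. split; [lia|].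
      replace (iv s wj + 1) with (S (iv s wj)) by lia. split; [lia|]. split.
      * rewrite seg_S. f_equal.
        -- rewrite <- H1. apply seg_ext. intros x Hx. unfold upd. eqbs; auto.
        -- unfold upd. simpl. rewrite Nat.eqb_refl. rewrite H2 by lia; auto.
      * intros x Hx. unfold upd. eqbs. apply H2; lia.
    + destruct (pr (ra s0 WK i)); [exfalso; destruct Hr as [_ Hr]; specialize (Hr eq_refl); lra|]. ws. split; [lia|]. split; [lia|]. rewrite app_nil_r.
      split; auto. intros x Hx; apply H2; lia.
  - intros s t HF (Hj & H1 & H2) Ei Ht. ws. split; [lia|auto].
Qed.

Definition select_step : cmd := (
  pivot ;; count3 ;;
  If (CLt (Vr wq) (Vr cl)) (compress (RAr WK (Vr wi)) (RVr rp))
    (If (CLt (Vr wq) (Vr ce)) (rres <-r RVr rp ;; sdone <-i Cn 1)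
       (compress (RVr rp) (RAr WK (Vr wi)) ;; wq <-i Vr wq - Vr ce)))%cmd.

Lemma gtb_reflect v a : reflect (v <r a) (gtb v a).
Proof. unfold gtb. destruct (leb_spec v a); simpl; constructor; lra. Qed.

(** At most 51/64 of the entries are below the pivot and at most 3/4 above it, and both fractions
    are less than 7/8. *)
Lemma select_step_ok m s0 : iv s0 wq < iv s0 wn -> 4 * iv s0 wn + 400 < lM m ->
  iv s0 sdone = 0 ->
  wp m select_step s0 (fun s t => t <= 80 * 63 * iv s0 wn /\ iv s wn <= iv s0 wn /\
    ((iv s sdone = 1 /\ rk (seg (ra s0 WK) 0 (iv s0 wn)) (iv s0 wq) (rv s rres)) \/
     (iv s sdone = 0 /\ 8 * iv s wn <= 7 * iv s0 wn /\ iv s wq < iv s wn /\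
      forall v, rk (seg (ra s WK) 0 (iv s wn)) (iv s wq) v ->
        rk (seg (ra s0 WK) 0 (iv s0 wn)) (iv s0 wq) v))).
Proof.
  intros Hq HM Hd. set (N := iv s0 wn) in *. set (q := iv s0 wq) in *. unfold select_step. ws.
  eapply wp_mono; [apply pivot_ok; lia|]. fold N. intros s1 t1 (Ht1 & P1 & P2) F1. ws.
  assert (E1 : iv s1 wn = N) by (fr; auto). assert (E2 : ra s1 WK = ra s0 WK) by (fr; auto).
  set (v := rv s1 rp) in *.
  eapply wp_mono; [apply count3_ok; lia|]. fold v. rewrite E1, E2.
  intros s2 t2 (Ht2 & C1 & C2) F2.
  set (l := seg (ra s0 WK) 0 N) in *.
  assert (El : length l = N) by (apply seg_length).
  assert (G1 : iv s2 wn = N) by (fr; auto). assert (G2 : ra s2 WK = ra s0 WK) by (fr; auto).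
  assert (G3 : rv s2 rp = v) by (fr; auto). assert (G4 : iv s2 wq = q) by (fr; auto).
  assert (G5 : iv s2 sdone = 0) by (fr; auto).
  wif H.
  - eapply wp_mono; [apply (compress_ok m s2 _ _ (ltb v)); [lia|]|].
    { intros s Hs Hv. split; [oks|]. sc. rewrite Hv, G3. apply reflect_iff, ltb_spec. }
    rewrite G1, G2. fold l. intros s3 t3 (Ht3 & Hf) F3.
    assert (Ew : iv s3 wn = cnt (ltb v) l).
    { apply (f_equal (@length R)) in Hf. rewrite seg_length in Hf. exact Hf. }
    assert (Eq : iv s3 wq = q) by (fr; auto). rewrite G4, C1 in H.
    split; [lia|]. split; [lia|]. right.
    split; [fr; auto|]. split; [lia|]. split; [lia|].
    intros u Hu. rewrite Hf, Eq in Hu. apply rk_low with v; auto.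
  - rewrite G4, C1 in H. wif H'; rewrite G4, C2 in H'.
    + split; [lia|]. split; [lia|]. left. split; auto. rewrite G3. split; lia.
    + eapply wp_mono; [apply (compress_ok m s2 _ _ (gtb v)); [lia|]|].
      { intros s Hs Hv. split; [oks|]. sc. rewrite Hv, G3. apply reflect_iff, gtb_reflect. }
      rewrite G1, G2. fold l. intros s3 t3 (Ht3 & Hf) F3.
      assert (Ew : iv s3 wn = N - cnt (leb v) l).
      { apply (f_equal (@length R)) in Hf. rewrite seg_length in Hf. rewrite Hf, <- El.
        rewrite <- (cnt_neg (leb v) l). unfold cnt at 2. unfold gtb. lia. }
      assert (Eq : iv s3 wq = q) by (fr; auto). assert (Ec : iv s3 ce = cnt (leb v) l) by (fr; auto).
      ws. rewrite Eq, Ec, Ew. split; [lia|]. split; [lia|]. right.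
      split; [fr; auto|]. split; [lia|]. split; [lia|].
      intros u Hu. rewrite <- Ew, Hf in Hu. apply rk_high in Hu.
      replace (cnt (leb v) l + (q - cnt (leb v) l)) with q in Hu by lia. auto.
Qed.

Definition select : cmd := (sdone <-i Cn 0 ;; While (CLt (Vr sdone) (Cn 1)) select_step)%cmd.

Lemma select_ok m s0 : iv s0 wq < iv s0 wn -> 4 * iv s0 wn + 400 < lM m ->
  wp m select s0 (fun s t => t <= 640 * 65 * iv s0 wn /\
    rk (seg (ra s0 WK) 0 (iv s0 wn)) (iv s0 wq) (rv s rres)).
Proof.
  intros Hq HM. set (N := iv s0 wn) in *. set (q := iv s0 wq) in *. unfold select. ws.
  (* The last step may keep [wn], so [sdone] enters the measure. In the potential, 8 [wn] is the sum
     of the geometric series with ratio 7/8. *)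
  apply wp_while with (f := fun s => iv s wn + (1 - iv s sdone))
    (I := fun s t => iv s wn <= N /\
      ((iv s sdone = 1 /\ t <= 80 * 64 * 8 * N /\ rk (seg (ra s0 WK) 0 N) q (rv s rres)) \/
       (iv s sdone = 0 /\ iv s wq < iv s wn /\ t + 80 * 64 * (8 * iv s wn) <= 80 * 64 * 8 * N /\
        forall v, rk (seg (ra s WK) 0 (iv s wn)) (iv s wq) v -> rk (seg (ra s0 WK) 0 N) q v))).
  - sc. fold N. split; [lia|]. right. split; auto. split; auto. split; [lia|]. auto.
  - intros s t HF _. oks.
  - intros s t HF (HN & [(Hd & _)|(Hd & Hqs & Ht & HI)]) Hl; sch Hl; [lia|].
    eapply wp_mono; [apply select_step_ok; auto; lia|].
    intros s' t' (Ht' & Hw & [(Hd' & Hr)|(Hd' & H8 & Hq' & Hr)]) _.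
    + split; [|lia]. split; [lia|]. left. split; auto. split; [lia|]. auto.
    + split; [|lia]. split; [lia|]. right. split; auto. split; auto. split; [lia|]. auto.
  - intros s t HF (HN & [(Hd & Ht & Hr)|(Hd & Hqs & Ht & HI)]) Hl; sch Hl; [|lia].
    split; [lia|auto].
Qed.

(** * Selection in a union of sorted blocks *)

(* Each block b is cut into units of g consecutive entries; the entries still under
   consideration are those in the units lo b .. hi b - 1. *)

Fixpoint wsum (lo hi : nat -> nat) (B : nat) : nat :=
  match B with O => 0 | S b => wsum lo hi b + (hi b - lo b) end.

Fixpoint active (E : nat -> nat -> R) (g : nat) (lo hi : nat -> nat) (B : nat) : list R :=
  match B with
  | O => []
  | S b => active E g lo hi b ++ seg (E b) (lo b * g) ((hi b - lo b) * g)
  end.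

Lemma wsum_ext lo hi lo' hi' B : (forall b, b < B -> lo b = lo' b /\ hi b = hi' b) ->
  wsum lo hi B = wsum lo' hi' B.
Proof.
  induction B as [|B IH]; intros H; simpl; auto. rewrite IH by (intros; apply H; lia).
  destruct (H B) as [-> ->]; auto.
Qed.

Lemma wsum_le lo hi lo' hi' B : (forall b, b < B -> hi b - lo b <= hi' b - lo' b) ->
  wsum lo hi B <= wsum lo' hi' B.
Proof.
  induction B as [|B IH]; intros H; simpl; auto.
  specialize (H B ltac:(lia)) as H1. assert (wsum lo hi B <= wsum lo' hi' B) by (apply IH; intros; apply H; lia).
  lia.
Qed.

Lemma wsum_mono lo hi B B' : B <= B' -> wsum lo hi B <= wsum lo hi B'.
Proof. induction 1; simpl; lia. Qed.

Lemma active_ext E g lo hi lo' hi' B : (forall b, b < B -> lo b = lo' b /\ hi b = hi' b) ->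
  active E g lo hi B = active E g lo' hi' B.
Proof.
  induction B as [|B IH]; intros H; simpl; auto. rewrite IH by (intros; apply H; lia).
  destruct (H B) as [-> ->]; auto.
Qed.

Lemma active_length E g lo hi B : length (active E g lo hi B) = wsum lo hi B * g.
Proof. induction B; simpl; auto. rewrite length_app, seg_length, IHB. lia. Qed.

Lemma active_split E g lo cut hi B p : (forall b, b < B -> lo b <= cut b <= hi b) ->
  cnt p (active E g lo hi B) = cnt p (active E g lo cut B) + cnt p (active E g cut hi B).
Proof.
  induction B as [|B IH]; intros H; simpl; auto. rewrite !cnt_app, IH by (intros; apply H; lia).
  specialize (H B ltac:(lia)).
  replace ((hi B - lo B) * g) with ((cut B - lo B) * g + (hi B - cut B) * g) by nia.
  rewrite seg_app, cnt_app. replace (lo B * g + (cut B - lo B) * g) with (cut B * g) by nia. lia.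
Qed.

Lemma in_active E g lo hi B x : In x (active E g lo hi B) ->
  exists b t, b < B /\ lo b * g <= t < hi b * g /\ E b t = x.
Proof.
  induction B as [|B IH]; simpl; [tauto|]. rewrite in_app_iff. intros [H|H].
  - destruct (IH H) as (b & t & H1 & H2 & H3). exists b, t. split; auto.
  - apply in_seg in H as (t & Ht & <-). exists B, t. split; [lia|split; auto].
    rewrite Nat.mul_sub_distr_r in Ht. lia.
Qed.

Lemma active_halve E g lo hi B :
  active E (2 * g) lo hi B = active E g (fun b => 2 * lo b) (fun b => 2 * hi b) B.
Proof.
  induction B as [|B IH]; cbn [active]; auto. rewrite IH. f_equal.
  replace (lo B * (2 * g)) with (2 * lo B * g) by ring.
  replace ((hi B - lo B) * (2 * g)) with ((2 * hi B - 2 * lo B) * g); [auto|].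
  rewrite <- Nat.mul_sub_distr_l. ring.
Qed.

(* The last entry of a unit stands for the unit: q units end at most at p, the others at least
   at p. *)
Record cut_spec (E : nat -> nat -> R) (g : nat) (lo hi cut : nat -> nat) (B q : nat) (p : R) : Prop := {
  cs_rng : forall b, b < B -> lo b <= cut b <= hi b;
  cs_low : forall b u, b < B -> lo b <= u < cut b -> E b ((u + 1) * g - 1) <=r p;
  cs_high : forall b, b < B -> cut b < hi b -> p <=r E b ((cut b + 1) * g - 1);
  cs_sum : wsum lo cut B = q }.

Definition blocks_ok (E : nat -> nat -> R) (d B : nat) : Prop :=
  forall b i j, b < B -> i <= j < d -> E b i <=r E b j.

Lemma unit_of t g : 1 <= g -> exists u, u * g <= t < (u + 1) * g.
Proof.
  intros Hg. exists (t / g). pose proof (Nat.div_mod_eq t g). pose proof (Nat.mod_upper_bound t g ltac:(lia)).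
  split; nia.
Qed.

(** * Discarding units below or above a cut *)

Section Prune.
Variables (E : nat -> nat -> R) (d B g : nat) (lo hi cut : nat -> nat) (q : nat) (p : R).
Hypothesis HE : blocks_ok E d B.
Hypothesis Hg : 1 <= g.
Hypothesis Hhi : forall b, b < B -> hi b * g <= d.
Hypothesis HC : cut_spec E g lo hi cut B q p.

Lemma low_le x : In x (active E g lo cut B) -> x <=r p.
Proof.
  intros H. apply in_active in H as (b & t & Hb & Ht & <-).
  destruct (unit_of t g Hg) as (u & Hu).
  assert (u < cut b) by nia. assert (lo b <= u) by nia.
  pose proof (cs_rng _ _ _ _ _ _ _ _ HC b Hb). specialize (Hhi b Hb).
  eapply Rle_trans; [|apply (cs_low _ _ _ _ _ _ _ _ HC b u); auto].
  apply HE; auto. nia.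
Qed.

Lemma low_cnt : cnt (leb p) (active E g lo cut B) = q * g.
Proof.
  rewrite cnt_all.
  - rewrite active_length, (cs_sum _ _ _ _ _ _ _ _ HC); auto.
  - intros x Hx. apply low_le in Hx. destruct (leb_spec p x); auto.
Qed.

(** The discarded q g entries are at most p, so nothing is lost if v >= p. If v < p, then in each
    block only the first remaining unit can contain entries up to v, because that unit already ends
    at p or above. That makes at most B g entries, too few for the rank r - q g >= B g. *)
Lemma prune_lo_rk r v : q * g + B * g <= r ->
  rk (active E g cut hi B) (r - q * g) v -> rk (active E g lo hi B) r v.
Proof.
  intros Hr [H1 H2]. unfold rk.
  rewrite !(active_split E g lo cut hi B) by apply (cs_rng _ _ _ _ _ _ _ _ HC).
  assert (L : length (active E g lo cut B) = q * g)
    by (rewrite active_length, (cs_sum _ _ _ _ _ _ _ _ HC); auto).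
  pose proof (cnt_le_length (ltb v) (active E g lo cut B)).
  split; [lia|].
  destruct (Rle_lt_dec p v) as [Hv|Hv].
  - rewrite cnt_all; [lia|]. intros x Hx. apply low_le in Hx. destruct (leb_spec v x); auto; lra.
  - exfalso. assert (cnt (leb v) (active E g cut hi B) <= B * g); [|lia].
    assert (Q : forall B', B' <= B -> cnt (leb v) (active E g cut hi B') <= B' * g); [|apply Q; auto].
    induction B' as [|b IH]; intros Hb; [simpl; unfold cnt; simpl; lia|].
    simpl. rewrite cnt_app. specialize (IH ltac:(lia)).
    assert (cnt (leb v) (seg (E b) (cut b * g) ((hi b - cut b) * g)) <= g); [|lia].
    destruct (Nat.eq_dec (hi b - cut b) 0) as [->|Hn]; [unfold cnt; simpl; lia|].
    replace ((hi b - cut b) * g) with (g + (hi b - cut b - 1) * g) by nia.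
    rewrite seg_app, cnt_app, (cnt_none _ (seg _ (_ + _) _)).
    + pose proof (cnt_seg_le (leb v) (E b) (cut b * g) g). lia.
    + intros x Hx. apply in_seg in Hx as (t & Ht & <-).
      destruct (leb_spec v (E b t)) as [Hl|]; auto. exfalso.
      pose proof (cs_high _ _ _ _ _ _ _ _ HC b ltac:(lia) ltac:(lia)) as Hp.
      specialize (Hhi b ltac:(lia)).
      assert (E b ((cut b + 1) * g - 1) <=r E b t); [|lra].
      apply HE; [lia|]. nia.
Qed.

(** The q low units contain more than r entries, all at most p, so v <= p. One unit per block is
    kept beyond the cut because it may straddle p; everything after it is at least p. *)
Lemma prune_hi_rk r v (hi' : nat -> nat) : r < q * g ->
  (forall b, b < B -> hi' b = Nat.min (hi b) (cut b + 1)) ->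
  rk (active E g lo hi' B) r v -> rk (active E g lo hi B) r v.
Proof.
  intros Hr Hh [H1 H2]. unfold rk.
  pose proof (cs_rng _ _ _ _ _ _ _ _ HC) as Hrng.
  assert (R1 : forall b, b < B -> lo b <= hi' b <= hi b).
  { intros b Hb. rewrite Hh by auto. specialize (Hrng b Hb). lia. }
  assert (R2 : forall b, b < B -> lo b <= cut b <= hi' b).
  { intros b Hb. rewrite Hh by auto. specialize (Hrng b Hb). lia. }
  rewrite !(active_split E g lo hi' hi B) by auto.
  split; [|lia].
  assert (Hv : v <=r p).
  { apply Rnot_lt_le. intros Hv.
    assert (q * g <= cnt (ltb v) (active E g lo hi' B)); [|lia].
    rewrite (active_split E g lo cut hi' B) by auto. rewrite <- low_cnt.
    assert (cnt (leb p) (active E g lo cut B) <= cnt (ltb v) (active E g lo cut B)); [|lia].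
    apply cnt_mono. intros x _ Hx. destruct (leb_spec p x), (ltb_spec v x); auto; try discriminate; lra. }
  rewrite (cnt_none (ltb v) (active E g hi' hi B)); [lia|].
  intros x Hx. apply in_active in Hx as (b & t & Hb & Ht & <-).
  destruct (ltb_spec v (E b t)) as [Hl|]; auto. exfalso.
  specialize (Hh b Hb). specialize (Hhi b Hb).
  assert (cut b < hi b) by nia.
  pose proof (cs_high _ _ _ _ _ _ _ _ HC b Hb H) as Hp.
  assert (E b ((cut b + 1) * g - 1) <=r E b t); [|lra].
  apply HE; auto. replace (hi' b) with (cut b + 1) in Ht by lia. lia.
Qed.

Lemma prune_hi_wsum (hi' : nat -> nat) :
  (forall b, b < B -> hi' b = Nat.min (hi b) (cut b + 1)) ->
  q <= wsum lo hi' B <= q + B.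
Proof.
  intros Hh. rewrite <- (cs_sum _ _ _ _ _ _ _ _ HC). pose proof (cs_rng _ _ _ _ _ _ _ _ HC) as Hrng.
  revert Hh Hrng. clear. induction B as [|b IH]; intros Hh Hrng; simpl; [lia|].
  specialize (Hh b ltac:(lia)) as Hh1. specialize (Hrng b ltac:(lia)) as Hr1.
  assert (wsum lo cut b <= wsum lo hi' b <= wsum lo cut b + b); [|lia].
  apply IH; intros; [apply Hh|apply Hrng]; lia.
Qed.

Lemma prune_lo_wsum : wsum cut hi B + q = wsum lo hi B.
Proof.
  rewrite <- (cs_sum _ _ _ _ _ _ _ _ HC). pose proof (cs_rng _ _ _ _ _ _ _ _ HC) as Hrng.
  revert Hrng. clear. induction B as [|b IH]; intros Hrng; simpl; [lia|].
  specialize (Hrng b ltac:(lia)) as Hr1. specialize (IH (fun b Hb => Hrng b (Nat.lt_trans _ _ _ Hb (Nat.lt_succ_diag_r _)))).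
  lia.
Qed.

End Prune.

Notation vd := 22 (only parsing).
Notation vk := 27 (only parsing).
Notation bk := 28 (only parsing).
Notation fb := 29 (only parsing).
Notation fu := 30 (only parsing).
Notation vU := 31 (only parsing).
Notation vg := 32 (only parsing).
Notation rr := 33 (only parsing).
Notation vq := 34 (only parsing).
Notation bud := 35 (only parsing).
Notation fi := 36 (only parsing).

Definition pidx (t : iexp) : iexp := Ar PERM (Ar PT (Vr fb) + t).
(** In the last block the index into x may exceed k, by less than d. The shift by [vd] keeps the
    index into [YA] positive, and it then falls into the padding. *)
Definition elem (t : iexp) : rexp :=
  (RAr XA (Vr fb * Vr vd + pidx t) - RAr YA ((Vr vk + Vr vd) - (Vr fb * Vr vd + pidx t)))%re.

Arguments elem _%_ie.

(* The permutation table presents E b as the values of block b of x against the window of y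
   ending at k - b d, in sorted order. *)
Record elem_ok (M : nat) (perm pt : nat -> nat) (x y : nat -> R) (k d B : nat) (E : nat -> nat -> R) : Prop := {
  eo_idx : forall b t, b < B -> t < d -> pt b + t < M /\ perm (pt b + t) < d /\ b * d <= k;
  eo_val : forall b t, b < B -> t < d ->
    E b t = (x (b * d + perm (pt b + t)%nat)%nat - y (k + d - (b * d + perm (pt b + t)%nat))%nat)%R;
  eo_M : k + d + d + B < M }.

Lemma elem_eval m s B E e t :
  elem_ok (lM m) (ia s PERM) (ia s PT) (ra s XA) (ra s YA) (iv s vk) (iv s vd) B E ->
  iok m s e -> ieval s e = t -> t < iv s vd -> iv s fb < B ->
  rok m s (elem e) /\ reval s (elem e) = E (iv s fb) t.
Proof.
  intros [H1 H2 H3] Hk He Ht Hb. destruct (H1 (iv s fb) t Hb Ht) as (A1 & A2 & A3).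
  unfold elem, pidx. sc. rewrite He. rewrite H2 by auto. repeat split; auto; try lia.
Qed.

Definition fill : cmd := (
  vU <-i Cn 0 ;;
  For fb (Vr bk) (
    fu <-i Ar LO (Vr fb) ;;
    Loop fu (Ar HI (Vr fb)) (
      RSto VA (Vr vU) (elem ((Vr fu + Cn 1) * Vr vg - Cn 1)) ;;
      vU <-i Vr vU + Cn 1)))%cmd.

Section Fill.
Variables (m : lim) (B d g : nat) (E : nat -> nat -> R) (lo hi : nat -> nat).
Hypothesis Hg : 1 <= g.
Hypothesis Hlh : forall b, b < B -> lo b <= hi b.
Hypothesis Hhi : forall b, b < B -> hi b * g <= d.
Hypothesis HB : B + wsum lo hi B + d + 2 < lM m.

Lemma hi_le b : b < B -> hi b <= d.
Proof. intros H. specialize (Hhi b H). nia. Qed.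

Lemma fill_ok s0 :
  iv s0 bk = B -> iv s0 vd = d -> iv s0 vg = g ->
  (forall b, b < B -> ia s0 LO b = lo b) -> (forall b, b < B -> ia s0 HI b = hi b) ->
  elem_ok (lM m) (ia s0 PERM) (ia s0 PT) (ra s0 XA) (ra s0 YA) (iv s0 vk) d B E ->
  wp m fill s0 (fun s t => t <= 4 * wsum lo hi B + 5 * B + 4 /\ iv s vU = wsum lo hi B /\
    forall b u, b < B -> lo b <= u < hi b ->
      ra s VA (wsum lo hi b + (u - lo b)) = E b ((u + 1) * g - 1)).
Proof.
  intros EB Ed Eg Hlo Hhi' HE. unfold fill. ws.
  apply wp_for with (hi := B) (I := fun b s t => t <= 4 * wsum lo hi b + 5 * b /\ iv s vU = wsum lo hi b /\
    forall b' u, b' < b -> lo b' <= u < hi b' ->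
      ra s VA (wsum lo hi b' + (u - lo b')) = E b' ((u + 1) * g - 1)).
  - reflexivity.
  - lia.
  - sc. split; [lia|split; [reflexivity|intros; lia]].
  - intros s HF. oks.
  - intros b s t Hb HF (Ht & HU & HV) Efb.
    assert (A1 : ia s LO = ia s0 LO) by (fr; auto). assert (A2 : ia s HI = ia s0 HI) by (fr; auto).
    assert (A3 : iv s vg = g) by (fr; auto). assert (A4 : iv s vd = d) by (fr; auto).
    assert (A5 : ia s PERM = ia s0 PERM) by (fr; auto). assert (A6 : ia s PT = ia s0 PT) by (fr; auto).
    assert (A7 : ra s XA = ra s0 XA) by (fr; auto). assert (A8 : ra s YA = ra s0 YA) by (fr; auto).
    assert (A9 : iv s vk = iv s0 vk) by (fr; auto).
    pose proof (hi_le b Hb). pose proof (Hlh b Hb). pose proof (Hhi b Hb).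
    pose proof (wsum_mono lo hi (S b) B Hb) as Hw. simpl in Hw.
    ws.
    apply wp_loop with (lo := lo b) (hi := hi b)
      (I := fun u s t => t <= 4 * (u - lo b) /\ iv s vU = wsum lo hi b + (u - lo b) /\
       forall b' u', b' < S b -> lo b' <= u' < hi b' -> (b' = b -> u' < u) ->
        ra s VA (wsum lo hi b' + (u' - lo b')) = E b' ((u' + 1) * g - 1)).
    + reflexivity.
    + lia.
    + auto.
    + sc. rewrite A1, Efb. apply Hlo; auto.
    + sc. split; [lia|]. split; [lia|]. intros b' u' Hb' Hu' Hn. apply HV; auto.
      destruct (Nat.eq_dec b' b); [|lia]. specialize (Hn e). subst. lia.
    + intros s1 HF1. sc. fr. rewrite Efb, Hhi' by auto. split; auto. lia.
    + intros u s1 t1 Hu HF1 (Ht1 & HU1 & HV1) Eu.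
      assert (C1 : iv s1 vg = g) by (fr; auto). assert (C2 : iv s1 fb = b) by (fr; auto).
      assert ((u + 1) * g <= d) by nia. assert (1 <= (u + 1) * g) by nia.
      destruct (elem_eval m s1 B E ((Vr fu + Cn 1) * Vr vg - Cn 1)%ie ((u + 1) * g - 1)) as [K1 K2].
      { replace (iv s1 vk) with (iv s0 vk) by (fr; auto). replace (iv s1 vd) with d by (fr; auto).
        replace (ia s1 PERM) with (ia s0 PERM) by (fr; auto). replace (ia s1 PT) with (ia s0 PT) by (fr; auto).
        replace (ra s1 XA) with (ra s0 XA) by (fr; auto). replace (ra s1 YA) with (ra s0 YA) by (fr; auto). auto. }
      { sc. rewrite Eu, C1. repeat split; lia. }
      { sc. rewrite Eu, C1. auto. }
      { replace (iv s1 vd) with d by (fr; auto). lia. }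
      { lia. }
      apply wp_seq. apply wp_rsto.
      { split; [exact Logic.I|]. split; [exact K1|]. sc. lia. }
      rewrite K2. ws. split; [lia|]. split; [lia|].
      intros b' u' Hb' Hu' Hn. unfold upd. rewrite HU1, C2.
      destruct (Nat.eq_dec b' b) as [->|Hne].
      * specialize (Hn eq_refl). eqbs.
        -- replace u' with u by lia. auto.
        -- apply HV1; auto. intros; lia.
      * pose proof (wsum_mono lo hi (S b') b ltac:(lia)) as Hw'. simpl in Hw'.
        eqbs. apply HV1; auto. intros; lia.
    + intros s1 t1 HF1 (Ht1 & HU1 & HV1) _. sc. simpl. split; [lia|]. split; [lia|].
      intros b' u' Hb' Hu'. apply HV1; auto. intros ->; lia.
  - intros s t HF (Ht & HU & HV) _. split; [lia|]. auto.
Qed.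

End Fill.

(* Entries equal to the pivot are counted below the cut only while the allowance bud lasts, so
   that exactly vq units fall below it. *)
Definition cut_unit : cmd := (
  If (CRlt (RAr VA (Vr fi)) (RVr rres))
    (ISto CUT (Vr fb) (Ar CUT (Vr fb) + Cn 1))
    (If (CRlt (RVr rres) (RAr VA (Vr fi))) Skip
      (If (CLt (Cn 0) (Vr bud))
        (ISto CUT (Vr fb) (Ar CUT (Vr fb) + Cn 1) ;; bud <-i Vr bud - Cn 1)
        Skip)) ;;
  fi <-i Vr fi + Cn 1)%cmd.

Definition cut_scan : cmd := (
  fi <-i Cn 0 ;;
  For fb (Vr bk) (
    fu <-i Ar LO (Vr fb) ;;
    ISto CUT (Vr fb) (Vr fu) ;;
    Loop fu (Ar HI (Vr fb)) cut_unit))%cmd.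

Definition cut_bud : cmd := (
  bud <-i Vr vq ;;
  For wi (Vr vU) (If (CRlt (RAr VA (Vr wi)) (RVr rres)) (bud <-i Vr bud - Cn 1) Skip))%cmd.

Definition cut : cmd := (
  For wi (Vr vU) (RSto WK (Vr wi) (RAr VA (Vr wi))) ;;
  wn <-i Vr vU ;; wq <-i Vr vq - Cn 1 ;; select ;;
  cut_bud ;; cut_scan)%cmd.

Lemma cut_bud_ok m s0 : iv s0 vU + 2 < lM m ->
  cnt (ltb (rv s0 rres)) (seg (ra s0 VA) 0 (iv s0 vU)) <= iv s0 vq ->
  wp m cut_bud s0 (fun s t => t <= 4 * iv s0 vU + 3 /\
    iv s bud + cnt (ltb (rv s0 rres)) (seg (ra s0 VA) 0 (iv s0 vU)) = iv s0 vq).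
Proof.
  set (p := rv s0 rres). set (U := iv s0 vU) in *. intros HM Hq. unfold cut_bud. ws.
  apply wp_forc with (hi := U) (T := 2) (I := fun i s =>
    iv s bud + cnt (ltb p) (seg (ra s0 VA) 0 i) = iv s0 vq).
  - reflexivity.
  - lia.
  - sc. change (seg (ra s0 VA) 0 0) with (@nil R). change (cnt (ltb p) []) with 0. lia.
  - intros s HF. oks.
  - intros i s Hi HF HI Ei.
    assert (E1 : ra s VA = ra s0 VA) by (fr; auto). assert (E2 : rv s rres = p) by (fr; auto).
    rewrite cnt_seg_S. simpl (0 + i).
    assert (Hc : cnt (ltb p) (seg (ra s0 VA) 0 (S i)) <= iv s0 vq).
    { etransitivity; [|exact Hq]. replace U with (S i + (U - S i)) by lia. rewrite seg_app, cnt_app. lia. }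
    rewrite cnt_seg_S in Hc. simpl (0 + i) in Hc.
    apply wp_ifr; [oks| |]; sc; rewrite E1, E2, Ei; intros H.
    + destruct (ltb_spec p (ra s0 VA i)); [|lra]. ws. lia.
    + destruct (ltb_spec p (ra s0 VA i)); [lra|]. ws. lia.
  - intros s t HF HI _ Ht. split; [lia|auto].
Qed.

Section Cut.
Variables (m : lim) (B d g : nat) (E : nat -> nat -> R) (lo hi : nat -> nat).
Hypothesis HE : blocks_ok E d B.
Hypothesis Hg : 1 <= g.
Hypothesis Hlh : forall b, b < B -> lo b <= hi b.
Hypothesis Hhi : forall b, b < B -> hi b * g <= d.
Notation N := (wsum lo hi B).
Hypothesis HB : B + N + d + 2 < lM m.

Lemma cut_scan_ok s0 q : let p := rv s0 rres in
  iv s0 bk = B ->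
  (forall b, b < B -> ia s0 LO b = lo b) -> (forall b, b < B -> ia s0 HI b = hi b) ->
  (forall b u, b < B -> lo b <= u < hi b ->
      ra s0 VA (wsum lo hi b + (u - lo b)) = E b ((u + 1) * g - 1)) ->
  iv s0 bud + cnt (ltb p) (seg (ra s0 VA) 0 N) = q ->
  cnt (ltb p) (seg (ra s0 VA) 0 N) < q <= cnt (leb p) (seg (ra s0 VA) 0 N) ->
  wp m cut_scan s0 (fun s t => t <= 8 * N + 5 * B + 4 /\
    cut_spec E g lo hi (ia s CUT) B q p).
Proof.
  intros p EB Elo Ehi HV Hbud Hq. unfold cut_scan. ws.
  set (V := ra s0 VA) in *.
  (* While some allowance is left, every representative up to p has been put below the cut. An
     allowance left over at the end would thus mean that at least q units were put there, although
     their number plus the allowance is q; so it is used up. *)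
  apply wp_for with (hi := B) (I := fun b s t => t <= 8 * wsum lo hi b + 5 * b /\ iv s fi = wsum lo hi b /\
    (wsum lo (ia s CUT) b + iv s bud = iv s0 bud + cnt (ltb p) (seg V 0 (wsum lo hi b))) /\
    (0 < iv s bud -> wsum lo (ia s CUT) b = cnt (leb p) (seg V 0 (wsum lo hi b))) /\
    (forall b', b' < b -> lo b' <= ia s CUT b' <= hi b') /\
    (forall b' u, b' < b -> lo b' <= u < ia s CUT b' -> E b' ((u + 1) * g - 1) <=r p) /\
    (forall b', b' < b -> ia s CUT b' < hi b' -> p <=r E b' ((ia s CUT b' + 1) * g - 1))).
  - reflexivity.
  - lia.
  - sc. change (seg V 0 (wsum lo hi 0)) with (@nil R). unfold cnt; simpl. repeat split; intros; lia.
  - intros s HF. oks.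
  - intros b s t Hb HF (Ht & Hfi & Hw & Hw' & C1 & C2 & C3) Eb.
    assert (A1 : ia s LO = ia s0 LO) by (fr; auto). assert (A2 : ia s HI = ia s0 HI) by (fr; auto).
    assert (A3 : ra s VA = V) by (fr; auto). assert (A4 : rv s rres = p) by (fr; auto).
    pose proof (Hlh b Hb) as Hl. pose proof (Hhi b Hb).
    assert (hi b <= d) by nia.
    pose proof (wsum_mono lo hi (S b) B Hb) as Hws. cbn [wsum] in Hws.
    ws.
    (* The last clause makes the chosen units of a block an initial segment: once a unit is passed
       over, either its representative exceeds p, and so do the later ones, or the allowance is
       spent and no later representative is below p. *)
    apply wp_loop with (lo := lo b) (hi := hi b) (I := fun u s1 t1 => t1 <= 8 * (u - lo b) /\
      iv s1 fi = wsum lo hi b + (u - lo b) /\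
      (forall b', b' < b -> ia s1 CUT b' = ia s CUT b') /\
      lo b <= ia s1 CUT b <= u /\
      (wsum lo (ia s CUT) b + (ia s1 CUT b - lo b) + iv s1 bud
         = iv s0 bud + cnt (ltb p) (seg V 0 (wsum lo hi b + (u - lo b)))) /\
      (0 < iv s1 bud -> wsum lo (ia s CUT) b + (ia s1 CUT b - lo b)
         = cnt (leb p) (seg V 0 (wsum lo hi b + (u - lo b)))) /\
      (forall u', lo b <= u' < ia s1 CUT b -> E b ((u' + 1) * g - 1) <=r p) /\
      (ia s1 CUT b < u -> p <=r E b ((ia s1 CUT b + 1) * g - 1) /\
         (p <r E b ((u - 1 + 1) * g - 1) \/ iv s1 bud = 0 /\ p <=r E b ((u - 1 + 1) * g - 1)))).
    + reflexivity.
    + lia.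
    + auto.
    + sc. rewrite A1, Eb. apply Elo; auto.
    + sc. rewrite A1, Eb, Elo by auto. rewrite upd_same, Nat.sub_diag, !Nat.add_0_r.
      split; [lia|]. split; [auto|]. split; [intros; rewrite upd_other by lia; auto|].
      split; [lia|]. split; [auto|]. split; [auto|]. split; [intros; lia|intros; lia].
    + intros s1 HF1. sc. fr. rewrite Eb, Ehi by auto. split; auto. lia.
    + intros u s1 t1 Hu HF1 (Ht1 & Hfi1 & P1 & P2 & P3 & P4 & P5 & P6) Eu.
      assert (D1 : ra s1 VA = V) by (fr; auto). assert (D2 : rv s1 rres = p) by (fr; auto).
      assert (D3 : iv s1 fb = b) by (fr; auto).
      set (f := wsum lo hi b + (u - lo b)) in *.
      assert (Ef : wsum lo hi b + (S u - lo b) = S f) by (unfold f; lia).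
      assert (Ex : V f = E b ((u + 1) * g - 1)) by (apply HV; auto; lia).
      set (x := E b ((u + 1) * g - 1)) in *.
      assert (Hprev : lo b < u -> E b ((u - 1 + 1) * g - 1) <=r x).
      { intros Hlt. apply HE; auto.
        assert ((u + 1) * g <= hi b * g) by (apply Nat.mul_le_mono_r; lia).
        assert (0 < (u + 1) * g) by (apply Nat.mul_pos_pos; lia).
        split; [|clear - H1 H2 H; lia]. apply Nat.sub_le_mono_r, Nat.mul_le_mono_r. lia. }
      assert (Hs : 1 <= u -> S u - 1 + 1 = u + 1) by lia.
      replace (S u - 1 + 1) with (u + 1) by lia.
      assert (Hf : f < N) by (unfold f; lia).
      unfold cut_unit. rewrite Ef, !cnt_seg_S. simpl (0 + f). rewrite Ex.
      apply wp_seq. apply wp_ifr; [oks| |]; sc; rewrite D1, D2, Hfi1, Ex; intros Hx.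
      * assert (Hc : ia s1 CUT b = u).
        { destruct (Nat.eq_dec (ia s1 CUT b) u); auto. exfalso. destruct P6 as [_ [P6|[_ P6]]]; [lia| |];
          specialize (Hprev ltac:(lia)); lra. }
        ws; try (rewrite ?Eb, ?Hc; lia). rewrite D3, Hc. destruct (ltb_spec p x), (leb_spec p x); try lra.
        rewrite upd_same. rewrite Hc in *.
        split; [lia|]. split; [lia|]. split; [intros; rewrite upd_other by lia; auto|].
        split; [lia|]. split; [lia|]. split; [lia|]. split; [|intros; lia].
        intros u' Hu'. destruct (Nat.eq_dec u' u) as [->|]; [fold x; lra|apply P5; lia].
      * apply wp_ifr; [oks| |]; sc; rewrite D1, D2, Hfi1, Ex; intros Hx2.
        -- ws. destruct (ltb_spec p x), (leb_spec p x); try lra.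
           split; [lia|]. split; [lia|]. split; [auto|]. split; [lia|]. split; [lia|]. split; [lia|].
           split; auto. intros Hcu. split; [|left; auto].
           destruct (Nat.eq_dec (ia s1 CUT b) u) as [->|]; [auto|]. apply P6. lia.
        -- apply wp_ifi; [oks| |]; sc; intros Hb0.
           ++ assert (Hc : ia s1 CUT b = u).
              { destruct (Nat.eq_dec (ia s1 CUT b) u); auto. exfalso. destruct P6 as [_ [P6|[P6 _]]]; [lia| |lia].
                specialize (Hprev ltac:(lia)); lra. }
              ws; try (rewrite ?Eb, ?Hc; lia). rewrite D3, Hc. destruct (ltb_spec p x), (leb_spec p x); try lra.
              rewrite upd_same. rewrite Hc in *.
              split; [lia|]. split; [lia|]. split; [intros; rewrite upd_other by lia; auto|].
              split; [lia|]. split; [lia|]. split; [lia|]. split; [|intros; lia].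
              intros u' Hu'. destruct (Nat.eq_dec u' u) as [->|]; [fold x; lra|apply P5; lia].
           ++ ws. destruct (ltb_spec p x), (leb_spec p x); try lra.
              split; [lia|]. split; [lia|]. split; [auto|]. split; [lia|]. split; [lia|]. split; [lia|].
              split; auto. intros Hcu. split; [|right; split; [lia|exact Hx]].
              destruct (Nat.eq_dec (ia s1 CUT b) u) as [->|]; [auto|]. apply P6. lia.
    + intros s1 t1 HF1 (Ht1 & Hfi1 & P1 & P2 & P3 & P4 & P5 & P6) _. sc. cbn [wsum].
      assert (Ew : wsum lo (ia s1 CUT) b = wsum lo (ia s CUT) b) by (apply wsum_ext; intros; split; auto).
      rewrite Ew.
      split; [lia|]. split; [lia|]. split; [lia|]. split; [auto|].
      split; [|split].
      * intros b' Hb'. destruct (Nat.eq_dec b' b) as [->|]; [lia|]. rewrite P1 by lia. apply C1; lia.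
      * intros b' u' Hb'. destruct (Nat.eq_dec b' b) as [->|]; [apply P5|]. rewrite P1 by lia. apply C2; lia.
      * intros b' Hb'. destruct (Nat.eq_dec b' b) as [->|]; [intros; apply P6; auto|]. rewrite P1 by lia. apply C3; lia.
  - intros s t HF (Ht & Hfi & Hw & Hw' & C1 & C2 & C3) _. split; [lia|].
    constructor; auto.
    destruct (Nat.eq_dec (iv s bud) 0) as [E0|E0]; [lia|].
    specialize (Hw' ltac:(lia)). lia.
Qed.

Lemma cut_ok s0 q :
  iv s0 bk = B -> iv s0 vU = N -> iv s0 vq = q -> 1 <= q <= N -> 4 * N + 400 < lM m ->
  (forall b, b < B -> ia s0 LO b = lo b) -> (forall b, b < B -> ia s0 HI b = hi b) ->
  (forall b u, b < B -> lo b <= u < hi b ->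
      ra s0 VA (wsum lo hi b + (u - lo b)) = E b ((u + 1) * g - 1)) ->
  wp m cut s0 (fun s t => t <= 640 * 66 * N + 5 * B /\
    exists p, cut_spec E g lo hi (ia s CUT) B q p).
Proof.
  intros EB EU Eq Hq HM Elo Ehi HV. unfold cut. apply wp_seq.
  apply wp_forc with (hi := N) (T := 1) (I := fun i s => forall x, x < i -> ra s WK x = ra s0 VA x).
  { reflexivity. } { lia. } { intros; lia. } { intros s HF; oks. }
  { intros i s Hi HF HI Ei. ws. split; [lia|]. intros x Hx. unfold upd. fr. rewrite Ei. eqbs.
    - subst; auto.
    - apply HI; lia. }
  intros s1 t1 HF1 HW _ Ht1.
  assert (A1 : iv s1 vU = N) by (fr; auto). assert (A2 : iv s1 vq = q) by (fr; auto).
  (* Ranks count from 0: the pivot of rank q - 1 has fewer than q representatives below it and at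
     least q that do not exceed it, as [cut_scan_ok] demands. *)
  ws. eapply wp_mono; [apply select_ok; sc; lia|]. sc. rewrite A1, A2.
  intros s2 t2 (Ht2 & Hr) F2.
  rewrite (seg_ext (ra s1 WK) (ra s0 VA)) in Hr by (intros; apply HW; lia).
  assert (A3 : iv s2 vU = N) by (fr; auto). assert (A4 : iv s2 vq = q) by (fr; auto).
  assert (A5 : ra s2 VA = ra s0 VA) by (fr; auto).
  set (p := rv s2 rres) in *. destruct Hr as [Hr1 Hr2].
  ws. eapply wp_mono; [apply cut_bud_ok; rewrite ?A3, ?A4, ?A5; try fold p; lia|].
  rewrite A3, A4, A5. fold p. intros s3 t3 (Ht3 & Hb3) F3.
  assert (A6 : rv s3 rres = p) by (fr; auto). assert (A7 : ra s3 VA = ra s0 VA) by (fr; auto).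
  eapply wp_mono; [apply (cut_scan_ok s3 q); rewrite ?A6, ?A7; auto; try (fr; auto; fail); try lia|].
  intros s4 t4 (Ht4 & Hc) _. split; [lia|]. exists p. rewrite <- A6. auto.
Qed.

End Cut.

(** r/g + 1 is the least q with q g > r, as [prune_hi_rk] requires. *)
Definition prune_hi : cmd := (
  vq <-i Vr rr / Vr vg + Cn 1 ;;
  If (CLt (Vr vq) (Vr vU))
    (cut ;;
     For fb (Vr bk)
       (If (CLt (Ar CUT (Vr fb) + Cn 1) (Ar HI (Vr fb)))
          (ISto HI (Vr fb) (Ar CUT (Vr fb) + Cn 1)) Skip))
    Skip)%cmd.

(** r/g - B is the largest q with q g + B g <= r, as [prune_lo_rk] requires. *)
Definition prune_lo : cmd := (
  vq <-i Vr rr / Vr vg ;;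
  If (CLt (Vr bk) (Vr vq))
    (vq <-i Vr vq - Vr bk ;; cut ;;
     For fb (Vr bk) (ISto LO (Vr fb) (Ar CUT (Vr fb))) ;;
     rr <-i Vr rr - Vr vq * Vr vg)
    Skip)%cmd.

(** Halving the units turns at most 2B + 1 of them into at most 6B. [prune_hi] leaves at most r/g +
    1 + B, and [prune_lo] takes r/g - B of these away, so 2B + 1 remain. Each of the lg d rounds
    therefore costs O(B). *)
Definition round : cmd := (
  vg <-i Vr vg / Cn 2 ;;
  For fb (Vr bk) (ISto LO (Vr fb) (Cn 2 * Ar LO (Vr fb)) ;; ISto HI (Vr fb) (Cn 2 * Ar HI (Vr fb))) ;;
  fill ;; prune_hi ;; fill ;; prune_lo)%cmd.

Definition fj : cmd := (
  vg <-i Vr vd ;;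
  For fb (Vr bk) (ISto LO (Vr fb) (Cn 0) ;; ISto HI (Vr fb) (Cn 1)) ;;
  While (CLt (Cn 1) (Vr vg)) round ;;
  fill ;;
  For wi (Vr vU) (RSto WK (Vr wi) (RAr VA (Vr wi))) ;;
  wn <-i Vr vU ;; wq <-i Vr rr ;; select)%cmd.

Definition filled (E : nat -> nat -> R) (g B : nat) (s : st) : Prop :=
  iv s vU = wsum (ia s LO) (ia s HI) B /\
  forall b u, b < B -> ia s LO b <= u < ia s HI b ->
    ra s VA (wsum (ia s LO) (ia s HI) b + (u - ia s LO b)) = E b ((u + 1) * g - 1).

Section FJ.
Variables (m : lim) (B d : nat) (E : nat -> nat -> R) (r0 : nat).
Hypothesis HE : blocks_ok E d B.
Hypothesis HB : 1 <= B.
Hypothesis HM : 30 * B + B * d + 3 * d + 500 < lM m.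
Notation all := (active E d (fun _ => 0) (fun _ => 1) B).
Notation ws_ s := (wsum (ia s LO) (ia s HI) B).

Record fj_inv (g : nat) (s : st) : Prop := {
  fi_bk : iv s bk = B; fi_d : iv s vd = d; fi_g : iv s vg = g; fi_g1 : 1 <= g;
  fi_lh : forall b, b < B -> ia s LO b <= ia s HI b;
  fi_hi : forall b, b < B -> ia s HI b * g <= d;
  fi_E : elem_ok (lM m) (ia s PERM) (ia s PT) (ra s XA) (ra s YA) (iv s vk) d B E;
  fi_r : iv s rr < ws_ s * g;
  fi_rk : forall v, rk (active E g (ia s LO) (ia s HI) B) (iv s rr) v -> rk all r0 v }.

Lemma fill_ok' g s0 : fj_inv g s0 -> ws_ s0 <= 6 * B ->
  wp m fill s0 (fun s t => t <= 33 * B /\ fj_inv g s /\ filled E g B s /\ ws_ s = ws_ s0 /\ iv s rr = iv s0 rr).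
Proof.
  intros [] Hw. eapply wp_mono; [apply (fill_ok m B d g E (ia s0 LO) (ia s0 HI)); auto; lia|].
  intros s t (Ht & HU & HV) F.
  assert (A1 : ia s LO = ia s0 LO) by (fr; auto). assert (A2 : ia s HI = ia s0 HI) by (fr; auto).
  split; [lia|]. split; [|split; [|split]].
  - constructor; fr; auto.
  - unfold filled. rewrite A1, A2. split; auto.
  - rewrite A1, A2; auto.
  - fr; auto.
Qed.

Lemma prune_hi_ok g s0 : fj_inv g s0 -> filled E g B s0 -> ws_ s0 <= 6 * B ->
  wp m prune_hi s0 (fun s t => t <= 640 * 66 * (6 * B) + 30 * B /\ fj_inv g s /\
    ws_ s <= ws_ s0 /\ ws_ s <= iv s rr / g + 1 + B).
Proof.
  intros [] [HU HV] Hw. unfold prune_hi.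
  assert (Hdiv : iv s0 rr / g < ws_ s0).
  { apply Nat.Div0.div_lt_upper_bound. lia. }
  pose proof (Nat.div_mod_eq (iv s0 rr) g) as D1. pose proof (Nat.mod_upper_bound (iv s0 rr) g ltac:(lia)) as D2.
  ws. { rewrite fi_g0; lia. }
  set (q := iv s0 rr / iv s0 vg + 1) in *. assert (Eq : q = iv s0 rr / g + 1) by (unfold q; rewrite fi_g0; auto).
  wif H.
  - eapply wp_mono; [apply (cut_ok m B d g E (ia s0 LO) (ia s0 HI) HE) with (q := q); sc; auto; lia|].
    intros s1 t1 (Ht1 & p & HC) F1.
    assert (A1 : ia s1 LO = ia s0 LO) by (fr; auto). assert (A2 : ia s1 HI = ia s0 HI) by (fr; auto).
    assert (A3 : iv s1 bk = B) by (fr; auto).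
    pose proof (cs_rng _ _ _ _ _ _ _ _ HC) as Hrng.
    apply wp_forc with (hi := B) (T := 2) (I := fun b s => forall b', b' < B -> ia s HI b' =
       if b' <? b then Nat.min (ia s0 HI b') (ia s1 CUT b' + 1) else ia s0 HI b').
    + reflexivity.
    + lia.
    + intros b' Hb'. sc. rewrite A2; auto.
    + intros s HF. oks.
    + intros b s Hb HF HI' Eb.
      assert (E1 : ia s CUT = ia s1 CUT) by (fr; auto).
      pose proof (HI' b Hb) as Hh. rewrite Nat.ltb_irrefl in Hh.
      pose proof (Hrng b Hb). pose proof (fi_hi0 b Hb). assert (ia s0 HI b <= d) by nia.
      wif H3; rewrite ?Eb, ?E1, ?Hh in *; try lia.
      * split; [lia|]. intros b' Hb'. unfold upd. rewrite HI' by auto.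
        destruct (Nat.ltb_spec b' (S b)), (Nat.ltb_spec b' b), (Nat.eqb_spec b' b); subst; lia.
      * split; [lia|]. intros b' Hb'. rewrite HI' by auto.
        destruct (Nat.ltb_spec b' (S b)), (Nat.ltb_spec b' b); auto; try lia.
        assert (b' = b) by lia; subst. lia.
    + intros s t HF HI' _ Ht.
      assert (Hmin : forall b, b < B -> ia s HI b = Nat.min (ia s0 HI b) (ia s1 CUT b + 1)).
      { intros b Hb. rewrite HI' by auto. destruct (Nat.ltb_spec b B); lia. }
      assert (A4 : ia s LO = ia s0 LO) by (fr; auto). assert (A5 : iv s rr = iv s0 rr) by (fr; auto).
      pose proof (prune_hi_wsum E B g _ _ _ q p HC _ Hmin) as Hsum.
      assert (Hrq : iv s0 rr < q * g) by nia.
      split; [lia|]. split; [|split].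
      * constructor; try (fr; auto; fail).
        -- intros b Hb. rewrite A4, Hmin by auto. pose proof (Hrng b Hb). lia.
        -- intros b Hb. rewrite Hmin by auto. etransitivity; [|apply (fi_hi0 b Hb)].
           apply Nat.mul_le_mono_r. lia.
        -- rewrite A4, A5. eapply Nat.lt_le_trans; [exact Hrq|]. apply Nat.mul_le_mono_r. lia.
        -- intros v. rewrite A4, A5. intros Hv. apply fi_rk0.
           eapply (prune_hi_rk E d B g); eauto.
      * rewrite A4. apply wsum_le. intros b Hb. rewrite Hmin by auto. lia.
      * rewrite A4, A5, <- Eq. lia.
  - split; [lia|]. split; [constructor; auto|]. split; [auto|]. lia.
Qed.

Lemma prune_lo_ok g s0 : fj_inv g s0 -> filled E g B s0 -> ws_ s0 <= 6 * B ->
  ws_ s0 <= iv s0 rr / g + 1 + B ->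
  wp m prune_lo s0 (fun s t => t <= 640 * 66 * (6 * B) + 30 * B /\ fj_inv g s /\ ws_ s <= 2 * B + 1).
Proof.
  intros [] [HU HV] Hw Hw2. unfold prune_lo.
  assert (Hdiv : iv s0 rr / g < ws_ s0).
  { apply Nat.Div0.div_lt_upper_bound. lia. }
  pose proof (Nat.div_mod_eq (iv s0 rr) g) as D1. pose proof (Nat.mod_upper_bound (iv s0 rr) g ltac:(lia)) as D2.
  ws. rewrite fi_g0. set (R := iv s0 rr / g) in *.
  wif H.
  - rewrite fi_bk0 in *. set (q := R - B) in *.
    eapply wp_mono; [apply (cut_ok m B d g E (ia s0 LO) (ia s0 HI) HE) with (q := q); sc; auto; lia|].
    intros s1 t1 (Ht1 & p & HC) F1. ws.
    assert (A1 : ia s1 LO = ia s0 LO) by (fr; auto). assert (A2 : ia s1 HI = ia s0 HI) by (fr; auto).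
    assert (A3 : iv s1 bk = B) by (fr; auto).
    pose proof (cs_rng _ _ _ _ _ _ _ _ HC) as Hrng.
    apply wp_forc with (hi := B) (T := 1) (I := fun b s => forall b', b' < b -> ia s LO b' = ia s1 CUT b').
    + reflexivity.
    + lia.
    + intros b' Hb'. lia.
    + intros s HF. oks.
    + intros b s Hb HF HI' Eb.
      assert (E1 : ia s CUT = ia s1 CUT) by (fr; auto).
      ws. rewrite Eb, E1. split; [lia|]. intros b' Hb'. unfold upd. eqbs; [subst; auto|]. apply HI'; lia.
    + intros s t HF Hlo _ Ht.
      assert (A4 : ia s HI = ia s0 HI) by (fr; auto). assert (A5 : iv s rr = iv s0 rr) by (fr; auto).
      assert (A6 : iv s vq = q) by (fr; auto). assert (A7 : iv s vg = g) by (fr; auto).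
      pose proof (prune_lo_wsum E B g _ _ _ q p HC) as Hsum.
      assert (Hqg : q * g + B * g <= iv s0 rr).
      { rewrite <- Nat.mul_add_distr_r. replace (q + B) with R by lia. lia. }
      assert (Hrd : iv s0 rr < B * d + 1).
      { assert (ws_ s0 * g <= B * d); [|lia]. clear - fi_hi0. induction B as [|b IH]; simpl; [lia|].
        specialize (fi_hi0 b ltac:(lia)) as Hb. rewrite Nat.mul_add_distr_r, Nat.mul_sub_distr_r.
        specialize (IH ltac:(intros; apply fi_hi0; lia)). lia. }
      ws.
      rewrite A5, A6, A7.
      assert (Hws : wsum (ia s LO) (ia s HI) B = wsum (ia s1 CUT) (ia s0 HI) B).
      { rewrite A4. apply wsum_ext. intros; split; auto. }
      split; [lia|]. split; [|lia].
      constructor; sc; try (fr; auto; fail).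
      * intros b Hb. rewrite A4, Hlo by auto. apply Hrng; auto.
      * rewrite Hws. replace (wsum (ia s1 CUT) (ia s0 HI) B) with (ws_ s0 - q) by lia.
        rewrite Nat.mul_sub_distr_r. lia.
      * intros v. rewrite A4. intros Hv. apply fi_rk0.
        eapply (prune_lo_rk E d B g _ _ _ q p); eauto.
        erewrite active_ext; [exact Hv|]. intros b Hb; split; auto. symmetry; auto.
  - rewrite fi_bk0 in *. split; [lia|]. split; [constructor; auto|]. lia.
Qed.

Lemma round_ok g s0 : fj_inv (2 * g) s0 -> 1 <= g -> ws_ s0 <= 2 * B + 1 ->
  wp m round s0 (fun s t => t <= 640 * 800 * B /\ fj_inv g s /\ ws_ s <= 2 * B + 1).
Proof.
  intros [] Hg Hw. unfold round. ws.
  assert (Eg : iv s0 vg / 2 = g) by (rewrite fi_g0, Nat.mul_comm; apply Nat.div_mul; lia).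
  rewrite Eg.
  assert (Hhd : forall b, b < B -> 2 * ia s0 HI b <= d).
  { intros b Hb. specialize (fi_hi0 b Hb). nia. }
  apply wp_forc with (hi := B) (T := 2) (I := fun b s => forall b', b' < B ->
     ia s LO b' = (if b' <? b then 2 * ia s0 LO b' else ia s0 LO b') /\
     ia s HI b' = (if b' <? b then 2 * ia s0 HI b' else ia s0 HI b')).
  - reflexivity.
  - lia.
  - intros b' Hb'. sc. auto.
  - intros s HF. oks.
  - intros b s Hb HF HX Eb. destruct (HX b Hb) as [H1 H2]. rewrite Nat.ltb_irrefl in H1, H2.
    specialize (Hhd b Hb). specialize (fi_lh0 b Hb).
    ws; rewrite ?Eb, ?H1, ?H2; try lia.
    split; [lia|]. intros b' Hb'. destruct (HX b' Hb') as [H3 H4]. unfold upd.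
    destruct (Nat.eqb_spec b' b) as [->|Hn].
    + destruct (Nat.ltb_spec b (S b)); [auto|lia].
    + rewrite H3, H4. destruct (Nat.ltb_spec b' b), (Nat.ltb_spec b' (S b)); auto; lia.
  - intros s1 t1 HF1 HX _ Ht1.
    assert (H1 : forall b, b < B -> ia s1 LO b = 2 * ia s0 LO b /\ ia s1 HI b = 2 * ia s0 HI b).
    { intros b Hb. destruct (HX b Hb) as [H1 H2]. destruct (Nat.ltb_spec b B); [auto|lia]. }
    assert (Hws : ws_ s1 = 2 * ws_ s0).
    { clear - H1. induction B as [|b IH]; simpl; auto. rewrite IH by (intros; apply H1; lia).
      destruct (H1 b ltac:(lia)) as [-> ->]. lia. }
    assert (J1 : fj_inv g s1).
    { assert (A1 : iv s1 rr = iv s0 rr) by (fr; auto).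
      constructor; try (fr; auto; fail).
      - intros b Hb. destruct (H1 b Hb) as [-> ->]. specialize (fi_lh0 b Hb). lia.
      - intros b Hb. destruct (H1 b Hb) as [_ ->]. specialize (fi_hi0 b Hb). lia.
      - rewrite Hws, A1. lia.
      - intros v Hv. apply fi_rk0. rewrite active_halve. rewrite A1 in Hv.
        erewrite active_ext; [exact Hv|]. intros b Hb. destruct (H1 b Hb); auto. }
    ws. eapply wp_mono; [apply fill_ok'; [exact J1|lia]|].
    intros s2 t2 (Ht2 & J2 & V2 & W2 & _) _.
    ws. eapply wp_mono; [apply prune_hi_ok; [exact J2|auto|lia]|].
    intros s3 t3 (Ht3 & J3 & W3 & W3') _.
    ws. eapply wp_mono; [apply fill_ok'; [exact J3|lia]|].
    intros s4 t4 (Ht4 & J4 & V4 & W4 & R4) _.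
    eapply wp_mono; [apply prune_lo_ok; [exact J4|auto|lia|rewrite R4; lia]|].
    intros s5 t5 (Ht5 & J5 & W5) _. split; [lia|]. auto.
Qed.

Lemma active_one s b : filled E 1 B s -> b <= B ->
  seg (ra s VA) 0 (wsum (ia s LO) (ia s HI) b) = active E 1 (ia s LO) (ia s HI) b.
Proof.
  intros [_ HV]. induction b as [|b IH]; intros Hb; [reflexivity|].
  cbn [wsum active]. rewrite seg_app, IH by lia. f_equal. simpl (0 + _).
  rewrite seg_shift, (seg_shift (E b)). rewrite !Nat.mul_1_r. apply seg_ext. intros i Hi.
  specialize (HV b (ia s LO b + i) ltac:(lia) ltac:(lia)).
  replace (ia s LO b + i - ia s LO b) with i in HV by lia. rewrite HV. f_equal. lia.
Qed.

Lemma fj_ok h s0 : d = 2 ^ h -> iv s0 bk = B -> iv s0 vd = d -> iv s0 rr = r0 -> r0 < B * d ->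
  elem_ok (lM m) (ia s0 PERM) (ia s0 PT) (ra s0 XA) (ra s0 YA) (iv s0 vk) d B E ->
  wp m fj s0 (fun s t => t <= 640 * 801 * (B * (h + 1)) /\ rk all r0 (rv s rres)).
Proof.
  intros Hd EB Ed Er Hr HEl. unfold fj. ws.
  assert (Hd1 : 1 <= d) by (rewrite Hd; pose proof (Nat.pow_nonzero 2 h); lia).
  apply wp_forc with (hi := B) (T := 2) (I := fun b s => forall b', b' < b -> ia s LO b' = 0 /\ ia s HI b' = 1).
  { reflexivity. } { lia. } { intros; lia. } { intros s HF; oks. }
  { intros b s Hb HF HX Eb. ws. rewrite Eb. split; [lia|]. intros b' Hb'. unfold upd.
    eqbs; auto. apply HX; lia. }
  intros s1 t1 HF1 H1 _ Ht1.
  assert (J1 : fj_inv d s1 /\ ws_ s1 = B).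
  { assert (Hw : forall b, b <= B -> wsum (ia s1 LO) (ia s1 HI) b = b).
    { induction b as [|b IH]; intros Hb; simpl; auto. rewrite IH by lia.
      destruct (H1 b ltac:(lia)) as [-> ->]. lia. }
    assert (A1 : iv s1 rr = r0) by (fr; auto).
    split; [|apply Hw; auto]. constructor; try (fr; auto; fail).
    - intros b Hb. destruct (H1 b Hb) as [-> ->]; lia.
    - intros b Hb. destruct (H1 b Hb) as [_ ->]; lia.
    - rewrite A1, Hw by auto. auto.
    - intros v. rewrite A1. erewrite active_ext; [eauto|]. intros b Hb. destruct (H1 b Hb); auto. }
  destruct J1 as [J1 W1]. ws.
  apply wp_while with (f := fun s => iv s vg)
    (I := fun s t => exists e, fj_inv (2 ^ e) s /\ ws_ s <= 2 * B + 1 /\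
        t + (640 * 800 * B + 1) * e <= (640 * 800 * B + 1) * h).
  { exists h. rewrite <- Hd. split; [auto|]. split; [lia|]. lia. }
  { intros s t HF (e & J & _). oks. }
  { intros s t HF (e & J & W & Ht) Hl. sch Hl. pose proof (fi_g _ _ J) as Eg. rewrite Eg in Hl.
    destruct e as [|e]; [simpl in Hl; lia|].
    pose proof (Nat.pow_nonzero 2 e ltac:(lia)).
    eapply wp_mono; [apply (round_ok (2 ^ e)); [exact J|lia|auto]|].
    intros s' t' (Ht' & J' & W') _. split.
    - exists e. split; [auto|]. split; [auto|]. lia.
    - rewrite Eg, (fi_g _ _ J'). simpl. lia. }
  intros s2 t2 HF2 (e & J2 & W2 & Ht2) Hl. sch Hl. rewrite (fi_g _ _ J2) in Hl.
  destruct e as [|e]; [|exfalso; simpl in Hl; pose proof (Nat.pow_nonzero 2 e ltac:(lia)); lia].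
  ws. eapply wp_mono; [apply fill_ok'; [exact J2|lia]|].
  intros s3 t3 (Ht3 & J3 & V3 & W3 & _) F3.
  pose proof V3 as [VU _]. set (N := ws_ s3) in *.
  ws. apply wp_forc with (hi := N) (T := 1) (I := fun i s => forall x, x < i -> ra s WK x = ra s3 VA x).
  { reflexivity. } { lia. } { intros; lia. } { intros s HF; oks. }
  { intros i s Hi HF HX Ei. ws. split; [lia|]. intros x Hx. unfold upd. fr. rewrite Ei. eqbs.
    - subst; auto.
    - apply HX; lia. }
  intros s4 t4 HF4 HW _ Ht4.
  assert (A1 : iv s4 vU = N) by (fr; auto). assert (A2 : iv s4 rr = iv s3 rr) by (fr; auto).
  pose proof (fi_r _ _ J3) as Hr3. simpl in Hr3. fold N in Hr3.
  ws. eapply wp_mono; [apply select_ok; sc; lia|]. sc. rewrite A1, A2.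
  intros s5 t5 (Ht5 & Hrk) _. split; [assert (h <= B * h) by (destruct B; [lia|apply Nat.le_add_r]); lia|].
  apply (fi_rk _ _ J3). simpl (2 ^ 0). rewrite <- active_one by auto. fold N.
  rewrite (seg_ext (ra s4 WK) (ra s3 VA)) in Hrk by (intros; apply HW; lia). auto.
Qed.

End FJ.

(** * Counting the cells of an arrangement of difference constraints *)

Definition constr : Type := nat * nat * R.
Definition sat (y : nat -> R) (k : constr) : bool :=
  let '(p, q, c) := k in leb (y p - y q)%R c.
Definition pat (cs : list constr) (y : nat -> R) : list bool := map (sat y) cs.

(* Substitutes y p := y q + c. *)
Definition subst1 (p q : nat) (c : R) (k : constr) : constr :=
  let '(p', q', c') := k in
  (if p' =? p then q else p', if q' =? p then q else q',
   (c' - (if Nat.eqb p' p then c else 0) + (if Nat.eqb q' p then c else 0))%R).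

Lemma leb_eq a b a' b' : (a <=r b <-> a' <=r b') -> leb b a = leb b' a'.
Proof. intros H. destruct (leb_spec b a), (leb_spec b' a'); tauto. Qed.

Lemma sat_subst1 y p q c k : y p = (y q + c)%R -> sat y (subst1 p q c k) = sat y k.
Proof.
  destruct k as [[p' q'] c']. intros H. simpl. apply leb_eq.
  destruct (Nat.eqb_spec p' p), (Nat.eqb_spec q' p); subst; rewrite ?H; split; intros; lra.
Qed.

Lemma NoDup_map_filter {A B} (f : A -> B) (p : A -> bool) l :
  NoDup (map f l) -> NoDup (map f (filter p l)).
Proof.
  induction l as [|a l IH]; simpl; auto. intros H. inversion H; subst.
  destruct (p a); simpl; auto. constructor; auto.
  rewrite in_map_iff in *. intros (x & E & Hx). apply filter_In in Hx as [Hx _]. eauto.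
Qed.

Lemma NoDup_map_factor {A B C} (f : A -> B) (g : A -> C) l :
  (forall x y, f x = f y -> g x = g y) -> NoDup (map g l) -> NoDup (map f l).
Proof.
  intros H. induction l as [|a l IH]; simpl; intros Hn; [constructor|]. inversion Hn; subst.
  constructor; auto. rewrite in_map_iff in *. intros (x & E & Hx). eauto.
Qed.

(** z is the point where the segment from y to y' meets the hyperplane. Half-spaces and their
    complements are convex, so a constraint on which both ends agree has the same value at z. *)
Lemma segment_point p q c y y' :
  (y p - y q <r c) -> (c <=r y' p - y' q) ->
  exists z, z p = (z q + c)%R /\ forall k, sat y k = sat y' k -> sat z k = sat y k.
Proof.
  intros H1 H2. set (l := ((c - (y p - y q)) / ((y' p - y' q) - (y p - y q)))%R).
  assert (Hd : (0 < (y' p - y' q) - (y p - y q))%R) by lra.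
  assert (Hl0 : (0 <= l)%R) by (apply Rlt_le, Rdiv_lt_0_compat; lra).
  assert (Hl1 : (l <= 1)%R).
  { apply Rmult_le_reg_r with (1 := Hd). unfold l, Rdiv. rewrite Rmult_assoc, Rinv_l; lra. }
  assert (Hl : (l * ((y' p - y' q) - (y p - y q)) = c - (y p - y q))%R).
  { unfold l, Rdiv. rewrite Rmult_assoc, Rinv_l; lra. }
  exists (fun v => ((1 - l) * y v + l * y' v)%R). split; [lra|].
  intros [[p' q'] c'] E. simpl in *.
  destruct (leb_spec (y p' - y q') c') as [A|A], (leb_spec (y' p' - y' q') c') as [A'|A']; try discriminate;
  match goal with |- leb ?u c' = _ => destruct (leb_spec u c') as [D|D]; auto; exfalso end.
  - apply D.
    replace ((1 - l) * y p' + l * y' p' - ((1 - l) * y q' + l * y' q'))%R with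
      ((1 - l) * (y p' - y q') + l * (y' p' - y' q'))%R by ring. nra.
  - apply Rnot_le_lt in A, A'.
    replace ((1 - l) * y p' + l * y' p' - ((1 - l) * y q' + l * y' q'))%R with
      ((1 - l) * (y p' - y q') + l * (y' p' - y' q'))%R in D by ring. nra.
Qed.

Lemma sat_cons_NoDup k cs b ys : (forall y, In y ys -> sat y k = b) ->
  NoDup (map (pat (k :: cs)) ys) -> NoDup (map (pat cs) ys).
Proof.
  intros H Hn. rewrite (map_ext_in _ (fun y => b :: pat cs y)) in Hn.
  - rewrite <- (map_map (pat cs) (cons b)) in Hn. apply NoDup_map_inv in Hn. auto.
  - intros y Hy. unfold pat; simpl. rewrite H; auto.
Qed.

Lemma filter_length_split {A} (p : A -> bool) l :
  length l = length (filter p l) + length (filter (fun x => negb (p x)) l).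
Proof. induction l as [|a l IH]; simpl; auto. destruct (p a); simpl; lia. Qed.

Definition mem (b : list bool) (l : list (list bool)) : bool :=
  if in_dec (list_eq_dec bool_dec) b l then true else false.

(* Adding a constraint splits a cell only if its hyperplane crosses it, and the crossed cells
   inject into the cells cut out on that hyperplane, where one variable can be eliminated. *)
Lemma cells_bound n : forall cs V ys, length cs = n ->
  (forall p q c, In (p, q, c) cs -> In p V /\ In q V) ->
  NoDup (map (pat cs) ys) -> length ys <= (n + 1) ^ length V.
Proof.
  induction n as [|n IH]; intros cs V ys Hn HV HD.
  - destruct cs; [|discriminate]. rewrite Nat.pow_1_l.
    destruct ys as [|y1 [|y2 ys]]; simpl; auto. exfalso. simpl in HD. inversion HD as [|? ? H _]; subst.
    apply H; simpl; auto.
  - destruct cs as [|[[p q] c] cs]; [discriminate|]. injection Hn as Hn.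
    destruct (HV p q c (or_introl eq_refl)) as [Hp Hq].
    assert (HV' : forall p q c, In (p, q, c) cs -> In p V /\ In q V) by (intros; eapply HV; simpl; eauto).
    set (k := (p, q, c)) in *.
    set (yT := filter (fun y => sat y k) ys). set (yF := filter (fun y => negb (sat y k)) ys).
    assert (NT : NoDup (map (pat cs) yT)).
    { apply sat_cons_NoDup with k true; [|apply NoDup_map_filter; auto].
      intros y Hy. apply filter_In in Hy; tauto. }
    assert (NF : NoDup (map (pat cs) yF)).
    { apply sat_cons_NoDup with k false; [|apply NoDup_map_filter; auto].
      intros y Hy. apply filter_In in Hy as [_ Hy]. destruct (sat y k); auto; discriminate. }
    (* [yB] consists of the points violating the constraint [k] whose cell in the arrangement of the
       others also contains a point satisfying it. These are the crossed cells; [yA] has one point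
       for every cell of the smaller arrangement that occurs. *)
    set (tw := fun y => mem (pat cs y) (map (pat cs) yT)).
    set (yA := yT ++ filter (fun y => negb (tw y)) yF). set (yB := filter tw yF).
    assert (HL : length ys = length yA + length yB).
    { unfold yA. rewrite length_app. rewrite (filter_length_split (fun y => sat y k) ys).
      fold yT yF. rewrite (filter_length_split tw yF). fold yB. lia. }
    assert (NA : NoDup (map (pat cs) yA)).
    { unfold yA. rewrite map_app. apply NoDup_app; auto; [apply NoDup_map_filter; auto|].
      intros b H1 H2. apply in_map_iff in H2 as (y & <- & Hy). apply filter_In in Hy as [_ Hy].
      unfold tw, mem in Hy. destruct (in_dec _ _ _); [discriminate|contradiction]. }
    assert (LA : length yA <= (n + 1) ^ length V) by (eapply IH; eauto).
    assert (HB : exists zs, map (pat (map (subst1 p q c) cs)) zs = map (pat cs) yB).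
    { assert (H : forall y, In y yB -> exists z, pat (map (subst1 p q c) cs) z = pat cs y).
      { intros y Hy. apply filter_In in Hy as [Hy Ht]. apply filter_In in Hy as [_ Hs].
        unfold tw, mem in Ht. destruct (in_dec _ _ _) as [Ht'|]; [|discriminate].
        apply in_map_iff in Ht' as (y' & E & Hy'). apply filter_In in Hy' as [_ Hs'].
        simpl in Hs, Hs'. destruct (leb_spec (y p - y q) c) as [|B1]; [discriminate|].
        destruct (leb_spec (y' p - y' q) c) as [B2|]; [|discriminate].
        destruct (segment_point p q c y y') as (z & Hz & Hk); [lra|lra|].
        exists z. unfold pat in *. rewrite map_map. apply map_ext_in. intros k' Hk'.
        rewrite sat_subst1 by auto. apply Hk. symmetry. revert Hk'. revert k'.
        apply ext_in_map. auto. }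
      revert H. clear. induction yB as [|y l IH]; intros H; [exists []; auto|].
      destruct IH as (zs & E); [intros; apply H; simpl; auto|].
      destruct (H y (or_introl eq_refl)) as (z & Ez). exists (z :: zs). simpl. congruence. }
    destruct HB as (zs & Hzs).
    assert (LB : length yB <= (n + 1) ^ (length V - 1)).
    { destruct (Nat.eq_dec p q) as [->|Hpq].
      - assert (yB = []); [|rewrite H; simpl; lia].
        destruct yB as [|y l] eqn:E; auto. exfalso.
        assert (Hy : In y yB) by (rewrite E; simpl; auto). unfold yB in Hy.
        apply filter_In in Hy as [Hy Ht]. apply filter_In in Hy as [_ Hs].
        unfold tw, mem in Ht. destruct (in_dec _ _ _) as [Ht'|]; [|discriminate].
        apply in_map_iff in Ht' as (y' & E' & Hy'). apply filter_In in Hy' as [_ Hs'].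
        simpl in Hs, Hs'. destruct (leb_spec (y q - y q) c) as [|B1]; [discriminate|].
        destruct (leb_spec (y' q - y' q) c) as [B2|]; [|discriminate]. lra.
      - replace (length yB) with (length zs)
          by (apply (f_equal (@length _)) in Hzs; rewrite !length_map in Hzs; auto).
        etransitivity.
        + apply (IH (map (subst1 p q c) cs) (remove Nat.eq_dec p V)).
          * rewrite length_map; auto.
          * intros p' q' c' H. apply in_map_iff in H as ([[p2 q2] c2] & E & H). simpl in E.
            injection E as <- <- <-. destruct (HV' _ _ _ H).
            split; apply in_in_remove; try (destruct (Nat.eqb_spec p2 p); auto);
            try (destruct (Nat.eqb_spec q2 p); auto).
          * rewrite Hzs. apply NoDup_map_filter; auto.
        + apply Nat.pow_le_mono_r; [lia|]. pose proof (remove_length_lt Nat.eq_dec V p Hp). lia. }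
    (* What remains is the recurrence (n + 1)^(v + 1) + (n + 1)^v <= (n + 2)^(v + 1). *)
    assert (1 <= length V) by (destruct V; [destruct Hp|simpl; lia]).
    destruct (length V) as [|v]; [lia|]. simpl in LB. rewrite Nat.sub_0_r in LB.
    assert ((n + 1) ^ v <= (S n + 1) ^ v) by (apply Nat.pow_le_mono_l; lia).
    rewrite HL. replace (S n + 1) with (n + 2) in * by lia. cbn [Nat.pow] in *. nia.
Qed.

Section Signature.
Variables (d s : nat) (xs w : nat -> nat -> R).

(** A pair of positions (r, t) is coded as the single number e = r d + t. *)
Definition dif (a e : nat) : R := (xs a (e / d)%nat - xs a (e mod d)%nat)%R.
Definition thr (j e : nat) : R := (w j (e / d)%nat - w j (e mod d)%nat)%R.
Definition rank (j e : nat) : nat := cnt (leb (thr j e)) (seg (fun a => dif a e) 0 s).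

(* The ranks, as digits in base s + 1, are packed into one number; it is kept in a real register,
   since it does not fit into a word. *)
Fixpoint kap (j n : nat) : R :=
  match n with O => 0%R | S e => (kap j e * INR (s + 1) + INR (rank j e))%R end.

Lemma rank_le j e : rank j e <= s.
Proof. apply cnt_seg_le. Qed.

Lemma kap_inj j j' n : kap j n = kap j' n -> forall e, e < n -> rank j e = rank j' e.
Proof.
  set (f := fun j => fix f n := match n with O => 0 | S e => f e * (s + 1) + rank j e end).
  assert (Hf : forall j n, kap j n = INR (f j n)).
  { intros i k. induction k as [|k IHk]; [reflexivity|]. cbn [kap]. rewrite IHk, <- mult_INR, <- plus_INR. reflexivity. }
  rewrite !Hf. intros H. apply INR_eq in H. revert H. induction n as [|n IH]; intros H e He; [lia|].
  simpl in H. pose proof (rank_le j n). pose proof (rank_le j' n).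
  assert (A : forall a r, r <= s -> (a * (s + 1) + r) mod (s + 1) = r /\ (a * (s + 1) + r) / (s + 1) = a).
  { intros a r Hr. split.
    - rewrite Nat.add_comm, Nat.Div0.mod_add, Nat.mod_small; lia.
    - rewrite Nat.div_add_l, Nat.div_small; lia. }
  destruct (A (f j n) _ H0) as [M1 D1]. destruct (A (f j' n) _ H1) as [M2 D2].
  rewrite H in M1, D1. destruct (Nat.eq_dec e n) as [->|]; [congruence|].
  apply IH; [congruence|lia].
Qed.

(** Of two thresholds the larger one counts all that the smaller one counts; equal counts leave no
    entry between them. *)
Lemma cnt_leb_inj l u u' : cnt (leb u) l = cnt (leb u') l -> forall x, In x l -> (x <=r u <-> x <=r u').
Proof.
  assert (A : forall u u', u <=r u' -> cnt (leb u) l = cnt (leb u') l -> forall x, In x l -> x <=r u' -> x <=r u).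
  { clear. intros u u' Hu. induction l as [|a l IH]; intros H x Hx Hle; [destruct Hx|].
    rewrite !cnt_cons in H.
    assert (cnt (leb u) l <= cnt (leb u') l).
    { apply cnt_mono. intros y _. destruct (leb_spec u y), (leb_spec u' y); auto; lra. }
    destruct (leb_spec u a), (leb_spec u' a); try lra; try lia; destruct Hx as [->|Hx]; auto;
    try (apply IH; auto; lia); lra. }
  intros H x Hx. destruct (Rle_lt_dec u u') as [Hu|Hu].
  - split; intros; [lra|eapply A; eauto].
  - split; intros; [|lra]. eapply (A u' u); eauto. lra.
Qed.

Lemma kap_dif j j' e a : kap j (d * d) = kap j' (d * d) -> e < d * d -> a < s ->
  (dif a e <=r thr j e <-> dif a e <=r thr j' e).
Proof.
  intros H He Ha. pose proof (kap_inj _ _ _ H e He) as Hr.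
  apply (cnt_leb_inj _ _ _ Hr). apply in_seg. exists a. split; auto. lia.
Qed.

(** Fredman's identity: the comparison within block a is one between a difference of the block and a
    difference of the window, and the signature records all of these. A table that sorts a block
    against window j thus sorts it against every window of the same signature. *)
Lemma kap_order j j' a r t : kap j (d * d) = kap j' (d * d) -> a < s -> r < d -> t < d ->
  (xs a r - w j r <=r xs a t - w j t) -> (xs a r - w j' r <=r xs a t - w j' t).
Proof.
  intros H Ha Hr Ht Hle.
  pose proof (kap_dif j j' (r * d + t) a H ltac:(nia) Ha) as K. unfold dif, thr in K.
  rewrite Nat.div_add_l, (Nat.div_small t), Nat.add_0_r in K by lia.
  rewrite Nat.add_comm, Nat.Div0.mod_add, Nat.mod_small in K by lia.
  assert (xs a r - xs a t <=r w j' r - w j' t); [|lra]. apply K. lra.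
Qed.

Lemma kap_ext j j' n : (forall e, e < n -> rank j e = rank j' e) -> kap j n = kap j' n.
Proof. induction n as [|n IH]; intros H; simpl; auto. rewrite IH, H; auto. Qed.

(** The signature is a function of the sign pattern with respect to the s d^2 constraints, so
    different signatures belong to different cells; the variables are the d positions of the
    window. *)
Lemma kap_count js : NoDup (map (fun j => kap j (d * d)) js) -> length js <= (s * (d * d) + 1) ^ d.
Proof.
  intros HD.
  set (cs := flat_map (fun e => map (fun a => (e / d, e mod d, dif a e)) (seq 0 s)) (seq 0 (d * d)) : list constr).
  assert (Hlen : length cs = s * (d * d)).
  { unfold cs. clear. induction (d * d) as [|n IH]; [simpl; lia|].
    rewrite seq_S, flat_map_app, length_app.
    transitivity (s * n + s); [f_equal; [exact IH|]|lia].
    simpl. rewrite app_nil_r, length_map, length_seq. auto. }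
  rewrite <- (length_seq d 0) at 3.
  rewrite <- (length_map w js). apply cells_bound with (cs := cs); auto.
  - intros p q c H. apply in_flat_map in H as (e & He & H). apply in_map_iff in H as (a & E & _).
    injection E as <- <- <-. apply in_seq in He. assert (d <> 0) by (intros ->; lia). rewrite !in_seq.
    assert (e / d < d) by (apply Nat.Div0.div_lt_upper_bound; lia).
    pose proof (Nat.mod_upper_bound e d). lia.
  - rewrite map_map. revert HD. apply NoDup_map_factor. intros j j' E. apply kap_ext. intros e He.
    apply cnt_ext. intros x Hx. apply in_seg in Hx as (a & Ha & <-).
    assert (Hin : In (e / d, e mod d, dif a e) cs).
    { apply in_flat_map. exists e. split; [apply in_seq; lia|]. apply in_map_iff. exists a.
      split; auto. apply in_seq; lia. }
    unfold pat in E. exact (ext_in_map E _ Hin).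
Qed.

End Signature.

(** * Tabulating the sorted orders *)

Notation vs := 23 (only parsing).
Notation vnb := 24 (only parsing).
Notation vbe := 37 (only parsing).
Notation vj := 38 (only parsing).
Notation ve := 39 (only parsing).
Notation er := 40 (only parsing).
Notation et := 41 (only parsing).
Notation dm := 42 (only parsing).
Notation nc := 43 (only parsing).
Notation va := 44 (only parsing).
Notation fnd := 45 (only parsing).

Notation rkap := 4 (only parsing).

Definition xel (t : iexp) : rexp := RAr XA (Bi Plus (Bi Times (Bi Plus (Bi Times (Vr vbe) (Vr vs)) (Vr va)) (Vr vd)) t).
Definition yel (t : iexp) : rexp := RAr YA (Bi Minus (Bi Plus (Vr vd) (Vr vj)) t).

(** [KEY] is divided among three uses: the dictionary starts at 0, the d terms of a block being
    sorted lie from n on, and the d^2 sorted lists from 2n on. *)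
Definition build_lists : cmd := (
  For ve (Vr vd * Vr vd) (
    er <-i Vr ve / Vr vd ;; et <-i Vr ve mod Vr vd ;;
    sb <-i Cn 2 * Vr vn + Vr ve * Vr vs ;;
    For va (Vr vs) (RSto KEY (Vr sb + Vr va) (xel (Vr er) - xel (Vr et))) ;;
    sn <-i Vr vs ;; isort))%cmd.

Definition signature : cmd := (
  rkap <-r RCn 0 ;;
  For ve (Vr vd * Vr vd) (
    er <-i Vr ve / Vr vd ;; et <-i Vr ve mod Vr vd ;;
    bb <-i Cn 2 * Vr vn + Vr ve * Vr vs ;; bn <-i Vr vs ;;
    ru <-r yel (Vr er) - yel (Vr et) ;; bsearch ;;
    rkap <-r RVr rkap * RI (Vr vs + Cn 1) + RI (Vr bl)))%cmd.

(** The search counts the keys up to [rkap]. A key equal to [rkap] must be the last one counted, and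
    that one is equal exactly if it is not smaller, so strict comparisons suffice. *)
Definition lookup : cmd := (
  bb <-i Cn 0 ;; bn <-i Vr dm ;; ru <-r RVr rkap ;; bsearch ;;
  fnd <-i Cn 0 ;;
  If (CLt (Cn 0) (Vr bl))
    (If (CRlt (RAr KEY (Vr bl - Cn 1)) (RVr rkap)) Skip (fnd <-i Cn 1))
    Skip)%cmd.

Definition new_table : cmd := (
  For va (Vr vs) (
    sb <-i Vr vn ;;
    For et (Vr vd) (
      RSto KEY (Vr sb + Vr et) (xel (Vr et) - yel (Vr et)) ;;
      ISto PAY (Vr sb + Vr et) (Vr et)) ;;
    sn <-i Vr vd ;; isort ;;
    For et (Vr vd)
      (ISto PERM ((Vr nc * Vr vs + Vr va) * Vr vd + Vr et) (Ar PAY (Vr sb + Vr et)))))%cmd.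

(** Sorting the whole dictionary anew costs O(Kc^2) steps per new cell and O(Kc^3) per batch, where
    Kc is at most n^(1/4). *)
Definition insert_key : cmd := (
  RSto KEY (Vr dm) (RVr rkap) ;; ISto PAY (Vr dm) (Vr nc) ;;
  dm <-i Vr dm + Cn 1 ;; nc <-i Vr nc + Cn 1 ;;
  sb <-i Cn 0 ;; sn <-i Vr dm ;; isort)%cmd.

Definition window_step : cmd := (
  signature ;; lookup ;;
  If (CLt (Cn 0) (Vr fnd))
    (ISto CELL (Vr vbe * Vr vn + Vr vj) (Ar PAY (Vr bl - Cn 1)))
    (ISto CELL (Vr vbe * Vr vn + Vr vj) (Vr nc) ;; new_table ;; insert_key))%cmd.

(** Signatures refer to the blocks of one batch, so the dictionary starts empty each time; the table
    numbers [nc] continue through all batches. *)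
Definition batch : cmd := (build_lists ;; dm <-i Cn 0 ;; For vj (Vr vn) window_step)%cmd.

Definition build : cmd := (nc <-i Cn 0 ;; For vbe (Vr vnb) batch)%cmd.

Lemma cnt_sorted K b n u l : sorted_at K b n -> l <= n ->
  (forall x, x < l -> K (b + x) <=r u) -> (forall x, l <= x < n -> u <r K (b + x)) ->
  cnt (leb u) (seg K b n) = l.
Proof.
  intros Hs Hl H1 H2. rewrite seg_shift. apply cnt_prefix; auto. intros i Hi.
  destruct (Nat.ltb_spec i l) as [H|H], (leb_spec u (K (b + i))) as [A|A]; auto; exfalso.
  assert (u <r K (b + i)) by (apply H2; lia). lra.
Qed.

Lemma le_mul1 a b : 1 <= b -> a <= a * b.
Proof. intros H. rewrite <- (Nat.mul_1_r a) at 1. apply Nat.mul_le_mono_l; auto. Qed.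

Section Batch.
Variables (m : lim) (n d s nb be es eq : nat) (X Y : nat -> R).
(* Block a of batch b, and the window of y that ends at j; indices into Y are shifted by d, the
   length of the padding. *)
Definition xs (b a r : nat) : R := X ((b * s + a) * d + r).
Definition win (j r : nat) : R := Y (d + j - r).
Definition Kc : nat := (s * (d * d) + 1) ^ d.
Hypothesis Hd : 1 <= d.
Hypothesis Hdn : d <= n.
Hypothesis Hs : 1 <= s.
Hypothesis Hes : s < 2 ^ es.
Hypothesis Heq : Kc < 2 ^ eq.
Hypothesis HM1 : nb * s * d + 4 * n + (d * d) * s + s + s + 10 < lM m.
Hypothesis HM2 : nb * n < lM m.
Hypothesis HM3 : (nb * Kc + 4) * s * d < lM m.

Record env (s0 : st) : Prop := {
  en_n : iv s0 vn = n; en_d : iv s0 vd = d; en_s : iv s0 vs = s; en_nb : iv s0 vnb = nb;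
  en_X : ra s0 XA = X; en_Y : ra s0 YA = Y }.

Definition lists_ok (b : nat) (K : nat -> R) : Prop := forall e, e < d * d ->
  sorted_at K (2 * n + e * s) s /\
  Permutation (seg (fun a => dif d (xs b) a e) 0 s) (seg K (2 * n + e * s) s).

Lemma idx_bound b a r : b < nb -> a < s -> r < d ->
  b * s < lM m /\ b * s + a < lM m /\ (b * s + a) * d < lM m /\ (b * s + a) * d + r < lM m.
Proof.
  intros Hb Ha Hr. assert (b * s + a + 1 <= nb * s) by nia.
  assert ((b * s + a + 1) * d <= nb * s * d) by (apply Nat.mul_le_mono_r; auto).
  assert (nb * s * 1 <= nb * s * d) by (apply Nat.mul_le_mono_l; auto). lia.
Qed.

Lemma xel_ok s0 b a t r : env s0 -> iv s0 vbe = b -> b < nb -> iv s0 va = a -> a < s ->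
  iok m s0 t -> ieval s0 t = r -> r < d ->
  rok m s0 (xel t) /\ reval s0 (xel t) = xs b a r.
Proof.
  intros [] Eb Hb Ea Ha Hk Et Hr. destruct (idx_bound b a r Hb Ha Hr) as (A1 & A2 & A3 & A4).
  unfold xel. sc. rewrite Eb, Ea, Et, en_s0, en_d0, en_X0. unfold xs. repeat split; auto.
Qed.

Lemma yel_ok s0 j t r : env s0 -> iv s0 vj = j -> j < n -> iok m s0 t -> ieval s0 t = r -> r < d ->
  rok m s0 (yel t) /\ reval s0 (yel t) = win j r.
Proof.
  intros [] Ej Hj Hk Et Hr.
  unfold yel. sc. rewrite Ej, Et, en_d0, en_Y0. unfold win. repeat split; auto; lia.
Qed.

Lemma env_frame c s0 s1 : env s0 -> frame c s0 s1 ->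
  forallb (fun v => negb (inb v (miv c))) [vn; vd; vs; vnb] = true ->
  forallb (fun v => negb (inb v (mra c))) [XA; YA] = true -> env s1.
Proof.
  intros [] F H1 H2. cbn [forallb] in H1, H2.
  repeat match goal with H : _ && _ = true |- _ => apply andb_prop in H as [? ?] end.
  repeat match goal with H : negb _ = true |- _ => apply negb_true_iff in H end.
  constructor; rewrite ?(fr_iv _ _ _ F), ?(fr_ra _ _ _ F); auto.
Qed.

Lemma e_split e : e < d * d -> e / d < d /\ e mod d < d.
Proof. intros H. split; [apply Nat.Div0.div_lt_upper_bound; lia|apply Nat.mod_upper_bound; lia]. Qed.

Lemma build_lists_ok s0 : env s0 -> iv s0 vbe = be -> be < nb ->
  wp m build_lists s0 (fun s1 t => t <= 40 * (d * d * (s * s)) + 2 /\ lists_ok be (ra s1 KEY)).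
Proof.
  intros He Eb Hb. unfold build_lists.
  apply wp_forc with (hi := d * d) (T := 11 * (s * s) + 8 * s + 8)
    (I := fun e s1 => forall e', e' < e -> sorted_at (ra s1 KEY) (2 * n + e' * s) s /\
      Permutation (seg (fun a => dif d (xs be) a e') 0 s) (seg (ra s1 KEY) (2 * n + e' * s) s)).
  - reflexivity.
  - nia.
  - intros; lia.
  - intros s1 HF. sc. fr. rewrite (en_d _ He). split; auto. repeat split; auto. nia.
  - intros e s1 Hee HF HI Ee.
    assert (He1 : env s1) by (eapply env_frame; eauto).
    assert (Eb1 : iv s1 vbe = be) by (fr; auto).
    destruct (e_split e Hee) as [Hr Ht].
    assert (Hes1 : e * s + s <= d * d * s) by nia.
    ws; rewrite ?Ee, ?(en_d _ He1), ?(en_s _ He1), ?(en_n _ He1), ?(en_s _ He), ?(en_n _ He); try lia.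
    match goal with |- wp _ _ ?s2 _ => set (s2' := s2) end.
    assert (He2 : env s2') by (destruct He1; constructor; auto).
    apply wp_forc with (hi := s) (T := 1)
      (I := fun a s3 => (forall a', a' < a -> ra s3 KEY (2 * n + e * s + a') = dif d (xs be) a' e) /\
         forall x, x < 2 * n + e * s -> ra s3 KEY x = ra s1 KEY x).
    + reflexivity.
    + lia.
    + split; intros; [lia|]. reflexivity.
    + intros s3 HF3. sc. fr. split; auto. apply (en_s _ He2).
    + intros a s3 Ha HF3 [H1 H2] Ea.
      assert (He3 : env s3) by (eapply env_frame; eauto).
      assert (Eb3 : iv s3 vbe = be) by (fr; auto).
      assert (Er3 : iv s3 er = e / d) by (fr; auto). assert (Et3 : iv s3 et = e mod d) by (fr; auto).
      assert (Es3 : iv s3 sb = 2 * n + e * s) by (fr; auto).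
      destruct (xel_ok s3 be a (Vr er) (e / d) He3 Eb3 Hb Ea Ha Logic.I Er3 Hr) as [K1 V1].
      destruct (xel_ok s3 be a (Vr et) (e mod d) He3 Eb3 Hb Ea Ha Logic.I Et3 Ht) as [K2 V2].
      apply wp_rsto.
      { split; [sc; rewrite Es3, Ea; repeat split; lia|]. split; [cbn [rok]; auto|]. sc. rewrite Es3, Ea. lia. }
      cbn [reval]. rewrite V1, V2. sc. rewrite Es3, Ea. split; [lia|]. split.
      * intros a' Ha'. unfold upd. eqbs; [|apply H1; lia]. replace a' with a by lia. reflexivity.
      * intros x Hx. rewrite upd_other by lia. apply H2; auto.
    + intros s3 t3 HF3 [H1 H2] _ Ht3.
      assert (He3 : env s3) by (eapply env_frame; eauto).
      assert (Es3 : iv s3 sb = 2 * n + e * s) by (fr; auto).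
      ws. rewrite (en_s _ He3).
      eapply wp_mono; [apply isort_ok; sc; rewrite Es3; lia|]. sc. rewrite Es3.
      intros s4 t4 (Ht4 & Ho & Hp & Hsrt) F4. split; [lia|].
      apply (Permutation_map fst) in Hp. rewrite !kp_fst in Hp. sch Hp.
      intros e' He'. destruct (Nat.eq_dec e' e) as [->|].
      * split; auto. rewrite <- Hp, (seg_shift (ra s3 KEY)).
        rewrite (seg_ext (fun i => ra s3 KEY (2 * n + e * s + i)) (fun a => dif d (xs be) a e)); [auto|].
        intros i Hi. apply H1; lia.
      * destruct (HI e' ltac:(lia)) as [S1 P1].
        assert (Hle : S e' * s <= e * s) by (apply Nat.mul_le_mono_r; lia). cbn [Nat.mul] in Hle.
        assert (HH : forall x, x < 2 * n + e * s -> ra s4 KEY x = ra s1 KEY x).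
        { intros x Hx. pose proof (Ho x ltac:(lia)) as Q. inversion Q as [[Q1 Q2]]. rewrite <- H2 by auto. exact Q1. }
        split.
        -- intros i j Hij. rewrite !HH by lia. apply S1; auto.
        -- rewrite P1. rewrite (seg_ext (ra s4 KEY) (ra s1 KEY)); auto. intros; apply HH; lia.
  - intros s1 t HF HI _ Ht. split; [|intros e He'; apply HI; auto].
    assert (d * d * (11 * (s * s) + 8 * s + 8 + 2) <= d * d * (40 * (s * s)))
      by (apply Nat.mul_le_mono_l; pose proof (le_mul1 s s Hs); lia).
    lia.
Qed.

Lemma signature_ok s0 j : env s0 -> lists_ok be (ra s0 KEY) -> iv s0 vj = j -> j < n ->
  wp m signature s0 (fun s1 t => t <= d * d * (4 * es + 11) + 3 /\
    rv s1 rkap = kap d s (xs be) win j (d * d)).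
Proof.
  intros He HL Ej Hj. unfold signature. ws.
  apply wp_forc with (hi := d * d) (T := 4 * es + 9)
    (I := fun e s1 => rv s1 rkap = kap d s (xs be) win j e).
  - reflexivity.
  - nia.
  - reflexivity.
  - intros s1 HF. sc. fr. rewrite (en_d _ He). split; auto. repeat split; auto. nia.
  - intros e s1 Hee HF HI Ee.
    assert (He1 : env s1) by (eapply env_frame with (s0 := set_rv s0 rkap 0); eauto; destruct He; constructor; auto).
    destruct (e_split e Hee) as [Hr Ht].
    assert (Hes1 : e * s + s <= d * d * s) by nia.
    assert (EK : ra s1 KEY = ra s0 KEY) by (fr; auto).
    assert (Ej1 : iv s1 vj = j) by (fr; auto).
    wsi; rewrite ?Ee, ?(en_d _ He1), ?(en_s _ He1), ?(en_n _ He1), ?(en_s _ He), ?(en_n _ He); try lia.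
    match goal with |- wp _ _ ?s2 _ => set (s2' := s2) end.
    assert (He2 : env s2') by (destruct He1; constructor; auto).
    destruct (yel_ok s2' j (Vr er) (e / d) He2 Ej1 Hj Logic.I eq_refl Hr) as [K1 V1].
    destruct (yel_ok s2' j (Vr et) (e mod d) He2 Ej1 Hj Logic.I eq_refl Ht) as [K2 V2].
    apply wp_rasg; [cbn [rok]; auto|]. cbn [reval]. rewrite V1, V2. cbn [reval_op].
    destruct (HL e Hee) as [S1 P1].
    apply wp_seq. eapply wp_mono; [apply (bsearch_ok m _ es)|]; unfold s2'; sc; try lia.
    { rewrite EK; auto. }
    intros s3 t3 (Ht3 & Hb3 & L1 & L2) F3. unfold s2' in *. sch F3.
    assert (He3 : env s3) by (eapply env_frame; [|exact F3|reflexivity|reflexivity]; destruct He1; constructor; auto).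
    assert (Ek3 : rv s3 rkap = rv s1 rkap) by (fr; auto).
    assert (Hb : iv s3 bl = rank d s (xs be) win j e).
    { unfold rank. rewrite (cnt_perm _ _ _ P1). rewrite EK in L1, L2. symmetry. apply cnt_sorted; auto. }
    ws. { rewrite (en_s _ He). lia. }
    rewrite Hb, Ek3, HI, (en_s _ He3). split; [lia|]. reflexivity.
  - intros s1 t HF HI _ Ht. split; [lia|auto].
Qed.

Lemma lookup_ok s0 : sorted_at (ra s0 KEY) 0 (iv s0 dm) -> iv s0 dm < 2 ^ eq -> iv s0 dm <= n ->
  wp m lookup s0 (fun s1 t => t <= 4 * eq + 12 /\
    ((iv s1 fnd = 1 /\ 1 <= iv s1 bl <= iv s0 dm /\ ra s0 KEY (iv s1 bl - 1) = rv s0 rkap) \/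
     (iv s1 fnd = 0 /\ forall i, i < iv s0 dm -> ra s0 KEY i <> rv s0 rkap))).
Proof.
  intros Hsrt Hq Hn. set (D := iv s0 dm) in *. set (k := rv s0 rkap). unfold lookup. ws.
  eapply wp_mono; [apply (bsearch_ok m _ eq)|]; sc; auto; try lia. fold D k.
  intros s1 t1 (Ht1 & Hb1 & L1 & L2) F1.
  assert (EK : ra s1 KEY = ra s0 KEY) by (fr; auto). assert (Er : rv s1 rkap = k) by (fr; auto).
  simpl in L1, L2.
  wif H.
  - wif H'; rewrite EK, Er in H'.
    + split; [lia|]. right. split; auto. intros i Hi E.
      destruct (Nat.lt_ge_cases i (iv s1 bl)).
      * pose proof (Hsrt i (iv s1 bl - 1) ltac:(lia)) as Q. simpl in Q. lra.
      * specialize (L2 i ltac:(lia)). lra.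
    + split; [lia|]. left. split; auto. split; [lia|].
      specialize (L1 (iv s1 bl - 1) ltac:(lia)). lra.
  - split; [lia|]. right. split; auto. intros i Hi E. specialize (L2 i ltac:(lia)). lra.
Qed.

Definition val (b a j r : nat) : R := (xs b a r - win j r)%R.

Definition tab_at (b : nat) (perm : nat -> nat) (p a j : nat) : Prop :=
  Permutation (seq 0 d) (seg perm p d) /\
  forall t t', t <= t' < d -> val b a j (perm (p + t)) <=r val b a j (perm (p + t')).

Definition tab_ok (b : nat) (perm : nat -> nat) (id j : nat) : Prop :=
  forall a, a < s -> tab_at b perm ((id * s + a) * d) a j.

Lemma seg_id b k : seg (fun i => i) b k = seq b k.
Proof. apply map_id. Qed.

Lemma new_table_ok s0 j c : env s0 -> iv s0 vbe = be -> be < nb -> iv s0 vj = j -> j < n ->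
  iv s0 nc = c -> c <= nb * Kc ->
  wp m new_table s0 (fun s1 t => t <= 40 * (s * (d * d)) + 2 /\ same_out s0 s1 n d /\
    (forall x, x < c * s * d -> ia s1 PERM x = ia s0 PERM x) /\ tab_ok be (ia s1 PERM) c j).
Proof.
  intros He Eb Hb Ej Hj Ec Hc. unfold new_table.
  assert (HcM : (c * s + s) * d < lM m).
  { eapply Nat.le_lt_trans; [|exact HM3]. apply Nat.mul_le_mono_r.
    replace (c * s + s) with ((c + 1) * s) by ring. apply Nat.mul_le_mono_r. lia. }
  apply wp_forc with (hi := s) (T := 11 * (d * d) + 12 * d + 10)
    (I := fun a s1 => same_out s0 s1 n d /\ (forall x, x < c * s * d -> ia s1 PERM x = ia s0 PERM x) /\
       forall a', a' < a -> tab_at be (ia s1 PERM) ((c * s + a') * d) a' j).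
  - reflexivity.
  - lia.
  - split; [intros x _; reflexivity|]. split; [auto|intros; lia].
  - intros s1 HF. sc. fr. rewrite (en_s _ He). auto.
  - intros a s1 Ha HF (Ho & HP & HT) Ea.
    assert (He1 : env s1) by (eapply env_frame; eauto).
    assert (Ec1 : iv s1 nc = c) by (fr; auto).
    wsi. rewrite (en_n _ He1).
    apply wp_forc with (hi := d) (T := 2)
      (I := fun t s2 => same_out s1 s2 n d /\ forall t', t' < t -> kp s2 (n + t') = (val be a j t', t')).
    + reflexivity.
    + lia.
    + split; [intros x _; reflexivity|intros; lia].
    + intros s2 HF2. sc. fr. rewrite (en_d _ He). auto.
    + intros t s2 Ht HF2 (Ho2 & HK) Et.
      assert (He2 : env s2) by (eapply env_frame; [|exact HF2|reflexivity|reflexivity]; destruct He1; constructor; auto).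
      assert (Eb2 : iv s2 vbe = be) by (fr; auto). assert (Ej2 : iv s2 vj = j) by (fr; auto).
      assert (Ea2 : iv s2 va = a) by (fr; auto). assert (Es2 : iv s2 sb = n) by (fr; auto).
      destruct (xel_ok s2 be a (Vr et) t He2 Eb2 Hb Ea2 Ha Logic.I Et Ht) as [K1 V1].
      destruct (yel_ok s2 j (Vr et) t He2 Ej2 Hj Logic.I Et Ht) as [K2 V2].
      apply wp_seq. apply wp_rsto.
      { split; [sc; rewrite Es2, Et; repeat split; lia|]. split; [cbn [rok]; auto|]. sc. rewrite Es2, Et. lia. }
      cbn [reval]. rewrite V1, V2. sc. rewrite Es2, Et.
      apply wp_isto; sc; rewrite Es2, Et; [repeat split; lia|].
      split; [lia|]. split.
      * intros x Hx. rewrite <- Ho2 by auto. unfold kp. sc. rewrite !upd_other by lia. auto.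
      * intros t' Ht'. unfold kp. sc. unfold upd. eqbs.
        -- replace t' with t by lia. reflexivity.
        -- apply HK. lia.
    + intros s2 t2 HF2 (Ho2 & HK) _ Ht2.
      assert (He2 : env s2) by (eapply env_frame; [|exact HF2|reflexivity|reflexivity]; destruct He1; constructor; auto).
      assert (Es2 : iv s2 sb = n) by (fr; auto).
      wsi. rewrite (en_d _ He2).
      eapply wp_mono; [apply isort_ok; sc; rewrite Es2; lia|]. sc. rewrite Es2.
      intros s3 t3 (Ht3 & Ho3 & Hp3 & Hs3) F3.
      assert (He3 : env s3) by (eapply env_frame; [|exact F3|reflexivity|reflexivity]; destruct He2; constructor; auto).
      assert (Es3 : iv s3 sb = n) by (fr; auto). assert (Ec3 : iv s3 nc = c) by (fr; auto).
      assert (Ea3 : iv s3 va = a) by (fr; auto).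
      assert (EP3 : ia s3 PERM = ia s1 PERM) by (fr; auto).
      assert (HH : forall t, t < d -> ra s3 KEY (n + t) = val be a j (ia s3 PAY (n + t)) /\ ia s3 PAY (n + t) < d).
      { intros t Ht. assert (Hin : In (kp s3 (n + t)) (seg (kp s3) n d)).
        { apply in_seg. exists (n + t). split; [lia|auto]. }
        apply (Permutation_in _ (Permutation_sym Hp3)) in Hin. apply in_seg in Hin as (i & Hi & E).
        specialize (HK (i - n) ltac:(lia)). replace (n + (i - n)) with i in HK by lia.
        change (kp (set_iv s2 sn d) i) with (kp s2 i) in E. rewrite HK in E.
        inversion E as [[E1 E2]]. split; auto; lia. }
      set (q := (c * s + a) * d) in *.
      assert (Hq : q + d <= (c * s + s) * d).
      { unfold q. replace ((c * s + a) * d + d) with ((c * s + a + 1) * d) by ring.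
        apply Nat.mul_le_mono_r. lia. }
      apply wp_forc with (hi := d) (T := 1)
        (I := fun t s4 => (forall t', t' < t -> ia s4 PERM (q + t') = ia s3 PAY (n + t')) /\
          forall x, x < q -> ia s4 PERM x = ia s3 PERM x).
      * reflexivity.
      * lia.
      * split; intros; [lia|reflexivity].
      * intros s4 HF4. sc. fr. rewrite (en_d _ He). auto.
      * intros t s4 Ht HF4 (HA & HB') Et.
        assert (He4 : env s4) by (eapply env_frame; eauto).
        assert (Es4 : iv s4 sb = n) by (fr; auto). assert (Ec4 : iv s4 nc = c) by (fr; auto).
        assert (Ea4 : iv s4 va = a) by (fr; auto).
        assert (EP4 : ia s4 PAY = ia s3 PAY) by (fr; auto).
        apply wp_isto; sc; rewrite ?Ec4, ?Ea4, ?Et, ?Es4, ?(en_d _ He4), ?(en_s _ He4); fold q.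
        { assert ((c * s + s) * 1 <= (c * s + s) * d) by (apply Nat.mul_le_mono_l; auto).
          repeat split; lia. }
        split; [lia|]. rewrite EP4. split.
        -- intros t' Ht'. unfold upd. eqbs; [|apply HA; lia]. f_equal; lia.
        -- intros x Hx. rewrite upd_other by lia. apply HB'; auto.
      * intros s4 t4 HF4 (HA & HB') _ Ht4.
        assert (EK4 : ra s4 KEY = ra s3 KEY) by (fr; auto). assert (EP4 : ia s4 PAY = ia s3 PAY) by (fr; auto).
        split; [lia|]. split; [|split].
        -- intros x Hx. unfold kp. sc. rewrite EK4, EP4. change (kp s3 x = kp s0 x).
           rewrite Ho3, <- Ho by auto. apply Ho2; auto.
        -- intros x Hx. sc. assert (c * s * d <= q) by (apply Nat.mul_le_mono_r; lia).
           rewrite HB' by lia. rewrite EP3. apply HP; auto.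
        -- intros a' Ha'. sc. destruct (Nat.eq_dec a' a) as [->|Hne].
           ++ fold q. split.
              ** rewrite seg_shift, (seg_ext _ (fun i => ia s3 PAY (n + i))) by (intros; apply HA; lia).
                 rewrite <- seg_shift.
                 apply (Permutation_map snd) in Hp3. unfold seg in Hp3. rewrite !map_map in Hp3.
                 change (map (fun x => snd (kp s3 x)) (seq n d)) with (seg (ia s3 PAY) n d) in Hp3.
                 rewrite <- Hp3.
                 change (map (fun x => snd (kp (set_iv s2 sn d) x)) (seq n d)) with (seg (ia s2 PAY) n d).
                 rewrite seg_shift, (seg_ext _ (fun i => i)); [rewrite seg_id; auto|].
                 intros i Hi. specialize (HK i ltac:(lia)). inversion HK; auto.
              ** intros t t' Htt. rewrite !HA by lia. destruct (HH t) as [<- _]; [lia|].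
                 destruct (HH t') as [<- _]; [lia|]. apply Hs3; auto.
           ++ assert (Hqa : (c * s + a') * d + d <= q).
              { unfold q. replace ((c * s + a') * d + d) with ((c * s + a' + 1) * d) by ring.
                apply Nat.mul_le_mono_r. lia. }
              destruct (HT a' ltac:(lia)) as [T1 T2]. split.
              ** rewrite (seg_ext _ (ia s1 PERM)); [auto|]. intros i Hi. rewrite HB', EP3 by lia. auto.
              ** intros t t' Htt. rewrite !HB', EP3 by lia. apply T2; auto.
  - intros s1 t HF (Ho & HP & HT) _ Ht. split; [|auto].
    assert (s * (11 * (d * d) + 12 * d + 10 + 2) <= s * (40 * (d * d)))
      by (apply Nat.mul_le_mono_l; pose proof (le_mul1 d d Hd); lia).
    lia.
Qed.

Lemma insert_key_ok s0 : iv s0 dm + 2 < lM m -> iv s0 nc + 2 < lM m ->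
  wp m insert_key s0 (fun s1 t => t <= 11 * ((iv s0 dm + 1) * (iv s0 dm + 1)) + 5 * iv s0 dm + 13 /\
    iv s1 dm = iv s0 dm + 1 /\ iv s1 nc = iv s0 nc + 1 /\
    same_out s0 s1 0 (iv s0 dm + 1) /\ sorted_at (ra s1 KEY) 0 (iv s0 dm + 1) /\
    Permutation ((rv s0 rkap, iv s0 nc) :: seg (kp s0) 0 (iv s0 dm)) (seg (kp s1) 0 (iv s0 dm + 1))).
Proof.
  intros HD Hc. set (D := iv s0 dm) in *. set (c := iv s0 nc) in *. unfold insert_key. ws.
  eapply wp_mono; [apply isort_ok; sc; lia|]. sc. fold D.
  intros s1 t1 (Ht1 & Ho1 & Hp1 & Hs1) F1. split; [lia|].
  split; [fr; auto|]. split; [fr; auto|]. split; [|split; auto].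
  - intros x Hx. rewrite Ho1 by auto. unfold kp. sc. fold D. rewrite !upd_other by lia. auto.
  - rewrite <- Hp1. replace (D + 1) with (S D) by lia.
    match goal with |- Permutation _ (seg (kp ?S) _ _) =>
      assert (E1 : seg (kp S) 0 D = seg (kp s0) 0 D);
      [apply seg_ext; intros i Hi; unfold kp; sc; fold D; rewrite !upd_other by lia; auto|];
      assert (E2 : kp S D = (rv s0 rkap, c));
      [unfold kp; sc; fold D; rewrite !upd_same; auto|]
    end.
    rewrite seg_S, E1. simpl (0 + D). rewrite E2. apply Permutation_cons_append.
Qed.

Notation K_ j := (kap d s (xs be) win j (d * d)).

Definition tabulated (b' j' : nat) (s1 : st) : Prop :=
  ia s1 CELL (b' * n + j') < iv s1 nc /\
  tab_ok b' (ia s1 PERM) (ia s1 CELL (b' * n + j')) j'.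

Definition visited (j b' j' : nat) : Prop := j' < n /\ (b' < be \/ b' = be /\ j' < j).

(** [wi_src] traces each dictionary entry to an earlier window, whose table a later window with the
    same signature can share. Together with [wi_nodup] it bounds the size of the dictionary by the
    number of cells. *)
Record win_inv (c0 j : nat) (s1 : st) : Prop := {
  wi_env : env s1;
  wi_b : iv s1 vbe = be;
  wi_lists : lists_ok be (ra s1 KEY);
  wi_sorted : sorted_at (ra s1 KEY) 0 (iv s1 dm);
  wi_nodup : NoDup (seg (ra s1 KEY) 0 (iv s1 dm));
  wi_src : forall i, i < iv s1 dm -> exists j', j' < j /\ kp s1 i = (K_ j', ia s1 CELL (be * n + j'));
  wi_tab : forall b' j', visited j b' j' -> tabulated b' j' s1;
  wi_nc : iv s1 nc = c0 + iv s1 dm;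
  wi_dm : iv s1 dm <= j }.

Lemma dict_small c0 j s1 : win_inv c0 j s1 -> iv s1 dm <= Kc.
Proof.
  intros H. assert (Hjs : exists js, map (fun j' => K_ j') js = seg (ra s1 KEY) 0 (iv s1 dm)).
  { pose proof (wi_src _ _ _ H) as Hsrc. revert Hsrc. generalize (iv s1 dm) as D.
    induction D as [|D IH]; intros Hsrc; [exists []; auto|].
    destruct IH as (js & E); [intros; apply Hsrc; lia|].
    destruct (Hsrc D ltac:(lia)) as (j' & _ & E'). exists (js ++ [j']).
    rewrite map_app, E, seg_S. simpl. f_equal. f_equal. inversion E'; auto. }
  destruct Hjs as (js & E). rewrite <- (seg_length (ra s1 KEY) 0 (iv s1 dm)), <- E, length_map.
  apply (kap_count d s (xs be) win). rewrite E. apply (wi_nodup _ _ _ H).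
Qed.

Lemma tab_ok_ext b' perm perm' id j : (forall x, x < (id + 1) * s * d -> perm' x = perm x) ->
  tab_ok b' perm id j -> tab_ok b' perm' id j.
Proof.
  intros H HT a Ha. destruct (HT a Ha) as [T1 T2].
  assert (Hq : (id * s + a) * d + d <= (id + 1) * s * d).
  { replace ((id * s + a) * d + d) with ((id * s + a + 1) * d) by ring.
    apply Nat.mul_le_mono_r. lia. }
  split.
  - rewrite (seg_ext perm' perm); auto. intros; apply H; lia.
  - intros t t' Ht. rewrite !H by lia. auto.
Qed.

Lemma tab_ok_same perm id j j' : K_ j = K_ j' -> tab_ok be perm id j -> tab_ok be perm id j'.
Proof.
  intros HK HT a Ha. destruct (HT a Ha) as [T1 T2]. split; auto.
  assert (Hp : forall t, t < d -> perm ((id * s + a) * d + t) < d).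
  { intros t Ht. assert (Hin : In (perm ((id * s + a) * d + t)) (seq 0 d)).
    { apply (Permutation_in _ (Permutation_sym T1)). apply in_seg. eexists; split; [|reflexivity]. lia. }
    apply in_seq in Hin. lia. }
  intros t t' Ht. unfold val. eapply (kap_order d s (xs be) win j j'); auto; try (apply Hp; lia).
  apply T2; auto.
Qed.

Lemma lists_ok_ext K K' : (forall x, 2 * n <= x -> K' x = K x) -> lists_ok be K -> lists_ok be K'.
Proof.
  intros H HL e He. destruct (HL e He) as [S1 P1]. split.
  - intros i j Hij. rewrite !H by lia. apply S1; auto.
  - rewrite P1, (seg_ext K' K); auto. intros; apply H; lia.
Qed.

(** [Tw] is charged to every window, [Tn] only to a window with a new signature. Their number is the
    growth of [dm], so [dm] times [Tn] serves as the potential of the amortised analysis. *)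
Definition Tw : nat := d * d * (4 * es + 11) + 4 * eq + 30.
Definition Tn : nat := 40 * (s * (d * d)) + 11 * ((Kc + 1) * (Kc + 1)) + 5 * Kc + 30.

Lemma window_step_ok c0 j s0 : win_inv c0 j s0 -> be < nb -> c0 <= be * Kc -> iv s0 vj = j -> j < n ->
  wp m window_step s0 (fun s1 t => t + iv s0 dm * Tn <= Tw + iv s1 dm * Tn /\
    win_inv c0 (S j) (set_iv s1 vj (S j))).
Proof.
  intros HW Hb Hc0 Ej Hj. pose proof (dict_small _ _ _ HW) as HDK.
  assert (HcM : c0 + Kc <= nb * Kc).
  { transitivity ((be + 1) * Kc); [lia|]. apply Nat.mul_le_mono_r. lia. }
  assert (HnM : nb * Kc + 3 < lM m).
  { pose proof (le_mul1 (nb * Kc + 4) s Hs). pose proof (le_mul1 ((nb * Kc + 4) * s) d Hd). lia. }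
  assert (HbnM : be * n + n <= nb * n).
  { transitivity ((be + 1) * n); [lia|]. apply Nat.mul_le_mono_r. lia. }
  destruct HW as [He Eb HL HS HN Hsrc HT Hnc Hdm].
  set (D := iv s0 dm) in *. unfold window_step. apply wp_seq.
  eapply wp_mono; [apply (signature_ok s0 j); auto|].
  intros s1 t1 (Ht1 & Hk1) F1. apply wp_seq.
  assert (He1 : env s1) by (eapply env_frame; eauto).
  assert (EK1 : ra s1 KEY = ra s0 KEY) by (fr; auto). assert (EP1 : ia s1 PAY = ia s0 PAY) by (fr; auto).
  assert (ED1 : iv s1 dm = D) by (fr; auto).
  eapply wp_mono; [apply lookup_ok; rewrite ?EK1, ?ED1; auto; lia|].
  rewrite EK1, ED1, Hk1. intros s2 t2 (Ht2 & Hcase) F2.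
  assert (He2 : env s2) by (eapply env_frame; eauto).
  assert (EK2 : ra s2 KEY = ra s0 KEY) by (fr; auto). assert (EP2 : ia s2 PAY = ia s0 PAY) by (fr; auto).
  assert (EQ2 : ia s2 PERM = ia s0 PERM) by (fr; auto). assert (EC2 : ia s2 CELL = ia s0 CELL) by (fr; auto).
  assert (ED2 : iv s2 dm = D) by (fr; auto). assert (Enc2 : iv s2 nc = iv s0 nc) by (fr; auto).
  assert (Ej2 : iv s2 vj = j) by (fr; auto). assert (Eb2 : iv s2 vbe = be) by (fr; auto).
  assert (Ek2 : rv s2 rkap = K_ j) by (fr; auto).
  assert (Hidx : forall b' j', j' < n -> b' < be \/ b' = be /\ j' < j -> b' * n + j' <> be * n + j).
  { intros b' j' Hj' [Hb'|[-> Hb']]; [|lia].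
    assert ((b' + 1) * n <= be * n) by (apply Nat.mul_le_mono_r; lia). lia. }
  assert (Hvis : forall b' j', visited (S j) b' j' -> visited j b' j' \/ b' = be /\ j' = j).
  { intros b' j' [Hj' [Hb'|[-> Hb']]]; unfold visited; [left; auto|].
    destruct (Nat.eq_dec j' j); [right; auto|left; split; auto; right; lia]. }
  apply wp_ifi; [oks| |]; sc; intros Hf; destruct Hcase as [(Hf1 & Hbl & HKey)|(Hf0 & Hnew)]; try lia.
  (* A hit: the key found is the signature of an earlier window j1, and the table of j1 is
     reused. *)
  - destruct (Hsrc (iv s2 bl - 1)) as (j1 & Hj1 & E1); [lia|].
    assert (E1K : ra s0 KEY (iv s2 bl - 1) = K_ j1) by (inversion E1; auto).
    assert (E1P : ia s0 PAY (iv s2 bl - 1) = ia s0 CELL (be * n + j1)) by (inversion E1; auto).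
    apply wp_isto; sc; rewrite Eb2, Ej2, ?EP2, ?(en_n _ He2).
    { repeat split; lia. }
    rewrite ED2. split; [unfold Tw; lia|]. rewrite E1P.
    constructor; sc; rewrite ?ED2, ?EK2, ?EQ2, ?Enc2; auto.
    + destruct He2; constructor; auto.
    + intros i Hi. destruct (Hsrc i Hi) as (j' & Hj' & E'). exists j'. split; [lia|].
      rewrite upd_other by lia. unfold kp. sc. rewrite EC2, EK2, EP2. exact E'.
    + intros b' j' Hv. unfold tabulated. sc. rewrite EC2, EQ2, Enc2.
      destruct (Hvis _ _ Hv) as [Hv'|[-> ->]].
      * rewrite upd_other by (destruct Hv'; auto). apply HT; auto.
      * rewrite upd_same. destruct (HT be j1) as [A1 A2]; [split; [lia|right; auto]|].
        split; auto. apply tab_ok_same with j1; auto. congruence.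
  - apply wp_seq. apply wp_isto; sc; rewrite Eb2, Ej2, ?(en_n _ He2).
    { repeat split; lia. }
    match goal with |- wp _ _ ?S _ => set (s3 := S) end.
    assert (He3 : env s3) by (destruct He2; constructor; auto).
    apply wp_seq. eapply wp_mono; [apply (new_table_ok s3 j (iv s0 nc)); auto; lia|].
    intros s4 t4 (Ht4 & Ho4 & HP4 & HT4) F4.
    assert (ED4 : iv s4 dm = D) by (fr; unfold s3; sc; auto).
    assert (Enc4 : iv s4 nc = iv s0 nc) by (fr; unfold s3; sc; auto).
    assert (Ek4 : rv s4 rkap = K_ j) by (fr; unfold s3; sc; auto).
    assert (EC4 : ia s4 CELL = upd (ia s0 CELL) (be * n + j) (iv s0 nc)).
    { fr. unfold s3. sc. rewrite EC2, Enc2; auto. }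
    assert (Eb4 : iv s4 vbe = be) by (fr; unfold s3; sc; auto).
    assert (He4 : env s4) by (eapply env_frame; eauto).
    eapply wp_mono; [apply insert_key_ok; lia|]. rewrite ED4, Enc4, Ek4.
    intros s5 t5 (Ht5 & ED5 & Enc5 & Ho5 & Hs5 & Hp5) F5.
    assert (He5 : env s5) by (eapply env_frame; eauto).
    assert (EC5 : ia s5 CELL = ia s4 CELL) by (fr; auto).
    assert (EP5 : ia s5 PERM = ia s4 PERM) by (fr; auto).
    assert (Eb5 : iv s5 vbe = be) by (fr; unfold s3; sc; auto).
    assert (Hkp4 : forall x, x < n -> kp s4 x = kp s0 x).
    { intros x Hx. rewrite Ho4 by lia. unfold kp, s3; sc. rewrite EK2, EP2. auto. }
    rewrite (seg_ext (kp s4) (kp s0)) in Hp5 by (intros; apply Hkp4; lia).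
    assert (HW5 : win_inv c0 (S j) (set_iv s5 vj (S j))).
    { constructor; sc; rewrite ?ED5, ?Enc5; auto.
      - destruct He5; constructor; auto.
      - apply lists_ok_ext with (ra s0 KEY); auto. intros x Hx.
        pose proof (Ho5 x ltac:(lia)) as Q. pose proof (Ho4 x ltac:(lia)) as Q'.
        inversion Q as [[Q1 Q2]]. inversion Q' as [[Q3 Q4]]. rewrite Q1, Q3. unfold s3. sc. rewrite EK2. auto.
      - apply (Permutation_map fst) in Hp5. cbn [map fst] in Hp5. rewrite !kp_fst in Hp5.
        apply (Permutation_NoDup Hp5). constructor; auto. intros Hin.
        apply in_seg in Hin as (i & Hi & E). apply (Hnew i); auto; lia.
      - intros i Hi. assert (Hin : In (kp s5 i) (seg (kp s5) 0 (D + 1))).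
        { apply in_seg. exists i. split; auto. lia. }
        apply (Permutation_in _ (Permutation_sym Hp5)) in Hin. destruct Hin as [E|Hin].
        + exists j. split; [lia|]. rewrite EC5, EC4, upd_same. change (kp s5 i = (K_ j, iv s0 nc)). auto.
        + apply in_seg in Hin as (i' & Hi' & E). destruct (Hsrc i' ltac:(lia)) as (j' & Hj' & E').
          exists j'. split; [lia|]. rewrite EC5, EC4, upd_other by lia.
          change (kp s5 i = (K_ j', ia s0 CELL (be * n + j'))). congruence.
      - intros b' j' Hv. unfold tabulated. sc. rewrite EC5, EC4, EP5, Enc5.
        destruct (Hvis _ _ Hv) as [Hv'|[-> ->]].
        + rewrite upd_other by (destruct Hv'; auto). destruct (HT _ _ Hv') as [A1 A2].
          split; [lia|]. apply tab_ok_ext with (ia s0 PERM); auto. intros x Hx.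
          rewrite HP4; [unfold s3; sc; rewrite EQ2; auto|].
          eapply Nat.lt_le_trans; [exact Hx|]. do 2 apply Nat.mul_le_mono_r. lia.
        + rewrite upd_same. split; [lia|auto].
      - lia.
      - lia. }
    split; auto. pose proof (dict_small _ _ _ HW5) as HDK5. sch HDK5. rewrite ED5 in HDK5 |- *.
    assert ((D + 1) * (D + 1) <= (Kc + 1) * (Kc + 1)) by (apply Nat.mul_le_mono; lia).
    unfold Tw, Tn. lia.
Qed.

Lemma batch_ok s0 : env s0 -> iv s0 vbe = be -> be < nb -> iv s0 nc <= be * Kc ->
  (forall b' j', b' < be -> j' < n -> tabulated b' j' s0) ->
  wp m batch s0 (fun s1 t => t <= 40 * (d * d * (s * s)) + n * (Tw + 2) + Kc * Tn + 10 /\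
    iv s1 nc <= (be + 1) * Kc /\
    forall b' j', b' < be + 1 -> j' < n -> tabulated b' j' s1).
Proof.
  intros He Eb Hb Hc HT. unfold batch. apply wp_seq.
  eapply wp_mono; [apply build_lists_ok; auto|]. intros s1 t1 (Ht1 & HL) F1.
  assert (He1 : env s1) by (eapply env_frame; eauto).
  ws. apply wp_for with (hi := n)
    (I := fun j s2 t => t <= j * (Tw + 2) + iv s2 dm * Tn /\ win_inv (iv s0 nc) j s2).
  - reflexivity.
  - lia.
  - split; [lia|]. constructor; sc; auto.
    + destruct He1; constructor; auto.
    + fr; auto.
    + intros i j' Hij. lia.
    + constructor.
    + intros; lia.
    + intros b' j' [Hj' [Hb'|[_ Hb']]]; [|lia].
      unfold tabulated. sc. fr. apply HT; auto.
    + fr. lia.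
  - intros s2 HF. sc. fr. rewrite (en_n _ He). auto.
  - intros j s2 t Hj HF [Ht HW] Ej.
    eapply wp_mono; [apply (window_step_ok (iv s0 nc) j s2); auto|].
    intros s3 t3 [Ht3 HW3] _. split; auto. sc. lia.
  - intros s2 t HF [Ht HW] _. pose proof (dict_small _ _ _ HW) as HD.
    assert (iv s2 dm * Tn <= Kc * Tn) by (apply Nat.mul_le_mono_r; auto).
    split; [lia|]. split; [rewrite (wi_nc _ _ _ HW); lia|].
    intros b' j' Hb' Hj'. apply (wi_tab _ _ _ HW). split; auto. lia.
Qed.

End Batch.

Section Build.
Variables (m : lim) (n d s nb es eq : nat) (X Y : nat -> R).
Hypothesis Hd : 1 <= d.
Hypothesis Hdn : d <= n.
Hypothesis Hs : 1 <= s.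
Hypothesis Hes : s < 2 ^ es.
Hypothesis Heq : Kc d s < 2 ^ eq.
Hypothesis HM1 : nb * s * d + 4 * n + (d * d) * s + s + s + 10 < lM m.
Hypothesis HM2 : nb * n < lM m.
Hypothesis HM3 : (nb * Kc d s + 4) * s * d < lM m.

Lemma build_ok s0 : env n d s nb X Y s0 ->
  wp m build s0 (fun s1 t =>
    t <= nb * (40 * (d * d * (s * s)) + n * (Tw d es eq + 2) + Kc d s * Tn d s + 12) + 3 /\
    iv s1 nc <= nb * Kc d s /\
    forall b' j', b' < nb -> j' < n -> tabulated n d s X Y b' j' s1).
Proof.
  intros He. unfold build. ws.
  assert (nb < lM m).
  { destruct n; [lia|]. nia. }
  apply wp_forc with (hi := nb) (T := 40 * (d * d * (s * s)) + n * (Tw d es eq + 2) + Kc d s * Tn d s + 10)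
    (I := fun be s1 => iv s1 nc <= be * Kc d s /\
       forall b' j', b' < be -> j' < n -> tabulated n d s X Y b' j' s1).
  - reflexivity.
  - auto.
  - sc. split; [lia|]. intros; lia.
  - intros s1 HF. sc. fr. rewrite (en_nb _ _ _ _ _ _ _ He). auto.
  - intros be s1 Hb HF [Hc HT] Eb.
    assert (He1 : env n d s nb X Y s1)
      by (eapply env_frame; [|exact HF|reflexivity|reflexivity]; destruct He; constructor; auto).
    eapply wp_mono; [apply (batch_ok m n d s nb be es eq X Y); auto|].
    intros s2 t2 (Ht2 & Hc2 & HT2) _. split; [exact Ht2|]. sc.
    split; [lia|]. intros b' j' Hb' Hj'. apply HT2; auto. lia.
  - intros s1 t HF [Hc HT] _ Ht. split; [lia|]. auto.
Qed.

End Build.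

(** * The whole algorithm *)

Notation vh := 25 (only parsing).
Notation lx := 46 (only parsing).
Notation ll := 47 (only parsing).
Notation lp := 48 (only parsing).
Notation vl2 := 50 (only parsing).
Notation vl3 := 51 (only parsing).

Notation racc := 5 (only parsing).

Definition log2c : cmd := (
  lp <-i Cn 1 ;; ll <-i Cn 0 ;;
  While (CLt (Cn 2 * Vr lp) (Vr lx + Cn 1)) (lp <-i Cn 2 * Vr lp ;; ll <-i Vr ll + Cn 1))%cmd.

Definition params : cmd := (
  lx <-i Vr vn ;; log2c ;;
  lx <-i Vr ll ;; log2c ;; vl2 <-i Vr ll ;;
  lx <-i Vr ll ;; log2c ;; vl3 <-i Vr ll ;;
  vh <-i Vr vl2 - (Vr vl3 + Cn 7) ;;
  vd <-i Cn 1 ;; For wi (Vr vh) (vd <-i Cn 2 * Vr vd) ;;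
  vs <-i Vr vd * Vr vd ;;
  vnb <-i Vr vn / (Vr vd * Vr vs) + Cn 1)%cmd.

(** [racc] becomes some A with x_j^2 + y_j^2 + 2 <= A for all j. Since 2|u| <= u^2 + 1, all entries
    are at most A/2 in absolute value. Genuine terms are thus at most A, while those with the
    padding value -2A are at least 3A/2. The first 16 entries of x are already in [XA]. *)
Definition load : cmd := (
  For wi (Vr vn) (If (CLt (Vr wi) (Cn 16)) Skip (RSto XA (Vr wi) (RAr RAW (Vr wi)))) ;;
  For wi (Vr vn) (RSto YA (Vr vd + Vr wi) (RAr RAW (Vr vn + Vr wi))) ;;
  racc <-r RCn 1 ;;
  For wi (Vr vn) (
    racc <-r RVr racc + (RAr XA (Vr wi) * RAr XA (Vr wi) + RCn 1) +
       (RAr YA (Vr vd + Vr wi) * RAr YA (Vr vd + Vr wi) + RCn 1)) ;;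
  For wi (Vr vd) (RSto YA (Vr wi) (RCn 0 - (RVr racc + RVr racc))))%cmd.

(** Block fb belongs to batch fb / s and faces the window ending at k - fb d. The rank k / 2 is that
    of the lower median of the k + 1 terms. *)
Definition answer : cmd := (
  bk <-i Vr vk / Vr vd + Cn 1 ;;
  For fb (Vr bk)
    (ISto PT (Vr fb)
      ((Ar CELL ((Vr fb / Vr vs) * Vr vn + (Vr vk - Vr fb * Vr vd)) * Vr vs + Vr fb mod Vr vs) * Vr vd)) ;;
  rr <-i Vr vk / Cn 2 ;;
  fj ;;
  RSto RAW (Cn 2 * Vr vn + Vr vk) (RVr rres))%cmd.

Definition main : cmd := (params ;; load ;; build ;; For vk (Vr vn) answer)%cmd.

Lemma log2c_ok m s0 : 1 <= iv s0 lx -> 2 * iv s0 lx + 3 < lM m ->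
  wp m log2c s0 (fun s t => t <= 3 * iv s0 lx + 3 /\ iv s ll = Nat.log2 (iv s0 lx)).
Proof.
  set (N := iv s0 lx). intros HN HM. unfold log2c. ws.
  apply wp_while with (f := fun s => N - iv s lp)
    (I := fun s t => t <= 3 * iv s ll /\ iv s lp = 2 ^ iv s ll /\ iv s lp <= N /\ iv s ll < iv s lp).
  - sc. simpl. lia.
  - intros s t HF (Ht & Hp & Hl & Hlt). assert (iv s lx = N) by (fr; auto). oks.
  - intros s t HF (Ht & Hp & Hl & Hlt) Hc. assert (Ex : iv s lx = N) by (fr; auto). sch Hc.
    ws. replace (iv s ll + 1) with (S (iv s ll)) by lia. cbn [Nat.pow]. lia.
  - intros s t HF (Ht & Hp & Hl & Hlt) Hc. assert (Ex : iv s lx = N) by (fr; auto). sch Hc.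
    split; [lia|]. symmetry. apply Nat.log2_unique; [lia|]. rewrite <- Hp. split; [auto|].
    cbn [Nat.pow]. lia.
Qed.

(* With d = 2^h, sc_h makes d about lg n / lg lg n up to a constant, and sc_d makes the number of
   cells small. *)
Record scale (n h : nat) : Prop := {
  sc_n : 1000 <= n;
  sc_h : Nat.log2 (Nat.log2 n) = h + (Nat.log2 (Nat.log2 (Nat.log2 n)) + 7);
  sc_h1 : 1 <= h;
  sc_d : 20 * (h * 2 ^ h) <= Nat.log2 n }.

Lemma params_ok m s0 n h : scale n h -> iv s0 vn = n -> 4 * n + 100 < lM m ->
  wp m params s0 (fun s t => t <= 30 * n /\ iv s vd = 2 ^ h /\ iv s vs = 2 ^ h * 2 ^ h /\
    iv s vnb = n / (2 ^ h * (2 ^ h * 2 ^ h)) + 1).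
Proof.
  intros [Hn Hh Hh1 Hd] En HM. unfold params.
  assert (L1 : Nat.log2 n < n) by (apply Nat.log2_lt_lin; lia).
  assert (L2 : Nat.log2 (Nat.log2 n) <= Nat.log2 n) by (apply Nat.log2_le_lin; lia).
  assert (L3 : Nat.log2 (Nat.log2 (Nat.log2 n)) <= Nat.log2 (Nat.log2 n)) by (apply Nat.log2_le_lin; lia).
  assert (L4 : 1 <= Nat.log2 n) by (destruct (Nat.log2 n); [simpl in *; lia|lia]).
  assert (Hdn : 2 ^ h <= Nat.log2 n).
  { destruct h; [lia|]. nia. }
  assert (H2h : 1 <= 2 ^ h) by (pose proof (Nat.pow_nonzero 2 h); lia).
  assert (H3h : 2 ^ h * (2 ^ h * 2 ^ h) <= n).
  { transitivity (2 ^ Nat.log2 n); [|apply Nat.log2_spec; lia].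
    rewrite <- !Nat.pow_add_r. apply Nat.pow_le_mono_r; [lia|]. nia. }
  ws. eapply wp_mono; [apply log2c_ok; sc; lia|]. sc. rewrite En. intros s1 t1 [Ht1 E1] F1.
  assert (En1 : iv s1 vn = n) by (fr; auto).
  ws. eapply wp_mono; [apply log2c_ok; sc; lia|]. sc. rewrite E1. intros s2 t2 [Ht2 E2] F2.
  assert (En2 : iv s2 vn = n) by (fr; auto).
  ws. eapply wp_mono; [apply log2c_ok; sc; lia|]. sc. rewrite E2. intros s3 t3 [Ht3 E3] F3.
  assert (En3 : iv s3 vn = n) by (fr; auto).
  assert (El2 : iv s3 vl2 = Nat.log2 (Nat.log2 n)) by (fr; auto).
  wsi. rewrite El2, E3.
  replace (Nat.log2 (Nat.log2 n) - (Nat.log2 (Nat.log2 (Nat.log2 n)) + 7)) with h by lia.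
  apply wp_forc with (hi := h) (T := 1) (I := fun i s => i <= h /\ iv s vd = 2 ^ i).
  - reflexivity.
  - lia.
  - split; [lia|reflexivity].
  - intros s HF. oks.
  - intros i s Hi HF [_ Hd'] Ei.
    assert (2 ^ (S i) <= 2 ^ h) by (apply Nat.pow_le_mono_r; lia). cbn [Nat.pow] in H.
    ws. split; [lia|]. split; [lia|]. cbn [Nat.pow]. lia.
  - intros s t HF [_ Hd'] _ Ht. assert (En4 : iv s vn = n) by (fr; auto).
    pose proof (le_mul1 (2 ^ h * 2 ^ h) (2 ^ h) H2h).
    assert (n / (2 ^ h * (2 ^ h * 2 ^ h)) <= n) by (apply Nat.Div0.div_le_upper_bound; nia).
    ws; rewrite ?Hd', ?En4, ?En; try lia.
Qed.

Record raw_ok (n : nat) (x y : list R) (s : st) : Prop := {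
  ro_x : forall i, 16 <= i < n -> ra s RAW i = nth i x 0%R;
  ro_y : forall j, j < n -> ra s RAW (n + j) = nth j y 0%R;
  ro_X : forall i, ra s XA i = if i <? 16 then nth i x 0%R else 0%R }.

(* The first d entries of the y-array are so small that the terms built from them exceed all
   genuine ones. *)
Record loaded (n d : nat) (x y : list R) (X Y : nat -> R) : Prop := {
  ld_x : forall i, X i = nth i x 0%R;
  ld_y : forall j, j < n -> Y (d + j) = nth j y 0%R;
  ld_pad : forall i i' j p, j < n -> p < d -> (X i' - Y (d + j)%nat < X i - Y p)%R }.

Lemma load_ok m s0 n d x y : lN m = n -> 16 <= n -> iv s0 vn = n -> iv s0 vd = d ->
  length x = n -> raw_ok n x y s0 -> n + n + d + 20 < lM m ->
  wp m load s0 (fun s t => t <= 12 * n + 3 * d + 12 /\ loaded n d x y (ra s XA) (ra s YA)).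
Proof.
  intros EN Hn En Ed Hx [Rx Ry RX] HM. unfold load. apply wp_seq.
  apply wp_forc with (hi := n) (T := 2) (I := fun i s => forall i',
    ra s XA i' = if i' <? Nat.max 16 i then nth i' x 0%R else 0%R).
  { reflexivity. } { lia. }
  { intros i'. sc. rewrite RX. reflexivity. }
  { intros s HF; oks. }
  { intros i s Hi HF HI Ei.
    assert (ER : ra s RAW = ra s0 RAW) by (fr; auto).
    apply wp_ifi; [oks| |]; sc; rewrite Ei; intros Hc.
    - ws. split; [lia|]. intros i'. rewrite HI.
      destruct (Nat.ltb_spec i' (Nat.max 16 i)), (Nat.ltb_spec i' (Nat.max 16 (S i))); auto; lia.
    - apply wp_rsto; sc; rewrite Ei; [repeat split; lia|]. split; [lia|]. intros i'. rewrite ER. unfold upd. rewrite HI.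
      destruct (Nat.eqb_spec i' i) as [->|].
      + rewrite Rx by lia. destruct (Nat.ltb_spec i (Nat.max 16 (S i))); auto; lia.
      + destruct (Nat.ltb_spec i' (Nat.max 16 i)), (Nat.ltb_spec i' (Nat.max 16 (S i))); auto; lia. }
  intros s1 t1 F1 HX _ Ht1.
  assert (HX1 : forall i, ra s1 XA i = nth i x 0%R).
  { intros i. rewrite HX. destruct (Nat.ltb_spec i (Nat.max 16 n)); auto. rewrite nth_overflow; auto. lia. }
  assert (En1 : iv s1 vn = n) by (fr; auto). assert (Ed1 : iv s1 vd = d) by (fr; auto).
  assert (ER1 : ra s1 RAW = ra s0 RAW) by (fr; auto).
  apply wp_seq. apply wp_forc with (hi := n) (T := 1) (I := fun i s => forall j, j < i -> ra s YA (d + j) = nth j y 0%R).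
  { reflexivity. } { lia. } { intros; lia. } { intros s HF; oks. }
  { intros i s Hi HF HI Ei.
    assert (E2 : iv s vn = n) by (fr; auto). assert (E3 : iv s vd = d) by (fr; auto).
    assert (E4 : ra s RAW = ra s0 RAW) by (fr; auto).
    apply wp_rsto; sc; rewrite ?Ei, ?E2, ?E3; [repeat split; lia|]. split; [lia|].
    intros j Hj. rewrite E4, Ry by auto. unfold upd. eqbs; [f_equal; lia|]. apply HI; lia. }
  intros s2 t2 F2 HY _ Ht2.
  assert (HX2 : forall i, ra s2 XA i = nth i x 0%R) by (intros; fr; auto).
  assert (En2 : iv s2 vn = n) by (fr; auto). assert (Ed2 : iv s2 vd = d) by (fr; auto).
  ws. apply wp_forc with (hi := n) (T := 1) (I := fun i s => (1 <= rv s racc)%R /\ forall j, j < i ->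
     (nth j x 0 * nth j x 0 + nth j y 0 * nth j y 0 + 2 <= rv s racc)%R).
  { reflexivity. } { lia. } { split; [sc; lra|intros; lia]. } { intros s HF; oks. }
  { intros i s Hi HF [HI1 HI2] Ei.
    assert (E2 : iv s vd = d) by (fr; auto).
    assert (E3 : ra s XA i = nth i x 0%R) by (fr; auto). assert (E4 : ra s YA (d + i) = nth i y 0%R) by (fr; auto).
    apply wp_rasg; sc; rewrite ?Ei, ?E2; [repeat split; lia|]. rewrite E3, E4. split; [lia|].
    pose proof (Rle_0_sqr (nth i x 0%R)) as Q1. pose proof (Rle_0_sqr (nth i y 0%R)) as Q2. unfold Rsqr in *.
    split; [lra|]. intros j Hj. destruct (Nat.eq_dec j i) as [->|]; [lra|]. specialize (HI2 j ltac:(lia)). lra. }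
  intros s3 t3 F3 [HA1 HA2] _ Ht3. set (A := rv s3 racc) in *.
  assert (HX3 : forall i, ra s3 XA i = nth i x 0%R) by (intros; fr; auto).
  assert (HY3 : forall j, j < n -> ra s3 YA (d + j) = nth j y 0%R) by (intros; fr; auto).
  assert (Ed3 : iv s3 vd = d) by (fr; auto).
  apply wp_forc with (hi := d) (T := 1) (I := fun i s => (forall j, j < n -> ra s YA (d + j) = nth j y 0%R) /\
    forall p, p < i -> ra s YA p = (0 - (A + A))%R).
  { reflexivity. } { lia. } { split; [auto|intros; lia]. } { intros s HF; oks. }
  { intros i s Hi HF [HI1 HI2] Ei. assert (E2 : rv s racc = A) by (fr; auto).
    ws. rewrite Ei, E2. split; [lia|]. split.
    - intros j Hj. rewrite upd_other by lia. auto.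
    - intros p Hp. unfold upd. eqbs; auto. apply HI2; lia. }
  intros s4 t4 F4 [HI1 HI2] _ Ht4. split; [lia|].
  assert (HX4 : forall i, ra s4 XA i = nth i x 0%R) by (intros; fr; auto).
  constructor; auto. intros i i' j p Hj Hp. rewrite !HX4, HI1, HI2 by auto.
  assert (B1 : forall i, (- A <= 2 * nth i x 0 <= A)%R).
  { intros i0. destruct (Nat.lt_ge_cases i0 n).
    - specialize (HA2 i0 H). set (u := nth i0 x 0%R) in *. set (v := nth i0 y 0%R) in *.
      pose proof (Rle_0_sqr (u - 1)). pose proof (Rle_0_sqr (u + 1)). pose proof (Rle_0_sqr v). unfold Rsqr in *. lra.
    - rewrite nth_overflow by lia. lra. }
  assert (B2 : (- A <= 2 * nth j y 0 <= A)%R).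
  { specialize (HA2 j Hj). set (u := nth j x 0%R) in *. set (v := nth j y 0%R) in *.
    pose proof (Rle_0_sqr (v - 1)). pose proof (Rle_0_sqr (v + 1)). pose proof (Rle_0_sqr u). unfold Rsqr in *. lra. }
  pose proof (B1 i). pose proof (B1 i'). lra.
Qed.

Lemma active_perm E d B f : (forall b, b < B -> Permutation (seg (E b) 0 d) (seg f (b * d) d)) ->
  Permutation (active E d (fun _ => 0) (fun _ => 1) B) (seg f 0 (B * d)).
Proof.
  induction B as [|B IH]; intros H; [constructor|]. cbn [active].
  replace (S B * d) with (B * d + d) by lia. rewrite seg_app.
  apply Permutation_app; [apply IH; intros; apply H; lia|].
  replace (0 * d) with 0 by lia. replace ((1 - 0) * d) with d by lia. apply H; lia.
Qed.

(** As k is less than the length of A, some entry of A is at least v. So v is below all of P, which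
    then adds nothing to either count. *)
Lemma rk_prefix A P k v : k < length A -> (forall a p, In a A -> In p P -> (a < p)%R) ->
  rk (A ++ P) k v -> rk A k v.
Proof.
  intros Hk H [H1 H2]. unfold rk. rewrite !cnt_app in *.
  assert (Hv : forall p, In p P -> (v < p)%R).
  { destruct (cnt_ex (ltb v) A) as (a & Ha & E); [lia|]. intros p Hp. specialize (H a p Ha Hp).
    destruct (ltb_spec v a); [discriminate|]. lra. }
  rewrite (cnt_none (leb v) P) in H2; [lia|].
  intros p Hp. specialize (Hv p Hp). destruct (leb_spec v p); auto; lra.
Qed.

Lemma rk_is_rank l k v : rk l k v -> is_rank l k v.
Proof.
  intros [H1 H2]. split; [|split; auto].
  destruct (in_dec Req_dec_T v l) as [|Hn]; auto. exfalso.
  assert (cnt (ltb v) l = cnt (leb v) l); [|lia].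
  apply cnt_ext. intros x Hx. destruct (ltb_spec v x), (leb_spec v x); auto; try lra.
  exfalso. apply Hn. replace v with x by lra. auto.
Qed.

Lemma div2_half k : Nat.div2 k = k / 2.
Proof. apply Nat.div2_div. Qed.

Section Answer.
Variables (m : lim) (n h nb : nat) (x y : list R) (X Y : nat -> R).
Notation d := (2 ^ h).
Notation s := (2 ^ h * 2 ^ h).
Hypothesis HnN : lN m = n.
Hypothesis Hn16 : 16 <= n.
Hypothesis Hx : length x = n.
Hypothesis HL : loaded n d x y X Y.
Hypothesis Hnb : n < nb * s * d.
Hypothesis HM0 : 100 * n + 20 * d + 600 < lM m.
Hypothesis HM2 : nb * n < lM m.
Hypothesis HM3 : (nb * Kc d s + 4) * s * d < lM m.
Hypothesis Hdn : d <= n.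

Record ready (s1 : st) : Prop := {
  rd_env : env n d s nb X Y s1;
  rd_nc : iv s1 nc <= nb * Kc d s;
  rd_tab : forall b' j', b' < nb -> j' < n -> tabulated n d s X Y b' j' s1 }.

Lemma answer_ok s0 k : ready s0 -> iv s0 vk = k -> k < n ->
  wp m answer s0 (fun s1 t => t <= 640 * 802 * ((n / d + 1) * (h + 1)) /\ ready s1 /\
    (forall i, i <> 2 * n + k -> ra s1 RAW i = ra s0 RAW i) /\
    is_median (conv_terms x y k) (ra s1 RAW (2 * n + k))).
Proof.
  intros [He Hnc HT] Ek Hk.
  assert (Hd1 : 1 <= d) by (pose proof (Nat.pow_nonzero 2 h); lia).
  assert (Hs1 : 1 <= s) by (apply (Nat.mul_le_mono 1 d 1 d); auto).
  pose proof (en_n _ _ _ _ _ _ _ He) as En. pose proof (en_d _ _ _ _ _ _ _ He) as Ed.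
  pose proof (en_s _ _ _ _ _ _ _ He) as Es.
  set (B := k / d + 1).
  pose proof (Nat.div_mod_eq k d) as Dk. pose proof (Nat.mod_upper_bound k d ltac:(lia)) as Mk.
  assert (HB1 : B <= k + 1).
  { unfold B. apply Nat.add_le_mono_r, Nat.Div0.div_le_upper_bound. rewrite Nat.mul_comm. apply le_mul1; auto. }
  assert (HBd : k < B * d <= k + d) by (unfold B; rewrite Nat.mul_add_distr_r, (Nat.mul_comm (k / d)); lia).
  assert (HBn : B <= n / d + 1) by (unfold B; apply Nat.add_le_mono_r, Nat.Div0.div_le_mono; lia).
  unfold answer. ws. { rewrite Ek, Ed. fold B. lia. }
  rewrite Ek, Ed. fold B.
  set (pt := fun b => (ia s0 CELL (b / s * n + (k - b * d)) * s + b mod s) * d).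
  assert (Hbk : forall b, b < B -> b * d <= k) by (intros b Hb; apply Nat.le_trans with (k / d * d);
    [apply Nat.mul_le_mono_r; unfold B in Hb; lia|rewrite Nat.mul_comm; lia]).
  assert (Hbs : forall b, b < B -> b / s < nb /\ b mod s < s /\ b = s * (b / s) + b mod s).
  { intros b Hb. split; [|split; [apply Nat.mod_upper_bound; lia|apply Nat.div_mod_eq]].
    apply Nat.Div0.div_lt_upper_bound. specialize (Hbk b Hb).
    apply Nat.mul_lt_mono_pos_r with d; [lia|]. lia. }
  assert (Hcell : forall b, b < B -> b / s * n + (k - b * d) < nb * n /\
     ia s0 CELL (b / s * n + (k - b * d)) < iv s0 nc /\
     tab_ok d s X Y (b / s) (ia s0 PERM) (ia s0 CELL (b / s * n + (k - b * d))) (k - b * d)).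
  { intros b Hb. destruct (Hbs b Hb) as (A1 & _ & _). split.
    - assert ((b / s + 1) * n <= nb * n) by (apply Nat.mul_le_mono_r; lia). lia.
    - apply HT; auto. lia. }
  assert (Hpt : forall b, b < B -> pt b + d <= (nb * Kc d s + 4) * s * d).
  { intros b Hb. destruct (Hbs b Hb) as (_ & A2 & _). destruct (Hcell b Hb) as (_ & A3 & _). unfold pt.
    set (c := ia s0 CELL (b / s * n + (k - b * d))) in *.
    replace ((c * s + b mod s) * d + d) with ((c * s + b mod s + 1) * d) by ring.
    apply Nat.mul_le_mono_r. transitivity ((c + 1) * s); [lia|]. apply Nat.mul_le_mono_r. lia. }
  apply wp_forc with (hi := B) (T := 1) (I := fun b s1 => forall b', b' < b -> ia s1 PT b' = pt b').
  { reflexivity. } { lia. } { intros; lia. } { intros s1 HF; oks. }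
  { intros b s1 Hb HF HI' Eb.
    assert (He1 : env n d s nb X Y s1)
      by (eapply env_frame; [|exact HF|reflexivity|reflexivity]; destruct He; constructor; auto).
    assert (Ek1 : iv s1 vk = k) by (fr; auto). assert (EC : ia s1 CELL = ia s0 CELL) by (fr; auto).
    destruct (Hbs b Hb) as (A1 & A2 & A3). destruct (Hcell b Hb) as (A4 & A5 & _).
    specialize (Hpt b Hb). unfold pt in Hpt.
    set (c := ia s0 CELL (b / s * n + (k - b * d))) in *.
    specialize (Hbk b Hb).
    apply wp_isto; sc; rewrite ?Eb, ?Ek1, ?EC, ?(en_n _ _ _ _ _ _ _ He1), ?(en_d _ _ _ _ _ _ _ He1), ?(en_s _ _ _ _ _ _ _ He1);
      fold c.
    - pose proof (le_mul1 (c * s + b mod s) d Hd1).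
      repeat split; try lia.
    - split; [lia|]. intros b' Hb'. unfold upd. eqbs; [subst b'; reflexivity|]. apply HI'; lia. }
  intros s1 t1 F1 HPT _ Ht1.
  assert (He1 : env n d s nb X Y s1)
      by (eapply env_frame; [|exact F1|reflexivity|reflexivity]; destruct He; constructor; auto).
  assert (Ek1 : iv s1 vk = k) by (fr; auto). assert (EP1 : ia s1 PERM = ia s0 PERM) by (fr; auto).
  assert (Eb1 : iv s1 bk = B) by (fr; auto).
  ws. rewrite Ek1.
  match goal with |- wp _ _ ?S _ => set (s2 := S) end.
  (* [f] continues the terms of the antidiagonal beyond k into the padding; block b is then a
     permutation of the segment of [f] from b d on. *)
  set (f := fun i => (X i - Y (k + d - i)%nat)%R).
  set (E := fun b t => f (b * d + ia s0 PERM (pt b + t)%nat)%nat).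
  assert (Htab : forall b, b < B -> Permutation (seq 0 d) (seg (ia s0 PERM) (pt b) d) /\
    forall t t', t <= t' < d -> E b t <=r E b t').
  { intros b Hb. destruct (Hcell b Hb) as (_ & _ & A). destruct (Hbs b Hb) as (_ & A2 & A3).
    destruct (A _ A2) as [T1 T2]. split; [exact T1|].
    intros t t' Htt. specialize (T2 t t' Htt). unfold val, xs, win in T2.
    rewrite (Nat.mul_comm (b / s) s), <- A3 in T2. unfold E, f, pt.
    specialize (Hbk b Hb).
    replace (k + d - (b * d + ia s0 PERM ((ia s0 CELL (b / s * n + (k - b * d)) * s + b mod s) * d + t)))
      with (d + (k - b * d) - ia s0 PERM ((ia s0 CELL (b / s * n + (k - b * d)) * s + b mod s) * d + t)) by lia.
    replace (k + d - (b * d + ia s0 PERM ((ia s0 CELL (b / s * n + (k - b * d)) * s + b mod s) * d + t')))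
      with (d + (k - b * d) - ia s0 PERM ((ia s0 CELL (b / s * n + (k - b * d)) * s + b mod s) * d + t')) by lia.
    exact T2. }
  assert (Hperm_lt : forall b t, b < B -> t < d -> ia s0 PERM (pt b + t) < d).
  { intros b t Hb Ht. destruct (Htab b Hb) as [T1 _].
    assert (Hin : In (ia s0 PERM (pt b + t)) (seq 0 d)).
    { apply (Permutation_in _ (Permutation_sym T1)). apply in_seg. exists (pt b + t). split; auto. lia. }
    apply in_seq in Hin. lia. }
  eapply wp_mono; [apply (fj_ok m B d E (k / 2)) with (h := h)|]; auto.
  { intros b i j Hb Hij. apply Htab; auto. }
  { unfold B; lia. }
  { lia. }
  { apply (en_d _ _ _ _ _ _ _ He1). }
  { assert (k / 2 <= k) by (apply Nat.Div0.div_le_upper_bound; lia). lia. }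
  { unfold s2. sc. rewrite EP1, (en_X _ _ _ _ _ _ _ He1), (en_Y _ _ _ _ _ _ _ He1), Ek1.
    constructor.
    - intros b t Hb Ht. rewrite HPT by auto. specialize (Hpt b Hb). split; [lia|]. split; auto.
    - intros b t Hb Ht. rewrite HPT by auto. reflexivity.
    - lia. }
  intros s3 t3 (Ht3 & Hrk) F3.
  assert (En3 : iv s3 vn = n) by (fr; unfold s2; sc; fr; auto).
  assert (Ek3 : iv s3 vk = k) by (fr; unfold s2; sc; fr; auto).
  apply wp_rsto; sc; rewrite En3, Ek3; [repeat split; lia|].
  split.
  { assert (B * (h + 1) <= (n / d + 1) * (h + 1)) by (apply Nat.mul_le_mono_r; auto).
    pose proof (le_mul1 (n / d + 1) (h + 1) ltac:(lia)). lia. }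
  split; [|split].
  - constructor; sc.
    + assert (env n d s nb X Y s3); [|destruct H; constructor; auto].
      eapply env_frame; [|exact F3|reflexivity|reflexivity]. unfold s2. destruct He1; constructor; auto.
    + fr. unfold s2. sc. fr. auto.
    + intros b' j' Hb' Hj'. unfold tabulated. sc. fr. unfold s2. sc. fr. apply HT; auto.
  - intros i Hi. rewrite upd_other by auto. fr. unfold s2. sc. fr. auto.
  - rewrite upd_same. unfold is_median. apply rk_is_rank.
    assert (Elen : length (conv_terms x y k) = S k) by (unfold conv_terms; rewrite length_map, length_seq; auto).
    rewrite Elen. replace (S k - 1) with k by lia. rewrite div2_half.
    apply (rk_perm _ (seg f 0 (B * d))) in Hrk.
    2:{ apply active_perm. intros b Hb. destruct (Htab b Hb) as [T1 _].
        rewrite seg_shift. change (seg (fun i => E b (0 + i)) 0 d) with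
          (seg (fun t => f (b * d + ia s0 PERM (pt b + t))) 0 d).
        rewrite (seg_shift f). rewrite (seg_shift (ia s0 PERM)) in T1.
        apply (Permutation_map (fun r => f (b * d + r))) in T1. rewrite seg_map in T1. symmetry. exact T1. }
    (* The first k + 1 terms are the genuine ones; the fewer than d others come from the padding. *)
    replace (B * d) with (S k + (B * d - S k)) in Hrk by lia. rewrite seg_app in Hrk.
    assert (EA : seg f 0 (S k) = conv_terms x y k).
    { unfold conv_terms, seg. apply map_ext_in. intros i Hi. apply in_seq in Hi. unfold f.
      rewrite (ld_x _ _ _ _ _ _ HL). replace (k + d - i) with (d + (k - i)) by lia.
      rewrite (ld_y _ _ _ _ _ _ HL) by lia. auto. }
    rewrite EA in Hrk. apply rk_prefix in Hrk; auto.
    + rewrite Elen. apply Nat.Div0.div_lt_upper_bound. lia.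
    + rewrite <- EA. intros a p Ha Hp. apply in_seg in Ha as (i & Hi & <-). apply in_seg in Hp as (i' & Hi' & <-).
      unfold f. replace (k + d - i) with (d + (k - i)) by lia. apply (ld_pad _ _ _ _ _ _ HL); lia.
Qed.

End Answer.

(** * Arithmetic of the parameters *)

Section Scale.
Variables (n h : nat).
Hypothesis Hsc : scale n h.
Notation d := (2 ^ h).
Notation s := (2 ^ h * 2 ^ h).
Notation nb := (n / (2 ^ h * (2 ^ h * 2 ^ h)) + 1).
Notation Q := (2 ^ (5 * (h * 2 ^ h))).

Lemma d_ge2 : 2 <= d.
Proof. change 2 with (2 ^ 1) at 1. apply Nat.pow_le_mono_r; [lia|apply (sc_h1 _ _ Hsc)]. Qed.

Lemma hd_ge : 2 * h <= h * d.
Proof. rewrite Nat.mul_comm. apply Nat.mul_le_mono_l, d_ge2. Qed.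

(** Four times the exponent 5 h d is the 20 h d that [sc_d] keeps below lg n: [Q] stands in for
    n^(1/4). *)
Lemma Q_small : Q * Q * (Q * Q) <= n.
Proof.
  pose proof (sc_n _ _ Hsc). transitivity (2 ^ Nat.log2 n); [|apply Nat.log2_spec; lia].
  rewrite <- !Nat.pow_add_r. apply Nat.pow_le_mono_r; [lia|]. pose proof (sc_d _ _ Hsc). lia.
Qed.

Lemma Q_ge1 : 1 <= Q.
Proof. pose proof (Nat.pow_nonzero 2 (5 * (h * d))). lia. Qed.

Lemma d6_Q : d * d * (s * s) <= Q.
Proof.
  rewrite <- !Nat.pow_add_r. apply Nat.pow_le_mono_r; [lia|]. pose proof hd_ge. lia.
Qed.

(** The 5 in the exponent: s d^2 + 1 = 2^(4h) + 1 <= 2^(5h), raised to the power d. *)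
Lemma Kc_Q : Kc d s <= Q.
Proof.
  unfold Kc. replace (5 * (h * d)) with (5 * h * d) by ring. rewrite Nat.pow_mul_r.
  apply Nat.pow_le_mono_l.
  transitivity (2 ^ (4 * h + 1)).
  - replace (s * (d * d)) with (2 ^ (4 * h)) by (rewrite <- !Nat.pow_add_r; f_equal; lia).
    rewrite Nat.add_1_r, (Nat.add_1_r (4 * h)). cbn [Nat.pow]. pose proof (Nat.pow_nonzero 2 (4 * h)). lia.
  - apply Nat.pow_le_mono_r; [lia|]. pose proof (sc_h1 _ _ Hsc). lia.
Qed.

Lemma Q_n : Q <= n.
Proof.
  pose proof Q_small as H. pose proof Q_ge1 as H1.
  assert (A : 1 <= Q * (Q * Q)) by (apply (Nat.mul_le_mono 1 Q 1 (Q * Q)); [|apply (Nat.mul_le_mono 1 Q 1 Q)]; auto).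
  pose proof (le_mul1 Q (Q * (Q * Q)) A). eapply Nat.le_trans; [exact H0|]. rewrite Nat.mul_assoc. exact H.
Qed.

Lemma ds_Q : d * s <= Q /\ s <= d * s /\ d <= s /\ s * (d * d) <= Q /\ s * s <= Q.
Proof.
  pose proof d6_Q as H. pose proof d_ge2 as H2.
  assert (A1 : d <= s) by (apply le_mul1; lia).
  assert (A2 : s <= d * s) by (rewrite (Nat.mul_comm d s); apply le_mul1; lia).
  assert (A3 : s * s <= d * d * (s * s)) by (rewrite (Nat.mul_comm (d * d) (s * s)); apply le_mul1; lia).
  assert (A4 : d * s <= s * s) by (apply Nat.mul_le_mono_r; auto).
  repeat split; auto; lia.
Qed.

Lemma nb_upper : nb * (d * s) <= 2 * n.
Proof.
  destruct ds_Q as (A & _). pose proof Q_n. pose proof d_ge2.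
  rewrite Nat.mul_add_distr_r. pose proof (Nat.Div0.mul_div_le n (d * s)). lia.
Qed.

Lemma nb_lower : n < nb * s * d.
Proof.
  pose proof d_ge2. assert (A : d * s <> 0) by (destruct ds_Q as (_ & A & B & _); lia).
  rewrite <- Nat.mul_assoc, (Nat.mul_comm s d), Nat.add_1_r, Nat.mul_comm.
  apply Nat.mul_succ_div_gt; auto.
Qed.

Lemma nb_n : nb <= 2 * n.
Proof.
  pose proof nb_upper. destruct ds_Q as (_ & A2 & A3 & _). pose proof d_ge2.
  pose proof (le_mul1 nb (d * s) ltac:(lia)). lia.
Qed.

(** The factor d keeps division out of the bound. A window costs O(s h), since it needs d^2 = s
    searches of O(h) steps, and nb d s <= 2n; the tables for new cells take only O(n) per batch. *)
Lemma build_time :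
  d * (nb * (40 * (d * d * (s * s)) + n * (Tw d (2 * h + 1) (5 * (h * d) + 1) + 2) + Kc d s * Tn d s + 12) + 3)
   <= 600 * (n * n * h).
Proof.
  pose proof Q_n as HQn. pose proof Q_small as HQ. pose proof Q_ge1 as HQ1. pose proof Kc_Q as HK.
  pose proof nb_upper as Hnb. pose proof d6_Q as H6. destruct ds_Q as (A1 & A2 & A3 & A4 & A5).
  pose proof d_ge2 as Hd. pose proof (sc_h1 _ _ Hsc) as Hh. pose proof (sc_n _ _ Hsc) as Hn.
  assert (B1 : Tw d (2 * h + 1) (5 * (h * d) + 1) + 2 <= 79 * (s * h)).
  { unfold Tw. assert (C1 : s <= s * h) by (apply le_mul1; auto).
    assert (C2 : h * d <= s * h) by (rewrite (Nat.mul_comm h); apply Nat.mul_le_mono_r; auto).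
    clear - C1 C2 A3 Hd. lia. }
  assert (B2 : Kc d s * Tn d s <= 119 * n).
  { assert (C1 : Tn d s <= 119 * (Q * Q)).
    { unfold Tn. pose proof (le_mul1 Q Q HQ1) as C2.
      assert (C3 : (Kc d s + 1) * (Kc d s + 1) <= (2 * Q) * (2 * Q)) by (apply Nat.mul_le_mono; lia).
      clear - C2 C3 A4 HK HQ1. lia. }
    transitivity (Q * (119 * (Q * Q))); [apply Nat.mul_le_mono; auto|].
    pose proof (le_mul1 (Q * Q * Q) Q HQ1) as C2. clear - C2 HQ. lia. }
  assert (B3 : n <= n * (s * h)) by (apply le_mul1, (Nat.mul_le_mono 1 s 1 h); [lia|auto]).
  set (I := 40 * (d * d * (s * s)) + n * (Tw d (2 * h + 1) (5 * (h * d) + 1) + 2) + Kc d s * Tn d s + 12).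
  assert (B4 : I <= 250 * (n * (s * h))).
  { unfold I. assert (C1 : n * (Tw d (2 * h + 1) (5 * (h * d) + 1) + 2) <= n * (79 * (s * h))) by (apply Nat.mul_le_mono_l; auto).
    clear - C1 B2 B3 HQn H6 Hn. lia. }
  assert (B5 : d * (nb * I) <= 500 * (n * n * h)).
  { transitivity (d * (nb * (250 * (n * (s * h))))); [do 2 apply Nat.mul_le_mono_l; auto|].
    replace (d * (nb * (250 * (n * (s * h))))) with (250 * (n * h) * (nb * (d * s))) by ring.
    transitivity (250 * (n * h) * (2 * n)); [apply Nat.mul_le_mono_l; auto|]. clear. lia. }
  assert (B6 : n <= n * n * h).
  { rewrite <- Nat.mul_assoc. apply le_mul1. apply (Nat.mul_le_mono 1 n 1 h); lia. }
  rewrite Nat.mul_add_distr_l. clear - B5 B6 A1 A2 A3 HQn. lia.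
Qed.

Definition answer_time : nat := 640 * 802 * ((n / d + 1) * (h + 1)).

Lemma answers_time : d * (n * (answer_time + 2) + 2) <= 640 * 3212 * (n * n * h).
Proof.
  pose proof Q_n as HQn. destruct ds_Q as (A1 & A2 & A3 & A4 & A5).
  pose proof d_ge2 as Hd. pose proof (sc_h1 _ _ Hsc) as Hh. pose proof (sc_n _ _ Hsc) as Hn.
  assert (B1 : d * (n / d + 1) <= 2 * n).
  { rewrite Nat.mul_add_distr_l. pose proof (Nat.Div0.mul_div_le n d). lia. }
  assert (B2 : d * (n / d + 1) * (h + 1) <= 2 * n * (2 * h)) by (apply Nat.mul_le_mono; [auto|lia]).
  assert (B3 : n * (d * (n / d + 1) * (h + 1)) <= n * (2 * n * (2 * h))) by (apply Nat.mul_le_mono_l; auto).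
  unfold answer_time. set (c := 640 * 802).
  replace (d * (n * (c * ((n / d + 1) * (h + 1)) + 2) + 2)) with
    (c * (n * (d * (n / d + 1) * (h + 1))) + 2 * (n * d) + 2 * d) by ring.
  unfold c.
  assert (B4 : n * d <= n * n) by (apply Nat.mul_le_mono_l; lia).
  assert (B5 : n * n <= n * n * h) by (apply le_mul1; auto).
  assert (B6 : d <= n * n) by (pose proof (le_mul1 n n ltac:(lia)); lia).
  clear - B3 B4 B5 B6. lia.
Qed.

End Scale.

(** The limit n^4 is generous, as the indices into [CELL] and [PERM] stay below 2 n^2 + 4 n; being
    polynomial, it still fits into words of O(lg n) bits. *)
Lemma main_ok n h x y s0 : let m := mkLim (n * n * n * n) n in
  scale n h -> length x = n -> iv s0 vn = n -> raw_ok n x y s0 ->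
  wp m main s0 (fun s t => 2 ^ h * t <= 640 * 3400 * (n * n * h) /\
    forall k, k < n -> is_median (conv_terms x y k) (ra s RAW (2 * n + k))).
Proof.
  intros m Hsc Hx En HR.
  pose proof (Q_n n h Hsc) as HQn. pose proof (Kc_Q n h Hsc) as HK. pose proof (nb_upper n h Hsc) as Hnb.
  pose proof (nb_lower n h Hsc) as Hnbl. pose proof (nb_n n h Hsc) as Hnbn.
  pose proof (build_time n h Hsc) as HTb. pose proof (answers_time n h Hsc) as HTa.
  destruct (ds_Q n h Hsc) as (A1 & A2 & A3 & A4 & A5). pose proof (d_ge2 n h Hsc) as Hd2.
  pose proof (sc_n _ _ Hsc) as Hn. pose proof (sc_h1 _ _ Hsc) as Hh.
  set (d := 2 ^ h) in *. set (s := d * d) in *. set (nb := n / (d * s) + 1) in *.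
  set (Q := 2 ^ (5 * (h * d))) in *.
  assert (HM : 1000 * (n * n) <= lM m /\ 1000 * n <= n * n).
  { unfold m; cbn [lM]. assert (1000 * n <= n * n) by (apply Nat.mul_le_mono_r; auto). split; auto.
    replace (n * n * n * n) with ((n * n) * (n * n)) by ring. apply Nat.mul_le_mono_r. lia. }
  destruct HM as [HM HM'].
  assert (HM1 : nb * s * d + 4 * n + (d * d) * s + s + s + 10 < lM m).
  { replace (nb * s * d) with (nb * (d * s)) by ring. fold s. lia. }
  assert (HM2 : nb * n < lM m).
  { assert (nb * n <= 2 * n * n) by (apply Nat.mul_le_mono_r; auto). lia. }
  assert (HM3 : (nb * Kc d s + 4) * s * d < lM m).
  { replace ((nb * Kc d s + 4) * s * d) with (nb * (d * s) * Kc d s + 4 * (d * s)) by ring.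
    assert (nb * (d * s) * Kc d s <= 2 * n * n) by (apply Nat.mul_le_mono; lia). lia. }
  assert (Hs : s < 2 ^ (2 * h + 1)).
  { unfold s, d. rewrite <- Nat.pow_add_r. apply Nat.pow_lt_mono_r; lia. }
  assert (HKq : Kc d s < 2 ^ (5 * (h * d) + 1)).
  { eapply Nat.le_lt_trans; [exact HK|]. apply Nat.pow_lt_mono_r; lia. }
  unfold main. apply wp_seq. eapply wp_mono; [apply (params_ok m s0 n h); auto; lia|].
  fold d s nb. intros s1 t1 (Ht1 & Ed & Es & Enb) F1.
  assert (En1 : iv s1 vn = n) by (fr; auto).
  assert (HR1 : raw_ok n x y s1).
  { destruct HR. constructor; intros; fr; auto. }
  apply wp_seq. eapply wp_mono; [apply (load_ok m s1 n d x y); auto; lia|].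
  intros s2 t2 (Ht2 & HL) F2.
  set (X := ra s2 XA) in *. set (Y := ra s2 YA) in *.
  assert (He2 : env n d s nb X Y s2) by (constructor; auto; fr; auto).
  apply wp_seq. eapply wp_mono; [apply (build_ok m n d s nb (2 * h + 1) (5 * (h * d) + 1) X Y); auto; lia|].
  intros s3 t3 (Ht3 & Hc3 & HT3) F3.
  assert (He3 : env n d s nb X Y s3) by (eapply env_frame; eauto).
  apply wp_forc with (hi := n) (T := answer_time n h)
    (I := fun i s' => ready n h nb X Y s' /\ forall k, k < i -> is_median (conv_terms x y k) (ra s' RAW (2 * n + k))).
  - reflexivity.
  - lia.
  - split; [|intros; lia]. constructor; auto. destruct He3; constructor; auto.
  - intros s' HF. sc. fr. rewrite En; auto.
  - intros k s4 Hk HF [Hrd Hmed] Ek.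
    eapply wp_mono; [apply (answer_ok m n h nb x y X Y) with (k := k); auto; fold d s; lia|].
    intros s5 t5 (Ht5 & Hrd5 & Hsame & Hk5) _. split; [exact Ht5|]. split.
    + destruct Hrd5 as [[] ? ?]; constructor; auto. constructor; auto.
    + intros k' Hk'. sc. destruct (Nat.eq_dec k' k) as [->|]; auto.
      rewrite Hsame by lia. apply Hmed. lia.
  - intros s4 t4 HF [Hrd Hmed] _ Ht4. split; [|exact Hmed].
    assert (B1 : n * d <= n * n) by (apply Nat.mul_le_mono_l; lia).
    assert (B2 : n * n <= n * n * h) by (apply le_mul1; auto).
    assert (C1 : d * t3 <= 600 * (n * n * h)).
    { etransitivity; [|exact HTb]. apply Nat.mul_le_mono_l; auto. }
    assert (C2 : d * t4 <= 640 * 3212 * (n * n * h)).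
    { etransitivity; [|exact HTa]. apply Nat.mul_le_mono_l; auto. }
    assert (C3 : d * (t1 + t2) <= d * (60 * n)) by (apply Nat.mul_le_mono_l; lia).
    clear - B1 B2 C1 C2 C3. lia.
Qed.

(** * The machine program and its running time *)

(* Registers 0..15 double as real scalars of the compiled code, so the inputs they hold are
   first moved to their places in the array XA. *)
Definition move_in (i : nat) : list instr :=
  [IConst 101 (Z.of_nat (8 * i + 1)); IArith IAdd 101 101 100; RStore 101 i].

Definition prelude : list instr :=
  [IConst 101 3; IArith IMul 100 0 101] ++ flat_map move_in (seq 0 16).

Definition machine : program := prelude ++ comp (length prelude) main.

Definition start (n : nat) (orig : nat -> R) : st :=
  mkSt (fun v => if v =? 0 then n else 0) orig (fun _ _ => 0)
    (fun a i => if a =? 0 then orig i else if a =? 1 then (if i <? 16 then orig i else 0%R) else 0%R).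

Lemma code_at_flat P p F k j : (forall i, length (F i) = 3) -> code_at P p (flat_map F (seq 0 k)) -> j < k ->
  code_at P (p + 3 * j) (F j).
Proof.
  intros HF. revert p j. assert (HG : forall k a p j, code_at P p (flat_map F (seq a k)) -> j < k ->
    code_at P (p + 3 * j) (F (a + j))).
  { clear k. induction k as [|k IH]; intros a p j HC Hj; [lia|]. cbn [seq flat_map] in HC.
    apply code_at_app in HC as [C1 C2]. rewrite HF in C2. destruct j as [|j].
    - rewrite Nat.mul_0_r, !Nat.add_0_r. auto.
    - replace (p + 3 * S j) with (p + 3 + 3 * j) by lia. replace (a + S j) with (S a + j) by lia.
      apply IH; auto; lia. }
  intros p j. apply (HG k 0).
Qed.

Lemma prelude_ok P w m orig : (8 * Z.of_nat (lM m) + 256 + 3 * Z.of_nat (lN m) <= 2 ^ Z.of_nat w)%Z ->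
  6 <= lN m -> (forall i, 3 * lN m <= i -> orig i = 0%R) -> code_at P 0 prelude ->
  exists rr ii,
    steps P w 50 (mkState 0 orig (fun j => if j =? 0 then Z.of_nat (lN m) else 0%Z)) (mkState 50 rr ii) /\
    rel w m (start (lN m) orig) rr ii.
Proof.
  intros HW Hn Horig HC. set (n := lN m) in *. unfold prelude in HC. apply code_at_app in HC as [C1 C2].
  rewrite !code_at_cons in C1. destruct C1 as (C0 & C1 & _). cbn [length] in C2. change (0 + 2) with 2 in C2.
  (* Moving entry i writes register 3n + 8i + 1, beyond the input area, so no entry waiting to be
     moved is lost. The cells from 3n on that have not been written are still 0, the initial content
     of the other arrays. *)
  assert (HI : forall j, j <= 16 -> exists rr ii,
    steps P w (2 + 3 * j) (mkState 0 orig (fun j => if j =? 0 then Z.of_nat n else 0%Z))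
      (mkState (2 + 3 * j) rr ii) /\
    (forall i, i < 3 * n -> rr i = orig i) /\
    (forall i, i < j -> rr (3 * n + 8 * i + 1) = orig i) /\
    (forall x, 3 * n <= x -> (forall i, i < j -> x <> 3 * n + 8 * i + 1) -> rr x = 0%R) /\
    ii 100 = Z.of_nat (3 * n) /\
    forall v, v <> 100 -> v <> 101 -> ii v = if v =? 0 then Z.of_nat n else 0%Z).
  { induction j as [|j IH]; intros Hj.
    - eexists; eexists; split; [|split; [|split; [|split; [|split]]]].
      + eapply steps_S; [eapply st_iconst; [exact C0|lia]|].
        eapply (st_iarith _ _ _ _ _ _ _ _ _ (Z.of_nat (3 * n)) C1); [|lia].
        unfold eval_iop. rewrite upd_same, upd_other by lia. cbn [Nat.eqb]. lia.
      + auto.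
      + intros; lia.
      + intros x Hx _. auto.
      + rewrite upd_same; auto.
      + intros v Hv1 Hv2. rewrite !upd_other by auto. auto.
    - destruct IH as (rr & ii & S1 & R1 & R2 & R3 & I1 & I2); [lia|].
      pose proof (code_at_flat P 2 move_in 16 j (fun _ => eq_refl) C2 ltac:(lia)) as CF.
      unfold move_in in CF. rewrite !code_at_cons in CF. destruct CF as (D1 & D2 & D3 & _).
      eexists; eexists; split; [|split; [|split; [|split; [|split]]]].
      + replace (2 + 3 * S j) with ((2 + 3 * j) + 3) at 1 by lia. eapply steps_trans; [exact S1|].
        eapply steps_S; [eapply st_iconst; [exact D1|lia]|].
        eapply steps_S; [eapply (st_iarith _ _ _ _ _ _ _ _ _ (Z.of_nat (3 * n + 8 * j + 1)) D2)|].
        { unfold eval_iop. rewrite upd_same, upd_other by lia. rewrite I1. lia. }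
        { lia. }
        replace (2 + 3 * S j) with (S (S (S (2 + 3 * j)))) by lia.
        eapply st_rstore. exact D3.
      + rewrite upd_same, Nat2Z.id. intros i Hi. rewrite upd_other by lia. auto.
      + rewrite upd_same, Nat2Z.id. intros i Hi. destruct (Nat.eq_dec i j) as [->|].
        * rewrite upd_same. apply R1. lia.
        * rewrite upd_other by lia. apply R2; lia.
      + rewrite upd_same, Nat2Z.id. intros x Hx Hne. rewrite upd_other by (apply Hne; lia).
        apply R3; auto.
      + rewrite !upd_other by lia. auto.
      + intros v Hv1 Hv2. rewrite !upd_other by auto. auto. }
  destruct (HI 16 (le_n _)) as (rr & ii & S1 & R1 & R2 & R3 & I1 & I2).
  exists rr, ii. split; [exact S1|]. unfold start. constructor; cbn [iv rv ia ra].
  - intros v Hv. rewrite I2 by lia. destruct (v =? 0); split; auto; lia.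
  - intros a i Ha Hi. rewrite I2 by lia. destruct (Nat.eqb_spec (128 + i * 8 + a) 0); split; auto; lia.
  - exact I1.
  - intros v Hv. apply R1. lia.
  - intros i Hi. apply R1. fold n in Hi. lia.
  - intros a i Ha Hi. fold n. destruct (Nat.eqb_spec a 0); [lia|]. destruct (Nat.eqb_spec a 1) as [->|].
    + destruct (Nat.ltb_spec i 16).
      * replace (i * 8) with (8 * i) by lia. apply R2; auto.
      * apply R3; lia.
    + apply R3; lia.
Qed.

(** * From binary logarithms of naturals to the final bound *)

Lemma exp_beats x : 16 <= x -> x < 2 ^ (x - 7).
Proof.
  intros H. replace (x - 7) with (4 + (x - 11)) by lia. rewrite Nat.pow_add_r.
  pose proof (Nat.pow_gt_lin_r 2 (x - 11) ltac:(lia)). change (2 ^ 4) with 16. lia.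
Qed.

Lemma scale_large n : 2 ^ (2 ^ 16) <= n -> exists h, scale n h.
Proof.
  intros H0. assert (Hn : 0 < n) by (eapply Nat.lt_le_trans; [|exact H0]; apply Nat.neq_0_lt_0, Nat.pow_nonzero; discriminate).
  apply (proj1 (Nat.log2_le_pow2 _ _ ltac:(eassumption))) in H0.
  assert (HL : 0 < Nat.log2 n) by (eapply Nat.lt_le_trans; [|exact H0]; apply Nat.neq_0_lt_0, Nat.pow_nonzero; discriminate).
  apply (proj1 (Nat.log2_le_pow2 _ _ ltac:(eassumption))) in H0.
  destruct (Nat.log2_spec _ HL) as [A1 A2].
  set (l2 := Nat.log2 (Nat.log2 n)) in *.
  destruct (Nat.log2_spec l2 ltac:(lia)) as [B1 B2].
  set (l3 := Nat.log2 l2) in *.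
  (* Otherwise l2 < 2^(l2 - 7) <= 2^l3 <= l2. The first inequality uses l2 >= 16, which is why n is
     required to be at least 2^(2^16). *)
  assert (H3 : l3 + 8 <= l2).
  { destruct (Nat.le_gt_cases (l3 + 8) l2); auto. exfalso.
    pose proof (exp_beats l2 H0). assert (2 ^ (l2 - 7) <= 2 ^ l3) by (apply Nat.pow_le_mono_r; lia). lia. }
  set (h := l2 - (l3 + 7)).
  (* As h <= l2 < 2^(l3 + 1), the left side is at most 2^6 2^(l3 + 1) 2^(l2 - l3 - 7) = 2^l2; the 7
     subtracted in h cancels the constant. *)
  assert (Hd : 64 * (h * 2 ^ h) <= Nat.log2 n).
  { transitivity (2 ^ l2); auto. replace (2 ^ l2) with (64 * (2 ^ S l3 * 2 ^ h)).
    - apply Nat.mul_le_mono_l, Nat.mul_le_mono_r. unfold h; lia.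
    - change 64 with (2 ^ 6). rewrite <- !Nat.pow_add_r. f_equal. unfold h. lia. }
  exists h. constructor.
  - destruct (Nat.log2_spec n Hn) as [C1 _].
    assert (2 ^ 10 <= 2 ^ Nat.log2 n).
    { apply Nat.pow_le_mono_r; [lia|]. pose proof (Nat.pow_gt_lin_r 2 l2 ltac:(lia)). lia. }
    change (2 ^ 10) with 1024 in H. lia.
  - fold l2 l3. unfold h. lia.
  - unfold h; lia.
  - lia.
Qed.

Lemma lg_pow2_le a x : (INR (2 ^ a) <= x)%R -> (INR a <= lg x)%R.
Proof.
  intros H. unfold lg. assert (0 < ln 2)%R by (rewrite <- ln_1; apply ln_increasing; lra).
  apply Rmult_le_reg_r with (ln 2); auto. unfold Rdiv. rewrite Rmult_assoc, Rinv_l, Rmult_1_r by lra.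
  rewrite pow_INR in H. rewrite <- ln_pow by lra.
  change (INR 2) with 2%R in H. destruct (Rle_lt_or_eq_dec _ _ H) as [Hl|<-]; [|lra].
  apply Rlt_le, ln_increasing; auto. apply pow_lt; lra.
Qed.

Lemma lg_lt_pow2 a x : (0 < x)%R -> (x < INR (2 ^ a))%R -> (lg x < INR a)%R.
Proof.
  intros Hx H. unfold lg. assert (0 < ln 2)%R by (rewrite <- ln_1; apply ln_increasing; lra).
  apply Rmult_lt_reg_r with (ln 2); auto. unfold Rdiv. rewrite Rmult_assoc, Rinv_l, Rmult_1_r by lra.
  rewrite pow_INR in H. rewrite <- ln_pow by lra. change (INR 2) with 2%R in H.
  apply ln_increasing; auto.
Qed.

(** From h = l2 - l3 - 7 follows lg n < 2^(l2 + 1) = 2^(8 + h + l3) <= 256 2^h l2, so 1/2^h is at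
    most 256 lg lg n / lg n, and h <= lg lg n gives the second factor lg lg n. *)
Lemma time_bound n h t (C : R) : scale n h -> (0 <= C)%R ->
  (INR (2 ^ h) * INR t <= C * (INR n * INR n * INR h))%R ->
  (INR t <= 256 * C * INR n ^ 2 * (lg (lg (INR n))) ^ 2 / lg (INR n))%R.
Proof.
  intros [Hn Hh Hh1 Hd] HC Ht.
  destruct (Nat.log2_spec n ltac:(lia)) as [A1 A2]. set (L := Nat.log2 n) in *. clearbody L.
  assert (HL : 0 < L) by (apply Nat.neq_0_lt_0; intros E; rewrite E in Hh; cbn in Hh; clear - Hh Hh1; lia).
  destruct (Nat.log2_spec L HL) as [B1 B2]. set (l2 := Nat.log2 L) in *.
  assert (Hl2 : 0 < l2) by lia.
  destruct (Nat.log2_spec l2 Hl2) as [D1 _]. set (l3 := Nat.log2 l2) in *.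
  set (G := lg (INR n)). set (LL := lg G).
  assert (E1 : (INR L <= G)%R) by (apply lg_pow2_le, le_INR; auto).
  assert (E2 : (G < INR (S L))%R).
  { apply lg_lt_pow2; [apply (lt_INR 0); lia|]. apply lt_INR; auto. }
  assert (E3 : (INR l2 <= LL)%R).
  { apply lg_pow2_le. eapply Rle_trans; [|exact E1]. apply le_INR; auto. }
  assert (HG : (0 < G)%R) by (eapply Rlt_le_trans; [apply (lt_INR 0 L)|]; auto).
  assert (E4 : (INR h <= LL)%R) by (eapply Rle_trans; [|exact E3]; apply le_INR; lia).
  assert (E5 : S L <= 256 * 2 ^ h * l2).
  { transitivity (2 ^ S l2); [lia|]. rewrite Hh.
    replace (S (h + (l3 + 7))) with (8 + h + l3) by lia. rewrite !Nat.pow_add_r. change (2 ^ 8) with 256.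
    apply Nat.mul_le_mono_l. rewrite <- Hh; auto.
 }
  apply le_INR in E5. rewrite !mult_INR in E5. rewrite (INR_IZR_INZ 256) in E5. change (Z.of_nat 256) with 256%Z in E5.
  set (dR := INR (2 ^ h)) in *. set (T := INR t) in *. set (N := INR n) in *.
  assert (P1 : (0 <= dR)%R) by apply pos_INR. assert (P2 : (0 <= T)%R) by apply pos_INR.
  assert (P3 : (0 <= N)%R) by apply pos_INR. assert (P4 : (0 <= INR l2)%R) by apply pos_INR.
  assert (P5 : (0 <= INR h)%R) by apply pos_INR.
  assert (F1 : (G <= 256 * dR * LL)%R).
  { apply Rle_trans with (256 * dR * INR l2)%R; [lra|]. apply Rmult_le_compat_l; lra. }
  assert (F2 : (dR * T <= C * (N * N * LL))%R).
  { eapply Rle_trans; [exact Ht|]. repeat apply Rmult_le_compat_l; auto. apply Rmult_le_pos; auto. }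
  apply Rmult_le_reg_r with G; auto. unfold Rdiv. rewrite Rmult_assoc, Rinv_l, Rmult_1_r by lra.
  apply Rle_trans with (T * (256 * dR * LL))%R; [apply Rmult_le_compat_l; auto|].
  replace (T * (256 * dR * LL))%R with (256 * LL * (dR * T))%R by ring.
  replace (256 * C * N ^ 2 * LL ^ 2)%R with (256 * LL * (C * (N * N * LL)))%R by ring.
  apply Rmult_le_compat_l; auto. lra.
Qed.

(** 8 n^4 + 256 + 3n is below n^6, and n < 2^(log2 n + 1). *)
Lemma word_large n : 1000 <= n ->
  (8 * Z.of_nat (n * n * n * n) + 256 + 3 * Z.of_nat n <= 2 ^ Z.of_nat (word_size 6 n))%Z.
Proof.
  intros Hn. destruct (Nat.log2_spec n ltac:(lia)) as [_ A]. rewrite <- (Nat.add_1_r (Nat.log2 n)) in A.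
  unfold word_size. set (T := 2 ^ (Nat.log2 n + 1)) in *.
  assert (E : 2 ^ (6 * (Nat.log2 n + 1)) = T ^ 6) by (unfold T; rewrite <- Nat.pow_mul_r, Nat.mul_comm; reflexivity).
  assert (B : 8 * (n * n * n * n) + 256 + 3 * n <= T ^ 6).
  { transitivity (n ^ 6); [|apply Nat.pow_le_mono_l, Nat.lt_le_incl, A]. cbn [Nat.pow]. rewrite Nat.mul_1_r.
    assert (C1 : 1000 * n <= n * n) by (apply Nat.mul_le_mono_r; auto).
    assert (C2 : 1000 * n * (n * n * n * n) <= n * n * (n * n * n * n)) by (apply Nat.mul_le_mono_r; auto).
    assert (C3 : n * n <= n * n * (n * n)) by (apply le_mul1; lia).
    assert (C4 : n * n * n * n <= n * n * n * n * n) by (apply le_mul1; lia).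
    lia. }
  rewrite <- E in B. apply inj_le in B. rewrite Nat2Z.inj_pow in B.
  change (Z.of_nat 2) with 2%Z in B. lia.
Qed.

Lemma machine_ok n h x y : scale n h -> length x = n -> length y = n ->
  exists t s, run machine (word_size 6 n) t (init_state n x y) = Some s /\
    2 ^ h * t <= (50 + length machine * (640 * 3400)) * (n * n * h) /\
    forall k, k < n -> is_median (conv_terms x y k) (rreg s (2 * n + k)).
Proof.
  intros Hsc Hx Hy. pose proof (sc_n _ _ Hsc) as Hn. pose proof (sc_h1 _ _ Hsc) as Hh.
  set (w := word_size 6 n). set (m := mkLim (n * n * n * n) n).
  pose proof (word_large n Hn) as HW. fold w in HW. change (n * n * n * n) with (lM m) in HW.
  set (orig := rreg (init_state n x y)).
  assert (HC : code_at machine 0 machine) by (intros i z Hz; exact Hz).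
  unfold machine in HC at 2. apply code_at_app in HC as [C1 C2].
  destruct (prelude_ok machine w m orig HW) as (r1 & i1 & S1 & R1); auto.
  { simpl; lia. }
  { intros i Hi. unfold orig, init_state; cbn [rreg lN m] in *. simpl lN in Hi.
    destruct (Nat.ltb_spec i n), (Nat.ltb_spec i (2 * n)); auto; lia. }
  destruct (main_ok n h x y (start n orig) Hsc Hx) as (s' & t & Hex & Ht & Hmed).
  { reflexivity. }
  { unfold start, orig, init_state. constructor; cbn [ra rreg Nat.eqb]; intros.
    - destruct (Nat.ltb_spec i n); auto; lia.
    - destruct (Nat.ltb_spec (n + j) n); [lia|]. destruct (Nat.ltb_spec (n + j) (2 * n)); [|lia].
      f_equal. lia.
    - destruct (Nat.ltb_spec i 16); auto. destruct (Nat.ltb_spec i n); auto; lia. }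
  fold m in Hex.
  destruct (comp_ok machine w m HW ltac:(simpl; lia) _ _ _ _ Hex 50 r1 i1) as (r2 & i2 & k & S2 & R2 & Hk).
  { vm_compute; reflexivity. }
  { exact R1. }
  { exact C2. }
  assert (Hlen : length machine = 50 + length (comp 50 main)) by (unfold machine; rewrite length_app; reflexivity).
  exists (50 + k), (mkState (50 + length (comp 50 main)) r2 i2). split; [|split].
  - eapply steps_run; [eapply steps_trans; [exact S1|exact S2]| |apply le_n].
    (* The machine halts by running off the end of its code. *)
    unfold step; cbn [pc]. rewrite (proj2 (nth_error_None _ _)); [reflexivity|]. rewrite Hlen. apply le_n.
  - specialize (Hk (length machine)). revert Hk Ht. rewrite Hlen. generalize (length (comp 50 main)) as l.
    generalize (640 * 3400) as B. intros B l Hk Ht. specialize (Hk ltac:(lia)).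
    (* Absorbs the 50 = 2 + 3 * 16 steps of the prelude. *)
    assert (Hd : 2 ^ h <= n * n * h).
    { pose proof (sc_d _ _ Hsc). pose proof (Nat.log2_lt_lin n ltac:(lia)).
      assert (2 ^ h <= h * 2 ^ h) by (rewrite Nat.mul_comm; apply le_mul1; lia). nia. }
    rewrite Nat.mul_add_distr_l, Nat.mul_add_distr_r. apply Nat.add_le_mono.
    + rewrite (Nat.mul_comm _ 50). apply Nat.mul_le_mono_l; auto.
    + transitivity (2 ^ h * ((50 + l) * t)); [apply Nat.mul_le_mono_l; auto|].
      replace (2 ^ h * ((50 + l) * t)) with ((50 + l) * (2 ^ h * t)) by ring.
      rewrite <- Nat.mul_assoc. apply Nat.mul_le_mono_l; auto.
  - intros k0 Hk0. cbn [rreg]. rewrite (rel_raw _ _ _ _ _ R2); [auto|]. unfold m; cbn [lN]. lia.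
Qed.

Lemma lt_0_machine_const : (0 < 50 + INR (length machine) * INR (640 * 3400))%R.
Proof. pose proof (pos_INR (length machine)). pose proof (pos_INR (640 * 3400)). nra. Qed.

Open Scope R_scope.

(* There is a real-RAM program P (with word size K*(floor(lg n)+1)) and constants
   C, N0 such that for all n >= N0 and all x, y in R^n, P halts within
   C * n^2 (lg lg n)^2 / lg n steps with the k-th (median,-) convolution entry
   median_{i=0..k}(x_i - y_{k-i}) in real register 2n+k, for every k < n. *)
Theorem theorem14 :
  exists (P : program) (K N0 : nat) (C : R),
    0 < C /\
    forall (n : nat) (x y : list R),
      (N0 <= n)%nat -> length x = n -> length y = n ->
      exists (t : nat) (s : state),
        run P (word_size K n) t (init_state n x y) = Some s /\
        INR t <= C * INR n ^ 2 * (lg (lg (INR n))) ^ 2 / lg (INR n) /\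
        forall k : nat, (k < n)%nat ->
          is_median (conv_terms x y k) (rreg s (2 * n + k)%nat).
Proof.
  exists machine, 6%nat, (2 ^ 2 ^ 16)%nat, (256 * (50 + INR (length machine) * INR (640 * 3400)))%R.
  split; [apply Rmult_lt_0_compat; [lra|exact lt_0_machine_const]|].
  intros n x y Hn Hx Hy. apply scale_large in Hn as [h Hsc].
  destruct (machine_ok n h x y Hsc Hx Hy) as (t & s & Hrun & Ht & Hmed).
  exists t, s. split; [exact Hrun|split; [|exact Hmed]].
  apply (time_bound n h); [exact Hsc|apply Rlt_le, lt_0_machine_const|].
  apply le_INR in Ht. rewrite (mult_INR (2 ^ h)), (mult_INR _ (n * n * h)), plus_INR, (mult_INR (length machine)),
    (mult_INR (n * n)), (mult_INR n) in Ht.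
  replace (INR 50) with 50%R in Ht by (simpl; lra). exact Ht.
Qed.
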